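(* Let $\omega\in\mathcal{I}\cup\mathcal{R}$ and $g\in\mathcal{C}^1(\omega^\star)$. Then the following assertions are equivalent: (i) $g\in\mathcal{C}^1_0(\omega^\star)$; (ii) $\lim_{r\to1^-}\|g-g_r\|_{\mathcal{C}^1(\omega^\star)}=0$; (iii) there is a sequence of polynomials $\{P_n\}$ such that $\lim_{n\to\infty}\|g-P_n\|_{\mathcal{C}^1(\omega^\star)}=0$.
   Context: $\mathbb{D}$ is the open unit disc, $\mathbb{T}$ its boundary, $\mathcal{H}(\mathbb{D})$ the set of analytic functions in $\mathbb{D}$, $dA=\frac{dx\,dy}{\pi}$. A weight is a function $\omega:\mathbb{D}\to(0,\infty)$ integrable over $\mathbb{D}$; it is radial if $\omega(z)=\omega(|z|)$. For a radial weight put $\psi_\omega(r)=\frac{1}{\omega(r)}\int_r^1\omega(s)\,ds$. $\mathcal{R}$: continuous radial weights for which there is $C\ge1$ with $C^{-1}(1-r)\le\psi_\omega(r)\le C(1-r)$ for all $0\le r<1$. $\mathcal{I}$: continuous radial weights with $\lim_{r\to1^-}\frac{\psi_\omega(r)}{1-r}=\infty$. $\omega^\star(z)=\int_{|z|}^1\omega(s)\log\frac{s}{|z|}\,s\,ds$, $z\in\mathbb{D}\setminus\{0\}$. For an interval $I\subset\mathbb{T}$ of Lebesgue measure $|I|$, $S(I)=\{re^{it}\in\mathbb{D}:e^{it}\in I,\ 1-|I|\le r<1\}$, and $\omega(E)=\int_E\omega\,dA$. $\mathcal{C}^1(\omega^\star)$ consists of $g\in\mathcal{H}(\mathbb{D})$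 with $$\|g\|^2_{\mathcal{C}^1(\omega^\star)}=|g(0)|^2+\sup_{I\subset\mathbb{T}}\frac{\int_{S(I)}|g'(z)|^2\omega^\star(z)\,dA(z)}{\omega(S(I))}<\infty ,$$ and $\mathcal{C}^1_0(\omega^\star)$ consists of $g\in\mathcal{H}(\mathbb{D})$ with $\lim_{|I|\to0}\frac{\int_{S(I)}|g'|^2\omega^\star\,dA}{\omega(S(I))}=0$. For $0<r<1$, $g_r(z)=g(rz)$. *)

(* Defs.v *)
From HB Require Import structures.
From mathcomp Require Import all_boot all_order all_algebra.
From mathcomp Require Import complex.
From mathcomp Require Import all_classical all_reals all_analysis.

Set Implicit Arguments.
Unset Strict Implicit.
Unset Printing Implicit Defensive.

Import Order.TTheory GRing.Theory Num.Theory numFieldNormedType.Exports.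

Local Open Scope classical_set_scope.
Local Open Scope ring_scope.
Local Open Scope complex_scope.

(* [R[i]] packaged as a numFieldType, so that it carries the topology and the
   normed module structure (over itself) that [derivable] and [derive1] need:
   [derivable g z 1] is then complex differentiability of [g] at [z], and
   [derive1 g z] is the complex derivative. *)
Definition Cplx (R : realType) : numFieldType := R[i].

Section weights.
Context {R : realType}.
Local Notation C := (Cplx R).
Local Notation mu := (@lebesgue_measure R).

(* The modulus as an element of [R] (the library's [`|z|] lies in [C]). *)
Definition modulus (z : C) : R := Normc.normc z.

Definition ofR (r : R) : C := r%:C.

Definition unit_disc : set C := [set z | modulus z < 1].

Definition cis (t : R) : C := cos t +i* sin t.

Definition plane (p : measurableTypeR R * measurableTypeR R) : C :=
  p.1 +i* p.2.

Lemma invpi_ge0 : 0 <= (pi : R)^-1.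
Proof. by rewrite invr_ge0 pi_ge0. Qed.

Definition dA :
    {measure set (measurableTypeR R * measurableTypeR R) -> \bar R} :=
  mscale (NngNum invpi_ge0) (mu \x mu)%E.

Definition area_integral (E : set C) (f : C -> \bar R) : \bar R :=
  (\int[dA]_(p in plane @^-1` E) f (plane p))%E.

(* Functions on the disc are total functions on [C] of which only the values
   on [unit_disc] are used; as the disc is open, continuity and
   differentiability at its points do not depend on the other values. *)
Definition weight (w : C -> R) : Prop :=
  (forall z, unit_disc z -> 0 < w z) /\
  dA.-integrable (plane @^-1` unit_disc) (fun p => (w (plane p))%:E).

Definition radial (w : C -> R) : Prop :=
  forall z, unit_disc z -> w z = w (ofR (modulus z)).

Definition continuous_radial_weight (w : C -> R) : Prop :=
  [/\ weight w, radial w & forall z, unit_disc z -> {for z, continuous w}].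

Definition psi (w : C -> R) (r : R) : R :=
  (w (ofR r))^-1 * \int[mu]_(s in `]r, 1[) w (ofR s).

Definition class_R (w : C -> R) : Prop :=
  continuous_radial_weight w /\
  exists2 K : R, 1 <= K &
    forall r : R, 0 <= r < 1 -> K^-1 * (1 - r) <= psi w r <= K * (1 - r).

Definition class_I (w : C -> R) : Prop :=
  continuous_radial_weight w /\ psi w r / (1 - r) @[r --> 1^'-] --> +oo.

Definition wstar (w : C -> R) (z : C) : \bar R :=
  (\int[mu]_(s in `]modulus z, 1%R[)
     (w (ofR s) * ln (s / modulus z) * s)%:E)%E.

Definition weight_of (w : C -> R) (E : set C) : \bar R :=
  area_integral E (fun z => (w z)%:E).

(* [I] is a nondegenerate arc of the unit circle, of arc length [l]; each of
   its endpoints may belong to [I] or not. *)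
Definition arc_of_length (I : set C) (l : R) : Prop :=
  0 < l <= 2 * pi /\
  exists (a : R) (J : set R),
    [/\ `]a, a + l[ `<=` J, J `<=` `[a, a + l] & I = cis @` J].

(* [r] is a polar radius, so it stays nonnegative even when [1 < l]. *)
Definition carleson_square (I : set C) (l : R) : set C :=
  [set z | exists r t : R,
    [/\ z = ofR r * cis t, I (cis t), 0 <= r & 1 - l <= r < 1]].

Definition holomorphic_disc (g : C -> C) : Prop :=
  forall z, unit_disc z -> derivable g z 1.

Definition carleson_quotient (w : C -> R) (g : C -> C) (I : set C) (l : R)
    : \bar R :=
  (area_integral (carleson_square I l)
     (fun z => (modulus (derive1 g z) ^+ 2)%:E * wstar w z)
   / weight_of w (carleson_square I l))%E.

Definition C1_norm (w : C -> R) (g : C -> C) : \bar R :=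
  sqrte ((modulus (g 0) ^+ 2)%:E +
    ereal_sup [set q | exists I l,
      arc_of_length I l /\ q = carleson_quotient w g I l])%E.

Definition C1 (w : C -> R) (g : C -> C) : Prop :=
  holomorphic_disc g /\ (C1_norm w g < +oo)%E.

Definition C1_0 (w : C -> R) (g : C -> C) : Prop :=
  holomorphic_disc g /\
  forall e : R, 0 < e -> exists2 d : R, 0 < d &
    forall I l, arc_of_length I l -> l < d ->
      (carleson_quotient w g I l < e%:E)%E.

Definition dilate (r : R) (g : C -> C) : C -> C := fun z => g (ofR r * z).

End weights.

(* Main.v *)
Require Import Defs.
From mathcomp Require Import all_boot all_order all_algebra.
From mathcomp Require Import complex.
From mathcomp Require Import all_classical all_reals all_analysis.
From mathcomp Require Import measurable_realfun.
From mathcomp Require Import ring lra.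

Set Implicit Arguments.
Unset Strict Implicit.
Unset Printing Implicit Defensive.

Import Order.TTheory GRing.Theory Num.Theory numFieldNormedType.Exports.

Local Open Scope classical_set_scope.
Local Open Scope ring_scope.

(** Everything is expressed through [phi], the derivative of [g], and its
    energy over a Carleson square [S(I)], the integral of [|phi| ^ 2] against
    [wstar]. In polar coordinates the weight of [S(I)] is the mass
    [pi^-1 * l * tail w (1 - l)], where [l] is the length of [I] and [tail w r]
    integrates [w(s) s] from [r] to [1]. The classes enter through the bound
    [psi w r >= c * (1 - r)] near the boundary, which makes the tail doubling
    ([class_tail_doubling]); hence [wstar w z] is comparable with
    [(1 - |z|) * tail w |z|] near the circle.

    From polynomials to the vanishing condition: if [phi] is bounded, its energy
    over [S(I)] is at most a multiple of [l ^ 2] times the mass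
    ([wstar_square_small]), so polynomials satisfy the condition, which is
    stable under approximation in norm ([poly_approx_vanishing]).

    From dilations to polynomials: [dilate r g] is holomorphic beyond the closed
    disc, so it is a uniform limit of polynomials together with its derivative,
    and a uniformly small derivative has small quotients
    ([dilation_poly_approx]).

    From the vanishing condition to dilations: let [h = 1 - r] be small. For
    arcs of length bounded below it suffices that the energy of
    [phi(z) - r phi(r z)] over the whole disc tends to [0]
    ([energy_total_dilate]), and it does as [phi] has finite energy. For a
    short arc, [phi] has small energy over the square and it remains to
    estimate [z |-> phi(r z)]. If [h <= l], the dilated square lies in a square
    of length [2 * l] ([energy_dilate_large]). If [l < h], the dilated function
    is evaluated at distance about [h] from the circle; there the mean value
    inequality and the vanishing condition at length [3 * h] bound
    [|phi| ^ 2] by a small multiple of [h ^ -2] ([carleson_pointwise]), and the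
    bounded case gives a small multiple of [(l / h) ^ 2] times the mass
    ([energy_dilate_small]). Doubling compares the masses of the squares
    involved ([dilation_energy_const]).

    The function theory is derived from pointwise differentiability: Green's
    formula by bisection ([segint_green]), Cauchy's formula by contracting a
    circle to a point ([cauchy]), then polynomial approximation
    ([holomorphic_poly_approx1]) and mean values ([mean_value]). Integration
    over squares rests on polar coordinates for nonnegative measurable
    functions ([full_polar], [sector_integral]). *)

(** * Integrals over segments and Green's formula *)

Section cousin.
Context {R : realType}.

Definition quartering (Phi : R -> R -> R -> R -> R) (x0 y0 L M : R) :=
  forall x y l m, 0 < l -> 0 < m -> x0 <= x -> y0 <= y ->
    x + l + l <= x0 + L -> y + m + m <= y0 + M ->
    Phi x y (l + l) (m + m) =
      Phi x y l m + Phi (x + l) y l m + Phi x (y + m) l m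
      + Phi (x + l) (y + m) l m.

Lemma half_exp0 (c : R) : 0 < c -> forall d : R, 0 < d -> exists n : nat, c / 2 ^+ n < d.
Proof.
move=> c0 d d0.
have [n hn] : exists n : nat, c / d < n%:R.
  by exists (Num.bound (c/d)); exact: archi_boundP (ltW (divr_gt0 c0 d0)).
exists n; rewrite ltr_pdivrMr ?exprn_gt0// mulrC -ltr_pdivrMr//.
apply: lt_le_trans hn _; rewrite -natrX ler_nat.
by apply: ltnW; apply: ltn_expl.
Qed.

(** Goursat's bisection. If [Phi] did not vanish, one of the four quarters of
    the rectangle would carry at least a quarter of its absolute value;
    iterating gives rectangles of sides [L / 2 ^ n] and [M / 2 ^ n] shrinking to
    a point, where they contradict the local bound. *)
Lemma additive_rectangle_eq0 (Phi : R -> R -> R -> R -> R) (x0 y0 L M : R) :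
  0 < L -> 0 < M -> quartering Phi x0 y0 L M ->
  (forall x y, x0 <= x <= x0 + L -> y0 <= y <= y0 + M ->
    forall e : R, 0 < e -> exists2 d : R, 0 < d & forall x' y' k,
      0 < k < d -> x0 <= x' -> x' <= x <= x' + L * k -> x' + L * k <= x0 + L ->
      y0 <= y' -> y' <= y <= y' + M * k -> y' + M * k <= y0 + M ->
      `|Phi x' y' (L * k) (M * k)| <= e * k ^+ 2) ->
  Phi x0 y0 L M = 0.
Proof.
move=> L0 M0 PhiD loc.
apply/eqP/negPn/negP => Phi0.
pose e := `|Phi x0 y0 L M| / 2.
have e0 : 0 < e by rewrite divr_gt0// normr_gt0.
pose k (n : nat) : R := (2 ^+ n)^-1.
have k0 n : 0 < k n by rewrite invr_gt0 exprn_gt0.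
have kS n : k n = k n.+1 + k n.+1.
  by rewrite /k exprS; field; rewrite expf_eq0 andbC pnatr_eq0.
pose bad (n : nat) (p : R * R) :=
  [/\ x0 <= p.1, p.1 + L * k n <= x0 + L, y0 <= p.2, p.2 + M * k n <= y0 + M &
    e * (k n) ^+ 2 < `|Phi p.1 p.2 (L * k n) (M * k n)|].
have step n p : bad n p -> exists q, bad n.+1 q /\
   [/\ p.1 <= q.1, q.1 + L * k n.+1 <= p.1 + L * k n, p.2 <= q.2 &
       q.2 + M * k n.+1 <= p.2 + M * k n].
  case: p => x y [/= h1 h2 h3 h4].
  have Lk : 0 < L * k n.+1 by rewrite mulr_gt0.
  have Mk : 0 < M * k n.+1 by rewrite mulr_gt0.
  rewrite kS !mulrDr in h2 h4 *.
  rewrite PhiD //; try lra.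
  move=> h5; apply: contrapT => /forallNP nb.
  have nb' q : x <= q.1 -> q.1 + L * k n.+1 <= x + (L * k n.+1 + L * k n.+1) ->
    y <= q.2 -> q.2 + M * k n.+1 <= y + (M * k n.+1 + M * k n.+1) ->
    `|Phi q.1 q.2 (L * k n.+1) (M * k n.+1)| <= e * k n.+1 ^+ 2.
    move=> q1 q2 q3 q4; rewrite leNgt; apply/negP => q5; apply: (nb q).
    by split=> //; split=> //; lra.
  have b1 := nb' (x, y); have b2 := nb' (x + L * k n.+1, y).
  have b3 := nb' (x, y + M * k n.+1); have b4 := nb' (x + L * k n.+1, y + M * k n.+1).
  rewrite /= in b1 b2 b3 b4.
  have {}b1 := b1 ltac:(clear -Lk Mk; lra) ltac:(clear -Lk Mk; lra) ltac:(clear -Lk Mk; lra) ltac:(clear -Lk Mk; lra).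
  have {}b2 := b2 ltac:(clear -Lk Mk; lra) ltac:(clear -Lk Mk; lra) ltac:(clear -Lk Mk; lra) ltac:(clear -Lk Mk; lra).
  have {}b3 := b3 ltac:(clear -Lk Mk; lra) ltac:(clear -Lk Mk; lra) ltac:(clear -Lk Mk; lra) ltac:(clear -Lk Mk; lra).
  have {}b4 := b4 ltac:(clear -Lk Mk; lra) ltac:(clear -Lk Mk; lra) ltac:(clear -Lk Mk; lra) ltac:(clear -Lk Mk; lra).
  move: h5; apply/negP; rewrite -leNgt.
  apply: le_trans (ler_normD _ _) _.
  apply: le_trans (lerD (ler_normD _ _) b4) _.
  apply: le_trans (lerD (lerD (ler_normD _ _) b3) (lexx _)) _.
  apply: le_trans (lerD (lerD (lerD b1 b2) (lexx _)) (lexx _)) _.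
  by rewrite le_eqVlt; apply/orP; left; apply/eqP; ring.
(* each bad rectangle has a bad quarter; [p] is only a default value *)
pose next n p := xget p [set q | bad n.+1 q /\
   [/\ p.1 <= q.1, q.1 + L * k n.+1 <= p.1 + L * k n, p.2 <= q.2 &
       q.2 + M * k n.+1 <= p.2 + M * k n]].
pose fix s n := if n is m.+1 then next m (s m) else (x0, y0).
have bads n : bad n (s n).
  elim: n => [|n /step[q hq]] /=; last by rewrite /next; case: xgetP => [? _ []|/(_ q)].
  rewrite /bad /= /k expr0 invr1 !mulr1 expr1n mulr1 !lexx; split=> //.
  by rewrite /e ltr_pdivrMr// ltr_pMr ?normr_gt0//; lra.
have nexts n : [/\ (s n).1 <= (s n.+1).1, (s n.+1).1 + L * k n.+1 <= (s n).1 + L * k n,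
   (s n).2 <= (s n.+1).2 & (s n.+1).2 + M * k n.+1 <= (s n).2 + M * k n].
  have [q hq] := step n _ (bads n).
  by rewrite /= /next; case: xgetP => [? _ []|/(_ q)].
have lim (u : R ^nat) (N : R) : (forall n, u n <= u n.+1) ->
   (forall n, u n.+1 + N * k n.+1 <= u n + N * k n) -> 0 < N ->
   exists x, forall n, u n <= x <= u n + N * k n.
  move=> u1 u2 N0.
  have uD n m : u n <= u (n + m)%N /\ u (n + m)%N + N * k (n + m)%N <= u n + N * k n.
    elim: m => [|m [h1 h2]]; first by rewrite addn0.
    rewrite addnS; split; first exact: le_trans h1 (u1 _).
    exact: le_trans (u2 _) h2.
  have ub n m : u m <= u n + N * k n.
    have kk j : 0 < N * k j by rewrite mulr_gt0.
    case: (leqP m n) => mn.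
      have [h _] := uD m (n - m)%N; rewrite subnKC// in h.
      by apply: le_trans h _; rewrite lerDl ltW.
    have [_ h] := uD n (m - n)%N; rewrite subnKC 1?ltnW// in h.
    by apply: le_trans h; rewrite lerDl ltW.
  have hs : has_sup (range u).
    split; first by exists (u 0%N); exists 0%N.
    by exists (u 0%N + N * k 0%N) => _ [m _ <-].
  exists (sup (range u)) => n; apply/andP; split.
    by apply: ub_le_sup; [case: hs|exists n].
  by apply: ge_sup; [case: hs|move=> _ [m _ <-]].
have [x hx] := lim (fun n => (s n).1) L (fun n => let: And4 a _ _ _ := nexts n in a)
   (fun n => let: And4 _ a _ _ := nexts n in a) L0.
have [y hy] := lim (fun n => (s n).2) M (fun n => let: And4 _ _ a _ := nexts n in a)
   (fun n => let: And4 _ _ _ a := nexts n in a) M0.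
have hk0 : k 0%N = 1 by rewrite /k expr0 invr1.
have [||d d0 hd] := loc x y _ _ e e0.
- by have := hx 0%N; rewrite /= hk0 mulr1.
- by have := hy 0%N; rewrite /= hk0 mulr1.
have [n hn] := half_exp0 (@ltr01 R) d0; rewrite mul1r in hn.
have [b1 b2 b3 b4 b5] := bads n.
have := hd (s n).1 (s n).2 (k n); rewrite k0 hn /= => /(_ isT b1 (hx n) b2 b3 (hy n) b4).
by rewrite leNgt b5.
Qed.
End cousin.

Section segment_integral.
Context {R : realType}.
Local Notation mu := (@lebesgue_measure R).

Definition cont_on (a b : R) (f : R -> R) :=
  forall t, a <= t <= b -> {for t, continuous f}.

Definition segint (a b : R) (f : R -> R) : R := \int[mu]_(t in `[a, b]) f t.

Lemma cont_on_sub a b a' b' f : a <= a' -> b' <= b -> cont_on a b f ->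
  cont_on a' b' f.
Proof. by move=> aa bb cf t /andP[h1 h2]; apply: cf; lra. Qed.

Lemma cont_on_integrable a b f : cont_on a b f ->
  mu.-integrable `[a, b] (EFin \o f).
Proof.
move=> cf; apply: continuous_compact_integrable; first exact: segment_compact.
by apply: continuous_in_subspaceT => t; rewrite inE /= in_itv /=; exact: cf.
Qed.

Lemma segint_split a b c f : a <= b -> b <= c -> cont_on a c f ->
  segint a c f = segint a b f + segint b c f.
Proof.
move=> ab bc cf; have ic := cont_on_integrable cf.
have := @Rintegral_itvB R f (BLeft a) (BRight c) b ic.
rewrite !bnd_simp => /(_ ab bc) h.
rewrite /segint -(@Rintegral_itv_obnd_cbnd _ b (BRight c)); last first.
  by apply: integrableS ic => //; apply: subset_itv; rewrite bnd_simp.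
by rewrite -h addrC subrK.
Qed.

Lemma segintD a b f g : cont_on a b f -> cont_on a b g ->
  segint a b (fun t => f t + g t) = segint a b f + segint a b g.
Proof. by move=> cf cg; rewrite /segint RintegralD//; exact: cont_on_integrable. Qed.

Lemma segintB a b f g : cont_on a b f -> cont_on a b g ->
  segint a b (fun t => f t - g t) = segint a b f - segint a b g.
Proof. by move=> cf cg; rewrite /segint RintegralB//; exact: cont_on_integrable. Qed.

Lemma segintZ a b c f : cont_on a b f ->
  segint a b (fun t => c * f t) = c * segint a b f.
Proof. by move=> cf; rewrite /segint RintegralZl//; exact: cont_on_integrable. Qed.

Lemma segint_cst a b c : a <= b -> segint a b (fun=> c) = c * (b - a).
Proof.
move=> ab; rewrite /segint Rintegral_cst//= lebesgue_measure_itv/= lte_fin.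
by case: ltgtP ab => //= -> _; rewrite subrr.
Qed.

Lemma cont_on_cst a b c : cont_on a b (fun=> c).
Proof. by move=> t _; exact: cst_continuous. Qed.

Lemma cont_onB a b f g : cont_on a b f -> cont_on a b g ->
  cont_on a b (fun t => f t - g t).
Proof. by move=> cf cg t ht; apply: continuousB; [exact: cf|exact: cg]. Qed.

Lemma eq_segint a b f g : (forall t, a <= t <= b -> f t = g t) ->
  segint a b f = segint a b g.
Proof. by move=> h; apply: eq_Rintegral => t; rewrite inE /= in_itv /=; exact: h. Qed.

Lemma le_segint a b f g : cont_on a b f -> cont_on a b g ->
  (forall t, a <= t <= b -> f t <= g t) -> segint a b f <= segint a b g.
Proof.
move=> cf cg h; apply: le_Rintegral; [by []|exact: cont_on_integrable..|].
by move=> t; rewrite /= in_itv /=; exact: h.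
Qed.

Lemma segint_near a b c e f : a <= b -> cont_on a b f ->
  (forall t, a <= t <= b -> `|f t - c| <= e) ->
  `|segint a b f - c * (b - a)| <= e * (b - a).
Proof.
move=> ab cf h; rewrite -(segint_cst c ab) -segintB//; last exact: cont_on_cst.
have hc := cont_onB cf (@cont_on_cst a b c).
rewrite ler_norml -mulNr -!(segint_cst _ ab); apply/andP; split;
  by apply: le_segint => //; [exact: cont_on_cst..|move=> t /h]; rewrite ler_norml => /andP[].
Qed.

Lemma segint_bound a b e f : a <= b -> cont_on a b f ->
  (forall t, a <= t <= b -> `|f t| <= e) -> `|segint a b f| <= e * (b - a).
Proof.
move=> ab cf h; have := @segint_near a b 0 e f ab cf.
by rewrite mul0r subr0; apply => t; rewrite subr0; exact: h.
Qed.

(** The difference of the two sides is additive under quartering, and the common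
    partial derivative [q] cancels in it up to a small multiple of [k ^+ 2], so
    that it vanishes by bisection. Only a pointwise expansion is assumed,
    because a complex derivative is not yet known to be continuous when the
    formula is applied. *)
Lemma segint_green (U V : R -> R -> R) (s0 s1 t0 t1 : R) :
  s0 < s1 -> t0 < t1 ->
  (forall s, s0 <= s <= s1 -> cont_on t0 t1 (U s)) ->
  (forall t, t0 <= t <= t1 -> cont_on s0 s1 (V ^~ t)) ->
  (forall s t, s0 <= s <= s1 -> t0 <= t <= t1 -> exists q : R,
     forall e : R, 0 < e -> exists2 d : R, 0 < d & forall s' t' l m,
      0 < l < d -> 0 < m < d -> s0 <= s' -> s' <= s <= s' + l -> s' + l <= s1 ->
      t0 <= t' -> t' <= t <= t' + m -> t' + m <= t1 ->
      (forall x, t' <= x <= t' + m ->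
         `|U (s' + l) x - U s' x - q * l| <= e * (l + m)) /\
      (forall x, s' <= x <= s' + l ->
         `|V x (t' + m) - V x t' - q * m| <= e * (l + m))) ->
  segint t0 t1 (U s1) - segint t0 t1 (U s0) =
  segint s0 s1 (V ^~ t1) - segint s0 s1 (V ^~ t0).
Proof.
move=> s01 t01 cU cV loc.
pose Phi x y l m := (segint y (y + m) (U (x + l)) - segint y (y + m) (U x)) -
   (segint x (x + l) (V ^~ (y + m)) - segint x (x + l) (V ^~ y)).
have L0 : 0 < s1 - s0 by lra.
have M0 : 0 < t1 - t0 by lra.
have eL : s0 + (s1 - s0) = s1 by ring.
have eM : t0 + (t1 - t0) = t1 by ring.
suff : Phi s0 t0 (s1 - s0) (t1 - t0) = 0.
  by rewrite /Phi eL eM => /eqP; rewrite subr_eq0 => /eqP.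
apply: additive_rectangle_eq0 => //.
  move=> x y l m l0 m0 x0 y0; rewrite eL eM => xl ym; rewrite /Phi.
  have sU s : s0 <= s <= s1 -> segint y (y + (m + m)) (U s) =
     segint y (y + m) (U s) + segint (y + m) (y + m + m) (U s).
    move=> hs; rewrite addrA; apply: segint_split; try lra.
    by apply: cont_on_sub (cU s hs); lra.
  have sV t : t0 <= t <= t1 -> segint x (x + (l + l)) (V ^~ t) =
     segint x (x + l) (V ^~ t) + segint (x + l) (x + l + l) (V ^~ t).
    move=> ht; rewrite addrA; apply: segint_split; try lra.
    by apply: cont_on_sub (cV t ht); lra.
  by rewrite !sU ?sV ?addrA; try lra; ring.
move=> x y; rewrite eL eM => hx hy e e0.
have [q hq] := loc x y hx hy.
move: L0 M0 eL eM; move: (s1 - s0) (t1 - t0) => L M L0 M0 eL eM.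
have LM0 : 0 < (L + M) ^+ 2 by rewrite exprn_gt0//; lra.
have [d d0 hd] := hq _ (divr_gt0 e0 LM0).
have LM0' : 0 < L + M by lra.
exists (d / (L + M)); first by rewrite divr_gt0.
move=> x' y' k /andP[k0 kd] h1 h2 h3 h4 h5 h6.
rewrite ltr_pdivlMr// in kd.
have Lk : 0 < L * k by rewrite mulr_gt0.
have Mk : 0 < M * k by rewrite mulr_gt0.
have [||hU hV] := hd x' y' (L * k) (M * k) _ _ h1 h2 h3 h4 h5 h6.
- by rewrite Lk /=; lra.
- by rewrite Mk /=; lra.
have hs1 : s0 <= x' + L * k <= s1 by apply/andP; split=> //; lra.
have hs0 : s0 <= x' <= s1 by apply/andP; split=> //; lra.
have ht1 : t0 <= y' + M * k <= t1 by apply/andP; split=> //; lra.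
have ht0 : t0 <= y' <= t1 by apply/andP; split=> //; lra.
have cU1 := cont_on_sub h4 h6 (cU _ hs1).
have cU0 := cont_on_sub h4 h6 (cU _ hs0).
have cV1 := cont_on_sub h1 h3 (cV _ ht1).
have cV0 := cont_on_sub h1 h3 (cV _ ht0).
have yM : y' <= y' + M * k by rewrite lerDl ltW.
have xL : x' <= x' + L * k by rewrite lerDl ltW.
have bU := segint_near yM (cont_onB cU1 cU0) hU.
have bV := segint_near xL (cont_onB cV1 cV0) hV.
rewrite !segintB// in bU bV.
rewrite /Phi; set A := segint y' _ (U _) - _ in bU *; set B := segint x' _ _ - _ in bV *.
have eU : y' + M * k - y' = M * k by ring.
have eV : x' + L * k - x' = L * k by ring.
rewrite eU in bU; rewrite eV in bV.
have -> : A - B = (A - q * (L * k) * (M * k)) - (B - q * (M * k) * (L * k)) by ring.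
apply: le_trans (ler_normB _ _) _; apply: le_trans (lerD bU bV) _.
rewrite le_eqVlt; apply/orP; left; apply/eqP; field.
by rewrite gt_eqF.
Qed.

End segment_integral.

(** * Complex derivatives as first-order expansions *)

Section derivative_expansion.
Context {K : numFieldType}.

Definition expansion_at (f : K -> K) (x df : K) := forall e : K, 0 < e ->
  exists2 d : K, 0 < d & forall y, `|y - x| < d ->
    `|f y - f x - df * (y - x)| <= e * `|y - x|.

Lemma derivable_expansion (f : K -> K) x : derivable f x 1 ->
  expansion_at f x (derive1 f x).
Proof.
move=> df e e0.
have : h^-1 *: (f (h *: 1 + x) - f x) @[h --> 0^'] --> derive1 f x.
  by rewrite derive1E; exact: df.
move/cvgr_dist_le => /(_ e e0) /nbhs_ballP[d /= d0 hd].
exists d => // y yx.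
have [->|yx0] := eqVneq y x; first by rewrite !subrr mulr0 subr0 normr0 mulr0.
have yx0' : y - x != 0 by rewrite subr_eq0.
have := hd (y - x); rewrite /ball/= sub0r normrN => /(_ yx yx0').
rewrite /GRing.scale/= mulr1 subrK => h.
rewrite -(ler_pM2r (x := `|y - x|)) ?normr_gt0// -normrM mulrBl in h.
rewrite mulrAC mulVf// mul1r distrC in h.
exact: h.
Qed.

Lemma expansion_derive1 (f : K -> K) x df : expansion_at f x df ->
  derivable f x 1 /\ derive1 f x = df.
Proof.
move=> hf.
have hc : h^-1 *: (f (h *: 1 + x) - f x) @[h --> 0^'] --> df.
  apply/cvgrPdist_le => e e0.
  have [d d0 hd] := hf e e0; apply/nbhs_ballP; exists d => //= h.
  rewrite /ball/= sub0r normrN => hd' h0.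
  have := hd (h + x); rewrite addrK => /(_ hd') {}hd.
  rewrite /GRing.scale/= mulr1.
  rewrite -(@ler_pM2r _ `|h|) ?normr_gt0// -normrM mulrBl mulrAC mulVf// mul1r.
  by rewrite distrC.
have df' : derivable f x 1 by apply/cvg_ex; exists df.
by split=> //; rewrite derive1E; exact: (cvg_lim _ hc).
Qed.

End derivative_expansion.

Section complex_basics.
Context {R : realType}.
Local Notation C := (Cplx R).
Implicit Types z u v : C.

Lemma normC_modulus z : `|z| = ofR (modulus z).
Proof. by []. Qed.

Lemma modulus_ge0 z : 0 <= modulus z.
Proof. by case: z => a b; exact: sqrtr_ge0. Qed.

Lemma modulusM u v : modulus (u * v) = modulus u * modulus v.
Proof. exact: Normc.normcM. Qed.

Lemma modulusV z : modulus z^-1 = (modulus z)^-1.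
Proof. exact: Normc.normcV. Qed.

Lemma modulusD u v : modulus (u + v) <= modulus u + modulus v.
Proof. exact: le_normcD. Qed.

Lemma modulusN z : modulus (- z) = modulus z.
Proof. exact: normcN. Qed.

Lemma modulusB u v : modulus (u - v) <= modulus u + modulus v.
Proof. by rewrite -(modulusN v); exact: modulusD. Qed.

Lemma modulus_dist u v : modulus (u - v) = modulus (v - u).
Proof. by rewrite -modulusN opprB. Qed.

Lemma modulusX z n : modulus (z ^+ n) = modulus z ^+ n.
Proof.
elim: n => [|n IH]; first by rewrite !expr0; exact: Normc.normc1.
by rewrite !exprS modulusM IH.
Qed.

Lemma modulus0 : modulus (0 : C) = 0.
Proof. exact: Normc.normc0. Qed.

Lemma modulus_eq0 z : modulus z = 0 -> z = 0.
Proof. exact: Normc.eq0_normc. Qed.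

Lemma modulus_gt0 z : z != 0 -> 0 < modulus z.
Proof.
move=> z0; rewrite lt_neqAle modulus_ge0 andbT eq_sym; apply: contra z0.
by move/eqP/modulus_eq0 => ->.
Qed.

Lemma modulus_ofR (r : R) : modulus (ofR r : C) = `|r|.
Proof. by rewrite /modulus /ofR /= expr0n /= addr0 sqrtr_sqr. Qed.

Lemma modulus_cis (t : R) : modulus (cis t : C) = 1.
Proof. by rewrite /modulus /cis /= cos2Dsin2 sqrtr1. Qed.

Lemma cis_neq0 (t : R) : (cis t : C) != 0.
Proof.
by apply/eqP => h; have := modulus_cis t; rewrite h modulus0 => /eqP; rewrite eq_sym oner_eq0.
Qed.

Lemma Re_le_modulus z : `|complex.Re z| <= modulus z.
Proof.
by case: z => a b; rewrite /modulus /= -sqrtr_sqr ler_wsqrtr// lerDl sqr_ge0.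
Qed.

Lemma Im_le_modulus z : `|complex.Im z| <= modulus z.
Proof.
by case: z => a b; rewrite /modulus /= -sqrtr_sqr ler_wsqrtr// lerDr sqr_ge0.
Qed.

Lemma modulus_le_ReIm z : modulus z <= `|complex.Re z| + `|complex.Im z|.
Proof.
case: z => a b; rewrite /modulus /=.
have -> : `|a| + `|b| = Num.sqrt ((`|a| + `|b|) ^+ 2).
  by rewrite sqrtr_sqr [in RHS]ger0_norm ?addr_ge0.
rewrite ler_wsqrtr// sqrrD !real_normK ?num_real//.
  by have := mulr_ge0 (normr_ge0 a) (normr_ge0 b); lra.
Qed.

Lemma ReD u v : complex.Re (u + v) = complex.Re u + complex.Re v.
Proof. by case: u; case: v. Qed.

Lemma ImD u v : complex.Im (u + v) = complex.Im u + complex.Im v.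
Proof. by case: u; case: v. Qed.

Lemma ReB u v : complex.Re (u - v) = complex.Re u - complex.Re v.
Proof. by case: u; case: v. Qed.

Lemma ImB u v : complex.Im (u - v) = complex.Im u - complex.Im v.
Proof. by case: u; case: v. Qed.

Lemma ReM u v : complex.Re (u * v) =
  complex.Re u * complex.Re v - complex.Im u * complex.Im v.
Proof. by case: u; case: v. Qed.

Lemma ImM u v : complex.Im (u * v) =
  complex.Re u * complex.Im v + complex.Im u * complex.Re v.
Proof. by case: u; case: v => a b c d /=. Qed.

Lemma ofRM (a b : R) : (ofR (a * b) : C) = ofR a * ofR b.
Proof. by rewrite /ofR -rmorphM. Qed.

Lemma ofRB (a b : R) : (ofR (a - b) : C) = ofR a - ofR b.
Proof. by rewrite /ofR -rmorphB. Qed.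

Lemma ofR1 : (ofR 1 : C) = 1. Proof. by []. Qed.

Lemma ofR0 : (ofR 0 : C) = 0. Proof. by []. Qed.

Lemma cisD (s t : R) : (cis (s + t) : C) = cis s * cis t.
Proof.
by apply/eqP; rewrite eq_complex /= cosD sinD; apply/andP; split; apply/eqP; ring.
Qed.

Lemma cis0 : (cis 0 : C) = 1.
Proof. by rewrite /cis cos0 sin0. Qed.

Lemma cis2pi : (cis (2 * pi) : C) = 1.
Proof. by rewrite /cis mulr_natl cos2pi sin2pi. Qed.

(** The norm of [C] takes its values in [C]; this form of the derivative keeps
    all the bounds in [R]. *)
Definition cderiv (g : C -> C) z d := forall e : R, 0 < e ->
  exists2 h : R, 0 < h & forall z', modulus (z' - z) < h ->
    modulus (g z' - g z - d * (z' - z)) <= e * modulus (z' - z).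

Lemma cderivE g z d : cderiv g z d <-> expansion_at g z d.
Proof.
split=> hg e e0.
  have [r er] : exists r : R, e = ofR r.
    by exists (complex.Re e); apply/eqP; rewrite eq_complex /= eqxx /=;
       move: e0; rewrite ltcE /= => /andP[].
  have r0 : 0 < r by move: e0; rewrite er; rewrite -ltcR.
  have [h h0 hh] := hg r r0.
  exists (ofR h) => [|y]; first by rewrite /ofR ltcR.
  rewrite !normC_modulus er -ofRM /ofR ltcR lecR; exact: hh.
have [h h0 hh] := hg (ofR e) ltac:(by rewrite /ofR ltcR).
have [r er] : exists r : R, h = ofR r.
  by exists (complex.Re h); apply/eqP; rewrite eq_complex /= eqxx /=;
     move: h0; rewrite ltcE /= => /andP[].
exists r => [|y]; first by move: h0; rewrite er -ltcR.
by have := hh y; rewrite !normC_modulus er -ofRM /ofR ltcR lecR.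
Qed.

Lemma derivable_cderiv g z : derivable g z 1 -> cderiv g z (derive1 g z).
Proof. by move/derivable_expansion/cderivE. Qed.

Lemma cderiv_derivable g z d : cderiv g z d -> derivable g z 1.
Proof. by move/cderivE/expansion_derive1 => []. Qed.

Lemma cderiv_derive1 g z d : cderiv g z d -> derive1 g z = d.
Proof. by move/cderivE/expansion_derive1 => []. Qed.

End complex_basics.

(** * Cauchy's formula on circles *)

Section cauchy.
Context {R : realType}.
Local Notation C := (Cplx R).

Lemma is_derive_expansion (f : R -> R) (x df : R) : is_derive x 1 f df ->
  expansion_at f x df.
Proof.
move=> fdf; have fd : derivable f x 1 by [].
have := derivable_expansion fd.
by rewrite derive1E derive_val.
Qed.

(** Unlike the existence of the two partial derivatives [a] and [b], this joint
    expansion is stable under composition with a complex differentiable map. *)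
Definition rdiff2 (K : R -> R -> C) (s t : R) (a b : C) := forall e : R, 0 < e ->
  exists2 d : R, 0 < d & forall s' t', `|s' - s| < d -> `|t' - t| < d ->
    modulus (K s' t' - K s t - (a * ofR (s' - s) + b * ofR (t' - t)))
      <= e * (`|s' - s| + `|t' - t|).

Lemma rdiff2_comp (z : R -> R -> C) (g : C -> C) s t a b d :
  rdiff2 z s t a b -> cderiv g (z s t) d ->
  rdiff2 (fun s t => g (z s t)) s t (d * a) (d * b).
Proof.
move=> hz hg e e0.
pose M := modulus a + modulus b + 1.
have a0 := modulus_ge0 a; have b0 := modulus_ge0 b; have d0 := modulus_ge0 d.
have M0 : 0 < M by rewrite /M; lra.
have [h h0 hh] := hg (e / (2 * M)) ltac:(by rewrite divr_gt0 ?mulr_gt0).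
have e1 : 0 < Num.min 1 (e / (2 * (modulus d + 1))).
  by rewrite lt_min ltr01 divr_gt0// mulr_gt0//; lra.
have [k k0 hk] := hz _ e1.
set e' := Num.min _ _ in e1 hk.
have e'1 : e' <= 1 by rewrite ge_min lexx.
have e'2 : e' * (2 * (modulus d + 1)) <= e.
  by rewrite -ler_pdivlMr ?ge_min ?lexx ?orbT// mulr_gt0//; lra.
exists (Num.min k (h / (2 * M))).
  by rewrite lt_min k0 divr_gt0// mulr_gt0.
move=> s' t'; rewrite !lt_min => /andP[s1 s2] /andP[t1 t2].
have {}hk := hk _ _ s1 t1.
set ds := s' - s in hk s2 *; set dt := t' - t in hk t2 *.
have bD : modulus (z s' t' - z s t) <= M * (`|ds| + `|dt|).
  have -> : z s' t' - z s t = (z s' t' - z s t - (a * ofR ds + b * ofR dt))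
     + (a * ofR ds + b * ofR dt) by ring.
  apply: le_trans (modulusD _ _) _.
  apply: le_trans (lerD hk (modulusD _ _)) _.
  rewrite !modulusM !modulus_ofR.
  have h1 := ler_wpM2r (normr_ge0 ds) b0; have h2 := ler_wpM2r (normr_ge0 dt) a0.
  have h3 := ler_wpM2r (addr_ge0 (normr_ge0 ds) (normr_ge0 dt)) e'1.
  by rewrite /M; lra.
have zh : modulus (z s' t' - z s t) < h.
  apply: le_lt_trans bD _; rewrite mulrC -ltr_pdivlMr//.
  have -> : h / M = h / (2 * M) + h / (2 * M) by field; rewrite gt_eqF.
  lra.
have {}hh := hh _ zh.
have -> : g (z s' t') - g (z s t) - (d * a * ofR ds + d * b * ofR dt) =
  (g (z s' t') - g (z s t) - d * (z s' t' - z s t)) +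
  d * (z s' t' - z s t - (a * ofR ds + b * ofR dt)) by ring.
apply: le_trans (modulusD _ _) _; rewrite modulusM.
apply: le_trans (lerD hh (ler_wpM2l d0 hk)) _.
have S0 : 0 <= `|ds| + `|dt| by rewrite addr_ge0.
move: (`|ds| + `|dt|) S0 bD => S S0 bD.
have h1 : e / (2 * M) * modulus (z s' t' - z s t) <= e / 2 * S.
  have c0 : 0 <= e / (2 * M) by rewrite divr_ge0 ?mulr_ge0 ?ltW.
  apply: le_trans (ler_wpM2l c0 bD) _.
  by rewrite le_eqVlt; apply/orP; left; apply/eqP; field; rewrite gt_eqF.
have h2 : modulus d * (e' * S) <= e / 2 * S.
  rewrite mulrA; apply: ler_wpM2r => //.
  have := ltW e1; nra.
lra.
Qed.

Lemma cis_expansion (t : R) : forall e : R, 0 < e -> exists2 d : R, 0 < d &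
  forall t', `|t' - t| < d ->
    modulus (cis t' - cis t - 'i%C * cis t * ofR (t' - t) : C) <= e * `|t' - t|.
Proof.
move=> e e0.
have [d1 d10 h1] := is_derive_expansion (is_derive_cos t) (divr_gt0 e0 (ltr0Sn R 1)).
have [d2 d20 h2] := is_derive_expansion (is_derive_sin t) (divr_gt0 e0 (ltr0Sn R 1)).
exists (Num.min d1 d2); first by rewrite lt_min d10.
move=> t'; rewrite lt_min => /andP[/h1 {}h1 /h2 {}h2].
apply: le_trans (modulus_le_ReIm _) _.
have -> : complex.Re (cis t' - cis t - 'i%C * cis t * ofR (t' - t) : C) =
  cos t' - cos t - (- sin t) * (t' - t).
  by rewrite /= ; ring.
have -> : complex.Im (cis t' - cis t - 'i%C * cis t * ofR (t' - t) : C) =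
  sin t' - sin t - cos t * (t' - t).
  by rewrite /= ; ring.
by apply: le_trans (lerD h1 h2) _; lra.
Qed.

(** For [s = 0] this is the circle of radius [r] about the origin; as [s] tends
    to minus infinity it contracts to [zeta]. Thanks to the exponential, the
    quotient of the two partial derivatives does not depend on [s]. *)
Definition circ (zeta : C) (r s t : R) : C :=
  zeta + ofR (expR s) * (ofR r * cis t - zeta).

Lemma rdiff2_circ (zeta : C) (r s t : R) :
  rdiff2 (circ zeta r) s t (ofR (expR s) * (ofR r * cis t - zeta))
    (ofR (expR s) * ('i%C * (ofR r * cis t))).
Proof.
move=> e e0.
set w := ofR r * cis t - zeta.
pose W := modulus w + `|r| + 1.
have w0 := modulus_ge0 w; have r0 := normr_ge0 r.
have W0 : 0 < W by rewrite /W; lra.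
have E0 := expR_gt0 s.
pose e' := e / (3 * W * (expR s + 1)).
have WE : 0 < 3 * W * (expR s + 1) by rewrite mulr_gt0 ?mulr_gt0//; lra.
have e'0 : 0 < e' by rewrite divr_gt0.
have e'e : e' * (3 * W * (expR s + 1)) = e by rewrite divfK// gt_eqF.
have e1 : 0 < Num.min 1 e' by rewrite lt_min ltr01.
have [d1 d10 h1] := is_derive_expansion (is_derive_expR s) e1.
have [d2 d20 h2] := cis_expansion t e1.
set e'' := Num.min _ _ in e1 h1 h2.
have e'1 : e'' <= 1 by rewrite ge_min lexx.
have e'2 : e'' <= e' by rewrite ge_min lexx orbT.
exists (Num.min d1 (Num.min d2 (e' / 2))).
  by rewrite !lt_min d10 d20 divr_gt0.
move=> s' t'; rewrite !lt_min => /andP[/h1 {}h1 _] /and3P[_ /h2 {}h2 h3].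
have -> : circ zeta r s' t' - circ zeta r s t -
  (ofR (expR s) * w * ofR (s' - s) +
   ofR (expR s) * ('i%C * (ofR r * cis t)) * ofR (t' - t)) =
  ofR (expR s' - expR s - expR s * (s' - s)) * w +
  ofR (expR s) * ofR r * (cis t' - cis t - 'i%C * cis t * ofR (t' - t)) +
  ofR (expR s' - expR s) * (ofR r * (cis t' - cis t)).
  by rewrite /circ /w !ofRB ofRM ofRB; ring.
have bE : `|expR s' - expR s| <= (expR s + 1) * `|s' - s|.
  have -> : expR s' - expR s = (expR s' - expR s - expR s * (s' - s)) +
    expR s * (s' - s) by ring.
  apply: le_trans (ler_normD _ _) _; rewrite normrM (gtr0_norm E0).
  apply: le_trans (lerD h1 (lexx _)) _.
  by rewrite -mulrDl ler_wpM2r//; lra.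
have bC : modulus (cis t' - cis t : C) <= 2 * `|t' - t|.
  have -> : cis t' - cis t = (cis t' - cis t - 'i%C * cis t * ofR (t' - t))
    + 'i%C * cis t * ofR (t' - t) :> C by ring.
  apply: le_trans (modulusD _ _) _; rewrite !modulusM modulus_cis modulus_ofR mulr1.
  have -> : modulus ('i%C : C) = 1.
    by rewrite /modulus /= expr0n/= expr1n add0r sqrtr1.
  by have := ler_wpM2r (normr_ge0 (t' - t)) e'1; lra.
have bC' : modulus (cis t' - cis t : C) <= e' by lra.
apply: le_trans (modulusD _ _) _.
apply: le_trans (lerD (modulusD _ _) (lexx _)) _.
rewrite !modulusM !modulus_ofR (gtr0_norm E0).
have dt0 := normr_ge0 (t' - t); have ds0 := normr_ge0 (s' - s).
have c0 := modulus_ge0 (cis t' - cis t : C).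
have b1 : `|expR s' - expR s - expR s * (s' - s)| * modulus w <= e' * W * `|s' - s|.
  apply: le_trans (ler_wpM2r w0 h1) _.
  have wW : modulus w <= W by rewrite /W; lra.
  rewrite (_ : _ * _ * _ = e'' * modulus w * `|s' - s|); last by ring.
  by apply: ler_wpM2r => //; apply: ler_pM => //; exact: ltW.
have b2 : expR s * `|r| * modulus (cis t' - cis t - 'i%C * cis t * ofR (t' - t) : C)
   <= e' * (W * (expR s + 1)) * `|t' - t|.
  apply: le_trans (ler_wpM2l (mulr_ge0 (ltW E0) r0) h2) _.
  rewrite (_ : _ * _ * _ = e'' * (`|r| * expR s) * `|t' - t|); last by ring.
  have rW : `|r| <= W by rewrite /W; lra.
  have rE : `|r| * expR s <= W * (expR s + 1) by apply: ler_pM => //; lra.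
  have rE0 : 0 <= `|r| * expR s := mulr_ge0 r0 (ltW E0).
  by apply: ler_wpM2r => //; exact: ler_pM (ltW e1) rE0 e'2 rE.
have b3 : `|expR s' - expR s| * (`|r| * modulus (cis t' - cis t : C)) <=
   e' * (W * (expR s + 1)) * `|s' - s|.
  apply: le_trans (ler_pM _ _ bE (ler_pM r0 c0 (_ : _ <= W) bC')) _ => //.
  - by rewrite mulr_ge0.
  - by rewrite /W; lra.
  - by rewrite le_eqVlt; apply/orP; left; apply/eqP; ring.
have b4 : e' * W * `|s' - s| <= e' * (W * (expR s + 1)) * `|s' - s|.
  have eWE : 0 <= e' * W * expR s := mulr_ge0 (mulr_ge0 (ltW e'0) (ltW W0)) (ltW E0).
  by apply: ler_wpM2r => //; lra.
have -> : e = e' * (W * (expR s + 1)) * 3 by rewrite -e'e; ring.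
set Q := e' * (W * (expR s + 1)) in b2 b3 b4 *.
have Q0 : 0 <= Q by rewrite /Q; apply: mulr_ge0 (ltW e'0) (mulr_ge0 (ltW W0) _); lra.
have := mulr_ge0 Q0 dt0; have := mulr_ge0 Q0 ds0; lra.
Qed.

End cauchy.

Section cauchy.
Context {R : realType}.
Local Notation C := (Cplx R).

Definition ccont (F : R -> C) (t : R) := forall e : R, 0 < e ->
  exists2 d : R, 0 < d & forall t', `|t' - t| < d -> modulus (F t' - F t) <= e.

Lemma eps_continuous (f : R -> R) t :
  (forall e : R, 0 < e -> exists2 d : R, 0 < d & forall t', `|t' - t| < d ->
    `|f t' - f t| <= e) -> {for t, continuous f}.
Proof.
move=> h; apply/cvgrPdist_le => e e0; have [d d0 hd] := h e e0.
apply/nbhs_ballP; exists d => //= t'; rewrite /ball/= distrC => /hd.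
by rewrite distrC.
Qed.

Lemma ccont_Re F t : ccont F t -> {for t, continuous (fun x => complex.Re (F x))}.
Proof.
move=> h; apply: eps_continuous => e e0; have [d d0 hd] := h e e0.
exists d => // t' /hd; apply: le_trans; rewrite -ReB; exact: Re_le_modulus.
Qed.

Lemma ccont_Im F t : ccont F t -> {for t, continuous (fun x => complex.Im (F x))}.
Proof.
move=> h; apply: eps_continuous => e e0; have [d d0 hd] := h e e0.
exists d => // t' /hd; apply: le_trans; rewrite -ImB; exact: Im_le_modulus.
Qed.

Lemma ccont_modulus F t : ccont F t -> {for t, continuous (fun x => modulus (F x))}.
Proof.
move=> h; apply: eps_continuous => e e0; have [d d0 hd] := h e e0.
exists d => // t' /hd; apply: le_trans.
have h1 := modulusD (F t' - F t) (F t); have h2 := modulusD (F t - F t') (F t').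
rewrite !subrK (modulus_dist (F t)) in h1 h2.
by rewrite ler_norml; apply/andP; split; lra.
Qed.

Lemma ccont_cst c t : ccont (fun=> c) t.
Proof. by move=> e e0; exists 1 => // t' _; rewrite subrr modulus0 ltW. Qed.

Lemma ccontB F G t : ccont F t -> ccont G t -> ccont (fun x => F x - G x) t.
Proof.
move=> hF hG e e0.
have [d d0 hd] := hF (e / 2) ltac:(lra); have [k k0 hk] := hG (e / 2) ltac:(lra).
exists (Num.min d k); first by rewrite lt_min d0.
move=> t'; rewrite lt_min => /andP[/hd {}hd /hk {}hk].
rewrite (_ : _ - _ = (F t' - F t) - (G t' - G t)); last by ring.
by apply: le_trans (modulusB _ _) _; lra.
Qed.

Lemma ccontM F G t : ccont F t -> ccont G t -> ccont (fun x => F x * G x) t.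
Proof.
move=> hF hG e e0.
pose M := modulus (F t) + modulus (G t) + 1.
have f0 := modulus_ge0 (F t); have g0 := modulus_ge0 (G t).
have M0 : 0 < M by rewrite /M; lra.
have e1 : 0 < Num.min 1 (e / M) by rewrite lt_min ltr01 divr_gt0.
have [d d0 hd] := hF _ e1; have [k k0 hk] := hG _ e1.
set e' := Num.min _ _ in e1 hd hk.
have e'1 : e' <= 1 by rewrite ge_min lexx.
have e'2 : e' * M <= e by rewrite -ler_pdivlMr ?ge_min ?lexx ?orbT.
exists (Num.min d k); first by rewrite lt_min d0.
move=> t'; rewrite lt_min => /andP[/hd {}hd /hk {}hk].
rewrite (_ : _ - _ = (F t' - F t) * (G t' - G t) + (F t' - F t) * G t
  + F t * (G t' - G t)); last by ring.
apply: le_trans (modulusD _ _) _.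
apply: le_trans (lerD (modulusD _ _) (lexx _)) _; rewrite !modulusM.
have a0 := modulus_ge0 (F t' - F t); have b0 := modulus_ge0 (G t' - G t).
apply: le_trans e'2; rewrite /M.
have h1 := ler_pM a0 b0 hd hk; have h2 := ler_wpM2r g0 hd.
have h3 := ler_wpM2l f0 hk; have h4 := ler_wpM2l (ltW e1) e'1.
lra.
Qed.

Lemma ccontV F t : ccont F t -> F t != 0 -> ccont (fun x => (F x)^-1) t.
Proof.
move=> hF F0 e e0.
have m0 := modulus_gt0 F0; set m := modulus (F t) in m0.
have m2 : 0 < m / 2 by lra.
have em : 0 < e * (m / 2) * m by rewrite !mulr_gt0.
have [d d0 hd] := hF _ m2; have [k k0 hk] := hF _ em.
exists (Num.min d k); first by rewrite lt_min d0.
move=> t'; rewrite lt_min => /andP[/hd {}hd /hk {}hk].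
have h := modulusD (F t - F t') (F t'); rewrite subrK modulus_dist -/m in h.
have m' : m / 2 <= modulus (F t') by lra.
have F'0 : F t' != 0 by apply/eqP => F'0; rewrite F'0 modulus0 in m'; lra.
have -> : (F t')^-1 - (F t)^-1 = (F t - F t') * ((F t')^-1 * (F t)^-1).
  by field; rewrite F0 F'0.
rewrite !modulusM !modulusV modulus_dist -/m -invfM ler_pdivrMr; last first.
  by rewrite mulr_gt0//; lra.
apply: le_trans hk _; rewrite -mulrA; apply: ler_wpM2l; first exact: ltW.
by apply: ler_wpM2r => //; exact: ltW.
Qed.

Lemma ccont_cis t : ccont cis t.
Proof.
move=> e e0; have [d d0 hd] := @cis_expansion R t 1 ltr01.
exists (Num.min d (e / 2)); first by rewrite lt_min d0; lra.
move=> t'; rewrite lt_min => /andP[/hd {}hd h2].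
rewrite (_ : _ - _ = (cis t' - cis t - 'i%C * cis t * ofR (t' - t))
    + 'i%C * cis t * ofR (t' - t)); last by ring.
apply: le_trans (modulusD _ _) _; rewrite !modulusM modulus_cis modulus_ofR mulr1.
have -> : modulus ('i%C : C) = 1 by rewrite /modulus /= expr0n/= expr1n add0r sqrtr1.
lra.
Qed.

Lemma ccont_comp (g : C -> C) F t d : ccont F t -> cderiv g (F t) d ->
  ccont (fun x => g (F x)) t.
Proof.
move=> hF hg e e0.
have [h h0 hh] := hg 1 ltr01; have d0 := modulus_ge0 d.
pose e' := Num.min (h / 2) (e / (modulus d + 1)).
have e'0 : 0 < e' by rewrite lt_min !divr_gt0//; lra.
have [k k0 hk] := hF _ e'0; exists k => // t' /hk {}hk.
have eh : e' <= h / 2 by rewrite ge_min lexx.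
have ee : e' * (modulus d + 1) <= e.
  by rewrite -ler_pdivlMr ?ge_min ?lexx ?orbT//; lra.
have {}hh := hh (F t') ltac:(lra).
rewrite (_ : _ - _ = (g (F t') - g (F t) - d * (F t' - F t)) + d * (F t' - F t));
  last by ring.
apply: le_trans (modulusD _ _) _; rewrite modulusM.
have := ler_wpM2l d0 hk; lra.
Qed.

Lemma rdiff2_ccont1 K s t (a b : C) : rdiff2 K s t a b -> ccont (K ^~ t) s.
Proof.
move=> h e e0; have [d d0 hd] := h 1 ltr01; have a0 := modulus_ge0 a.
exists (Num.min d (e / (modulus a + 1))); first by rewrite lt_min d0 divr_gt0//; lra.
move=> s'; rewrite lt_min => /andP[h1 h2].
have := hd s' t h1; rewrite subrr normr0 => /(_ d0).
rewrite mul1r addr0 ofR0 mulr0 addr0 => {}hd.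
rewrite (_ : _ - _ = (K s' t - K s t - a * ofR (s' - s)) + a * ofR (s' - s));
  last by ring.
apply: le_trans (modulusD _ _) _; rewrite modulusM modulus_ofR.
rewrite ltr_pdivlMr in h2; lra.
Qed.

Lemma rdiff2_ccont2 K s t (a b : C) : rdiff2 K s t a b -> ccont (K s) t.
Proof.
move=> h; apply: (@rdiff2_ccont1 (fun t s => K s t) t s b a) => e e0.
have [d d0 hd] := h e e0; exists d => // t' s' ht hs.
by rewrite [X in K s' t' - K s t - X]addrC [X in e * X]addrC; exact: hd.
Qed.

(** The relation [b = 'i * kap t * a] is the Cauchy-Riemann equation. It gives
    [Re (kap a) = Im b], that is, the [s]-derivative of [Re (kap K)] is the
    [t]-derivative of [Im K], which is what Green's formula asks for. *)
Lemma green_complex (kap : R -> C) (K : R -> R -> C) (s0 s1 t0 t1 : R) :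
  s0 < s1 -> t0 < t1 ->
  (forall t, t0 <= t <= t1 -> ccont kap t) ->
  (forall s t, s0 <= s <= s1 -> t0 <= t <= t1 -> exists a b : C,
    b = 'i%C * kap t * a /\ rdiff2 K s t a b) ->
  segint t0 t1 (fun t => complex.Re (kap t * K s1 t))
    - segint t0 t1 (fun t => complex.Re (kap t * K s0 t)) =
  segint s0 s1 (fun s => complex.Im (K s t1))
    - segint s0 s1 (fun s => complex.Im (K s t0)).
Proof.
move=> s01 t01 ck dK.
apply: (@segint_green R (fun s t => complex.Re (kap t * K s t))
  (fun s t => complex.Im (K s t))) => //.
- move=> s hs t ht; apply: ccont_Re; apply: ccontM; first exact: ck.
  by have [a [b [_ /rdiff2_ccont2]]] := dK s t hs ht.
- move=> t ht s hs; apply: ccont_Im.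
  by have [a [b [_ /rdiff2_ccont1]]] := dK s t hs ht.
move=> s t hs ht; have [a [b [bE dKst]]] := dK s t hs ht.
exists (complex.Re (kap t * a)) => e e0.
set k := kap t in bE *.
pose M := modulus k + modulus a + 2.
have k0 := modulus_ge0 k; have a0 := modulus_ge0 a.
have M0 : 0 < M by rewrite /M; lra.
have e1 : 0 < Num.min 1 (e / (3 * M)) by rewrite lt_min ltr01 divr_gt0// mulr_gt0.
have [d1 d10 h1] := dKst _ e1; have [d2 d20 h2] := ck t ht _ e1.
set e' := Num.min _ _ in e1 h1 h2.
have e'1 : e' <= 1 by rewrite ge_min lexx.
have e'2 : e' * (3 * M) <= e.
  by rewrite -ler_pdivlMr ?ge_min ?lexx ?orbT// mulr_gt0.
clearbody e'.
exists (Num.min d1 d2); first by rewrite lt_min d10.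
move=> s' t' l m; rewrite !lt_min => /and3P[l0 ld1 ld2] /and3P[m0 md1 md2].
move=> _ /andP[hs1 hs2] _ _ /andP[ht1 ht2] _.
(* both points are expanded around the same centre [(s, t)] *)
have dd s2 t2 s3 t3 : s' <= s2 <= s' + l -> t' <= t2 <= t' + m ->
    s' <= s3 <= s' + l -> t' <= t3 <= t' + m ->
    modulus (K s3 t3 - K s2 t2 - (a * ofR (s3 - s2) + b * ofR (t3 - t2)))
     <= 2 * e' * (l + m).
  move=> /andP[s2a s2b] /andP[t2a t2b] /andP[s3a s3b] /andP[t3a t3b].
  have n2 : `|s2 - s| <= l by rewrite ler_norml; apply/andP; split; lra.
  have n3 : `|s3 - s| <= l by rewrite ler_norml; apply/andP; split; lra.
  have p2 : `|t2 - t| <= m by rewrite ler_norml; apply/andP; split; lra.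
  have p3 : `|t3 - t| <= m by rewrite ler_norml; apply/andP; split; lra.
  have b2 := h1 s2 t2 (le_lt_trans n2 ld1) (le_lt_trans p2 md1).
  have b3 := h1 s3 t3 (le_lt_trans n3 ld1) (le_lt_trans p3 md1).
  rewrite (_ : K s3 t3 - K s2 t2 - _ =
    (K s3 t3 - K s t - (a * ofR (s3 - s) + b * ofR (t3 - t))) -
    (K s2 t2 - K s t - (a * ofR (s2 - s) + b * ofR (t2 - t)))); last first.
    by rewrite !ofRB; ring.
  apply: le_trans (modulusB _ _) _.
  have c2 := ler_wpM2l (ltW e1) (lerD n2 p2).
  have c3 := ler_wpM2l (ltW e1) (lerD n3 p3).
  rewrite (_ : 2 * e' * (l + m) = e' * (l + m) + e' * (l + m)); last by ring.
  exact: lerD (le_trans b3 c3) (le_trans b2 c2).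
have lm0 : 0 < l + m by lra.
have is0 : s' <= s' <= s' + l by apply/andP; split; lra.
have is1 : s' <= s' + l <= s' + l by apply/andP; split; lra.
have it0 : t' <= t' <= t' + m by apply/andP; split; lra.
have it1 : t' <= t' + m <= t' + m by apply/andP; split; lra.
split=> x xab; move/andP: (xab) => [xa xb].
  have xt : `|x - t| <= m by rewrite ler_norml; apply/andP; split; lra.
  have hk := h2 x (le_lt_trans xt md2); rewrite -/k in hk.
  have := dd s' x (s' + l) x is0 xab is1 xab.
  rewrite subrr ofR0 mulr0 addr0 (addrC s') addrK => hK.
  rewrite -ReB -mulrBr.
  have -> : complex.Re (k * a) * l = complex.Re (k * a * ofR l).
    by rewrite [RHS]ReM /= mulr0 subr0.
  rewrite -ReB; apply: le_trans (Re_le_modulus _) _.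
  rewrite (_ : _ - _ = kap x * (K (l + s') x - K s' x - a * ofR l) +
    (kap x - k) * (a * ofR l)); last by ring.
  apply: le_trans (modulusD _ _) _; rewrite !modulusM modulus_ofR (gtr0_norm l0).
  have kx : modulus (kap x) <= modulus k + 1.
    have := modulusD (kap x - k) k; rewrite subrK; lra.
  have b1 := ler_pM (modulus_ge0 _) (modulus_ge0 _) kx hK.
  have b2 : modulus (kap x - k) * (modulus a * l) <= e' * (modulus a * (l + m)).
    apply: ler_pM; rewrite ?modulus_ge0// ?mulr_ge0//; first lra.
    by apply: ler_wpM2l => //; lra.
  apply: le_trans (lerD b1 b2) _.
  rewrite (_ : _ + _ = e' * (2 * (modulus k + 1) + modulus a) * (l + m));
    last by ring.
  apply: ler_wpM2r; first exact: ltW.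
  apply: le_trans e'2; apply: ler_wpM2l; first exact: ltW.
  rewrite /M; lra.
have := dd x t' x (t' + m) xab it0 xab it1.
rewrite subrr ofR0 mulr0 add0r (addrC t') addrK => hK.
rewrite -ImB.
have -> : complex.Re (k * a) * m = complex.Im (b * ofR m).
  by rewrite bE !ImM !ReM !ImM /=; ring.
rewrite -ImB; apply: le_trans (Im_le_modulus _) _; apply: le_trans hK _.
apply: ler_wpM2r; first exact: ltW.
apply: le_trans e'2; rewrite mulrC; apply: ler_wpM2l; first exact: ltW.
rewrite /M; lra.
Qed.

End cauchy.

Section cauchy_formula.
Context {R : realType}.
Local Notation C := (Cplx R).

Definition cint (F : R -> C) : C :=
  (segint 0 (2 * pi) (fun t => complex.Re (F t))
  +i* segint 0 (2 * pi) (fun t => complex.Im (F t)))%C.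

Lemma pi2_gt0 : 0 < 2 * pi :> R. Proof. by rewrite mulr_gt0 ?pi_gt0. Qed.

Lemma cont_on_Re a b (F : R -> C) : (forall t, ccont F t) ->
  cont_on a b (fun t => complex.Re (F t)).
Proof. by move=> h t _; exact: ccont_Re. Qed.

Lemma cont_on_Im a b (F : R -> C) : (forall t, ccont F t) ->
  cont_on a b (fun t => complex.Im (F t)).
Proof. by move=> h t _; exact: ccont_Im. Qed.

Hint Resolve cont_on_Re cont_on_Im : core.

Lemma complex_eq (u v : C) : complex.Re u = complex.Re v ->
  complex.Im u = complex.Im v -> u = v.
Proof. by case: u; case: v => a b c d /= -> ->. Qed.

Lemma cintB (F G : R -> C) : (forall t, ccont F t) -> (forall t, ccont G t) ->
  cint (fun t => F t - G t) = cint F - cint G.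
Proof.
move=> hF hG; apply: complex_eq; rewrite /= -segintB; auto;
  by apply: eq_segint => t _; rewrite ?ReB ?ImB.
Qed.

Lemma cintD (F G : R -> C) : (forall t, ccont F t) -> (forall t, ccont G t) ->
  cint (fun t => F t + G t) = cint F + cint G.
Proof.
move=> hF hG; apply: complex_eq; rewrite /= -segintD; auto;
  by apply: eq_segint => t _; rewrite ?ReD ?ImD.
Qed.

Lemma cont_onZ a b c (f : R -> R) : cont_on a b f -> cont_on a b (fun t => c * f t).
Proof.
by move=> cf t ht; apply: continuousM; [exact: cst_continuous|exact: cf].
Qed.

Lemma cintZ c (F : R -> C) : (forall t, ccont F t) ->
  cint (fun t => c * F t) = c * cint F.
Proof.
move=> hF.
have cR := @cont_on_Re 0 (2 * pi) F hF; have cI := @cont_on_Im 0 (2 * pi) F hF.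
apply: complex_eq; rewrite ?ReM ?ImM /= -!segintZ//.
  rewrite -segintB; try exact: cont_onZ.
  by apply: eq_segint => t _; rewrite ReM.
rewrite -segintD; try exact: cont_onZ.
by apply: eq_segint => t _; rewrite ImM.
Qed.

Lemma cint_cst c : cint (fun=> c) = ofR (2 * pi) * c.
Proof.
apply: complex_eq; rewrite ?ReM ?ImM /= segint_cst ?(ltW pi2_gt0)//; ring.
Qed.

Lemma eq_cint (F G : R -> C) : F =1 G -> cint F = cint G.
Proof. by move=> h; apply: complex_eq; apply: eq_segint => t _; rewrite h. Qed.

Lemma cint_bound_in M (F : R -> C) : (forall t, ccont F t) ->
  (forall t, 0 <= t <= 2 * pi -> modulus (F t) <= M) ->
  modulus (cint F) <= 4 * pi * M.
Proof.
move=> hF hM; apply: le_trans (modulus_le_ReIm _) _ => /=.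
have p2 := ltW pi2_gt0.
have h1 := segint_bound p2 (@cont_on_Re 0 (2 * pi) F hF)
  (fun t ht => le_trans (Re_le_modulus (F t)) (hM t ht)).
have h2 := segint_bound p2 (@cont_on_Im 0 (2 * pi) F hF)
  (fun t ht => le_trans (Im_le_modulus (F t)) (hM t ht)).
by apply: le_trans (lerD h1 h2) _; rewrite subr0; lra.
Qed.

Lemma cint_bound M (F : R -> C) : (forall t, ccont F t) ->
  (forall t, modulus (F t) <= M) -> modulus (cint F) <= 4 * pi * M.
Proof. by move=> hF hM; apply: cint_bound_in. Qed.

Lemma ccontX (F : R -> C) n t : ccont F t -> ccont (fun t => F t ^+ n) t.
Proof.
move=> hF; elim: n => [|n IH]; first exact: ccont_cst.
rewrite (_ : (fun _ => _) = (fun t => F t * F t ^+ n)); first exact: ccontM.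
by apply/funext => x; rewrite exprS.
Qed.

Lemma ccontD (F G : R -> C) t : ccont F t -> ccont G t ->
  ccont (fun x => F x + G x) t.
Proof.
move=> hF hG; rewrite (_ : (fun _ => _) = (fun t => F t - (0 - G t))).
  by apply: ccontB => //; apply: ccontB => //; exact: ccont_cst.
by apply/funext => x; rewrite sub0r opprK.
Qed.

Lemma ccont_sum n (F : nat -> R -> C) t : (forall i, ccont (F i) t) ->
  ccont (fun x => \sum_(i < n) F i x) t.
Proof.
move=> h; elim: n => [|n IH].
  rewrite (_ : (fun _ => _) = (fun=> 0)); first exact: ccont_cst.
  by apply/funext => x; rewrite big_ord0.
rewrite (_ : (fun _ => _) = (fun x => \sum_(i < n) F i x + F n x)).
  exact: ccontD.
by apply/funext => x; rewrite big_ord_recr.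
Qed.

Lemma cint_sum n (F : nat -> R -> C) : (forall i t, ccont (F i) t) ->
  cint (fun x => \sum_(i < n) F i x) = \sum_(i < n) cint (F i).
Proof.
move=> h; elim: n => [|n IH].
  rewrite big_ord0 (@eq_cint _ (fun=> 0)); first by rewrite cint_cst mulr0.
  by move=> x; rewrite big_ord0.
rewrite [RHS]big_ord_recr /= -IH -cintD//; last by move=> t; exact: ccont_sum.
by apply: eq_cint => x; rewrite big_ord_recr.
Qed.

Definition circle (r t : R) : C := ofR r * cis t.

Lemma ccont_circle r t : ccont (circle r) t.
Proof. by apply: ccontM; [exact: ccont_cst|exact: ccont_cis]. Qed.

Lemma modulus_circle r t : modulus (circle r t) = `|r|.
Proof. by rewrite modulusM modulus_ofR modulus_cis mulr1. Qed.

(** The form [dz / (z - zeta)] along the circle, divided by ['i dt]. *)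
Definition kernel (zeta : C) (r t : R) : C := circle r t / (circle r t - zeta).

Section circle_path.
Variables (zeta : C) (r : R).
Hypothesis r0 : 0 < r.
Hypothesis zr : modulus zeta < r.

Lemma circle_sub_ge t : r - modulus zeta <= modulus (circle r t - zeta).
Proof.
have := modulusD (circle r t - zeta) zeta.
by rewrite subrK modulus_circle gtr0_norm//; lra.
Qed.

Lemma circle_sub_neq0 t : circle r t - zeta != 0.
Proof.
apply/eqP => h; have := circle_sub_ge t; rewrite h modulus0 => zr'.
by move: zr; lra.
Qed.

Lemma ccont_circle_sub t : ccont (fun t => circle r t - zeta) t.
Proof. by apply: ccontB; [exact: ccont_circle|exact: ccont_cst]. Qed.

Lemma ccont_kernel t : ccont (kernel zeta r) t.
Proof.
apply: ccontM; first exact: ccont_circle.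
by apply: ccontV; [exact: ccont_circle_sub|exact: circle_sub_neq0].
Qed.

Lemma kernel_bound t : modulus (kernel zeta r t) <= r / (r - modulus zeta).
Proof.
rewrite modulusM modulusV modulus_circle gtr0_norm//.
apply: ler_wpM2l; first exact: ltW.
have z0 : 0 < r - modulus zeta by rewrite subr_gt0.
by rewrite lef_pV2 ?posrE ?circle_sub_ge ?(lt_le_trans z0 (circle_sub_ge t)).
Qed.

Lemma circ_modulus s t : s <= 0 -> modulus (circ zeta r s t) <= r.
Proof.
move=> s0; have E1 : expR s <= 1 by rewrite -expR0 ler_expR.
have E0 := expR_gt0 s.
rewrite (_ : circ _ _ _ _ = ofR (1 - expR s) * zeta + ofR (expR s) * circle r t).
  apply: le_trans (modulusD _ _) _; rewrite !modulusM !modulus_ofR modulus_cis.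
  rewrite ger0_norm ?subr_ge0// (gtr0_norm E0) (gtr0_norm r0) mulr1.
  have := ler_wpM2l (_ : 0 <= 1 - expR s) (ltW zr); rewrite subr_ge0 => /(_ E1); lra.
by rewrite /circ ofRB ofR1 /circle; ring.
Qed.
End circle_path.

(** By Green's formula the integral is the same on all the circles [circ zeta r
    s], the boundary terms at [0] and [2 * pi] being equal by periodicity; and
    it is small when [s] is very negative, since [g] is then close to [g zeta]
    on the whole circle. *)
Lemma cauchy_Re (g : C -> C) (rho r : R) (zeta : C) :
  0 < r -> r < rho -> modulus zeta < r ->
  (forall z, modulus z < rho -> exists d, cderiv g z d) ->
  segint 0 (2 * pi) (fun t => complex.Re
    (kernel zeta r t * (g (circle r t) - g zeta))) = 0.
Proof.
move=> r0 rrho zr dg.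
pose K s t := g (circ zeta r s t) - g zeta.
have dK s t : s <= 0 -> exists a b : C,
    b = 'i%C * kernel zeta r t * a /\ rdiff2 K s t a b.
  move=> s0.
  have [d hd] := dg (circ zeta r s t) (le_lt_trans (circ_modulus r0 zr t s0) rrho).
  have hd' : cderiv (fun z => g z - g zeta) (circ zeta r s t) d.
    move=> e e0; have [h h0 hh] := hd e e0; exists h => // z' /hh.
    by rewrite (_ : g z' - g zeta - _ = g z' - g (circ zeta r s t)) //; ring.
  have := rdiff2_comp (rdiff2_circ zeta r s t) hd' => hK.
  do 2 eexists; split; last exact: hK.
  by rewrite /kernel /circle; field; exact: circle_sub_neq0.
have const s : s < 0 -> segint 0 (2 * pi) (fun t => complex.Re (kernel zeta r t * K 0 t))
   = segint 0 (2 * pi) (fun t => complex.Re (kernel zeta r t * K s t)).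
  move=> s0; apply/eqP; rewrite -subr_eq0; apply/eqP.
  rewrite (@green_complex R (kernel zeta r) K s 0 0 (2 * pi) s0 pi2_gt0).
  - rewrite (_ : (fun s => complex.Im (K s (2 * pi))) = (fun s => complex.Im (K s 0))).
      by rewrite subrr.
    by apply/funext => x; rewrite /K /circ cis2pi cis0.
  - by move=> t _; exact: ccont_kernel.
  - by move=> x t /andP[_ x0] _; exact: dK.
have K0 t : K 0 t = g (circle r t) - g zeta.
  by rewrite /K /circ expR0 ofR1 mul1r (addrC zeta) subrK.
rewrite (_ : segint _ _ _ = segint 0 (2 * pi) (fun t => complex.Re (kernel zeta r t * K 0 t)));
  last by apply: eq_segint => t _; rewrite K0.
set I0 := segint _ _ _ in const *.
apply/eqP/negPn/negP => I00.
have I0p : 0 < `|I0| by rewrite normr_gt0.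
pose B := r / (r - modulus zeta).
have B0 : 0 < B by rewrite divr_gt0//; lra.
have [d hd] := dg zeta (lt_trans zr rrho).
have d0 := modulus_ge0 d.
have [h h0 hh] := hd 1 ltr01.
pose e := `|I0| / (2 * pi * B * 2).
have pB : 0 < 2 * pi * B * 2 := mulr_gt0 (mulr_gt0 pi2_gt0 B0) (ltr0Sn R 1).
have e0 : 0 < e by rewrite divr_gt0.
(* [expR s <= q] brings the circle so close to [zeta] that [g] varies by at most [e] *)
pose q := Num.min (h / 2) (e / (modulus d + 1)) / (2 * r).
have q0 : 0 < q by rewrite divr_gt0 ?mulr_gt0// lt_min !divr_gt0//; lra.
pose s := Num.min (-1) (ln q).
have s0 : s < 0 by rewrite /s gt_min oppr_lt0 ltr01.
have sq : expR s <= q.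
  by rewrite -[leRHS](lnK (_ : q \is Num.pos)) ?posrE// ler_expR /s ge_min lexx orbT.
have small t : modulus (K s t) <= e.
  have zb : modulus (circ zeta r s t - zeta) <= q * (2 * r).
    rewrite /circ addrC addKr modulusM modulus_ofR gtr0_norm ?expR_gt0//.
    apply: ler_pM => //; first exact: modulus_ge0.
    apply: le_trans (modulusB _ _) _.
    by rewrite modulus_circle gtr0_norm//; lra.
  rewrite /q divfK in zb; last by rewrite gt_eqF// mulr_gt0.
  set mn := Num.min _ _ in zb.
  have m1 : mn <= h / 2 by rewrite ge_min lexx.
  have m2 : mn * (modulus d + 1) <= e.
    by rewrite -ler_pdivlMr ?ge_min ?lexx ?orbT//; lra.
  clearbody mn.
  have := hh (circ zeta r s t) ltac:(lra) => {}hh.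
  rewrite /K (_ : _ - _ = (g (circ zeta r s t) - g zeta - d * (circ zeta r s t - zeta))
     + d * (circ zeta r s t - zeta)); last by ring.
  apply: le_trans (modulusD _ _) _; rewrite modulusM.
  have := ler_wpM2l d0 zb; lra.
have cK t : ccont (K s) t.
  by have [a [b [_ /rdiff2_ccont2]]] := dK s t (ltW s0).
have := @segint_bound R 0 (2 * pi) (B * e) (fun t => complex.Re (kernel zeta r t * K s t))
  (ltW pi2_gt0) (@cont_on_Re _ _ _ (fun t => ccontM (ccont_kernel r0 zr t) (cK t))).
rewrite -const// => /(_ _); rewrite leNgt subr0.
have -> : B * e * (2 * pi) = `|I0| / 2.
  rewrite /e; move: (@pi R) (pi_gt0 R) => p p0; field; by rewrite (gt_eqF B0) (gt_eqF p0).
rewrite ltr_pdivrMr// mulr_natr mulr2n ltrDl I0p /= => /(_ _)/notF; apply.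
move=> t _; apply: le_trans (Re_le_modulus _) _; rewrite modulusM.
by apply: ler_pM => //; try exact: modulus_ge0; exact: kernel_bound.
Qed.

(** The imaginary part is the real part for the function [- 'i g]. *)
Lemma cauchy (g : C -> C) (rho r : R) (zeta : C) :
  0 < r -> r < rho -> modulus zeta < r ->
  (forall z, modulus z < rho -> exists d, cderiv g z d) ->
  cint (fun t => kernel zeta r t * (g (circle r t) - g zeta)) = 0.
Proof.
move=> r0 rrho zr dg; apply: complex_eq; first exact: (@cauchy_Re g rho r zeta).
have dg' z : modulus z < rho -> exists d, cderiv (fun z => - 'i%C * g z) z d.
  move=> /dg[d hd]; exists (- 'i%C * d) => e e0.
  have [h h0 hh] := hd e e0; exists h => // z' /hh.
  rewrite (_ : - 'i%C * g z' - _ - _ = - 'i%C * (g z' - g z - d * (z' - z))); last by ring.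
  rewrite modulusM modulusN (_ : modulus ('i%C : C) = 1) ?mul1r//.
  by rewrite /modulus /= expr0n/= expr1n add0r sqrtr1.
rewrite /= -[RHS](cauchy_Re r0 rrho zr dg'); apply: eq_segint => t _.
by rewrite -mulrBr mulrCA [in RHS]ReM /=; ring.
Qed.

End cauchy_formula.

(** * Polynomial approximation of holomorphic functions *)

Section polynomial_approximation.
Context {R : realType}.
Local Notation C := (Cplx R).

Lemma cderivM (f g : C -> C) z a b : cderiv f z a -> cderiv g z b ->
  cderiv (fun z => f z * g z) z (a * g z + f z * b).
Proof.
move=> hf hg; apply/cderivE.
have df := cderiv_derivable hf; have dg := cderiv_derivable hg.
have ef := cderiv_derive1 hf; have eg := cderiv_derive1 hg.
have dfg : derivable (f * g) z 1 by exact: derivableM.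
have := derivable_expansion dfg.
rewrite derive1E deriveM// -!derive1E ef eg => h.
by rewrite (_ : a * g z + f z * b = f z *: b + g z *: a)// /GRing.scale /=; ring.
Qed.

Lemma cderiv_cst c (z : C) : cderiv (fun=> c) z 0.
Proof.
move=> e e0; exists 1 => // z' _.
by rewrite subrr mul0r subrr modulus0 mulr_ge0 ?modulus_ge0// ltW.
Qed.

Lemma cderiv_id (z : C) : cderiv id z 1.
Proof.
move=> e e0; exists 1 => // z' _.
by rewrite mul1r subrr modulus0 mulr_ge0 ?modulus_ge0// ltW.
Qed.

Lemma cderivB (f g : C -> C) z a b : cderiv f z a -> cderiv g z b ->
  cderiv (fun z => f z - g z) z (a - b).
Proof.
move=> hf hg e e0.
have [d d0 hd] := hf (e / 2) ltac:(lra); have [k k0 hk] := hg (e / 2) ltac:(lra).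
exists (Num.min d k); first by rewrite lt_min d0.
move=> z'; rewrite lt_min => /andP[/hd {}hd /hk {}hk].
rewrite (_ : f z' - g z' - _ - _ = (f z' - f z - a * (z' - z))
  - (g z' - g z - b * (z' - z))); last by ring.
by apply: le_trans (modulusB _ _) _; lra.
Qed.

Lemma cderivD (f g : C -> C) z a b : cderiv f z a -> cderiv g z b ->
  cderiv (fun z => f z + g z) z (a + b).
Proof.
move=> hf hg; have := cderivB hf (cderivB (cderiv_cst 0 z) hg).
by rewrite sub0r opprK; under eq_fun do rewrite sub0r opprK.
Qed.

Lemma cderiv_scale (f : C -> C) (c z d : C) : cderiv f (c * z) d ->
  cderiv (fun z => f (c * z)) z (d * c).
Proof.
move=> hf e e0; have c0 := modulus_ge0 c.
have [h h0 hh] := hf (e / (modulus c + 1)) ltac:(rewrite divr_gt0//; lra).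
exists (h / (modulus c + 1)) => [|z']; first by rewrite divr_gt0//; lra.
rewrite ltr_pdivlMr; last by lra.
have m0 := modulus_ge0 (z' - z) => hz.
have := hh (c * z'); rewrite -mulrBr modulusM => /(_ ltac:(lra)).
rewrite (mulrA d) => {}hh; apply: le_trans hh _.
rewrite mulrA; apply: ler_wpM2r => //.
by rewrite mulrAC ler_pdivrMr; [apply: ler_wpM2l; lra|lra].
Qed.

Lemma cderiv_shift (f : C -> C) (c z d : C) : cderiv f (c + z) d ->
  cderiv (fun z => f (c + z)) z d.
Proof.
move=> hf e e0; have [h h0 hh] := hf e e0; exists h => // z' hz.
by have := hh (c + z'); rewrite (_ : c + z' - (c + z) = z' - z); [exact|ring].
Qed.

Lemma cderiv_horner (p : {poly C}) (z : C) : cderiv (fun z => p.[z]) z p^`().[z].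
Proof.
elim/poly_ind: p => [|p c IH].
  rewrite deriv0 horner0 (_ : (fun _ => _) = fun=> 0); first exact: cderiv_cst.
  by apply/funext => x; rewrite horner0.
have := cderivD (cderivM IH (cderiv_id z)) (cderiv_cst c z).
rewrite addr0 mulr1.
rewrite (_ : (fun z => p.[z] * id z + c) = (fun z => (p * 'X + c%:P).[z])); last first.
  by apply/funext => x; rewrite !hornerE.
by rewrite derivD derivM derivX derivC addr0 mulr1 !hornerE.
Qed.

(** Cauchy's formula at the centre, where the kernel is constantly [1]. *)
Lemma mean_value (g : C -> C) (c : C) (rho r : R) : 0 < r -> r < rho ->
  (forall z, modulus (z - c) < rho -> exists d, cderiv g z d) ->
  cint (fun t => g (c + circle r t)) = ofR (2 * pi) * g c.
Proof.
move=> r0 rrho dg.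
have dg' z : modulus z < rho -> exists d, cderiv (fun z => g (c + z)) z d.
  move=> zr; have [|d hd] := dg (c + z); first by rewrite (addrC c) addrK.
  by exists d; exact: cderiv_shift.
have := @cauchy R (fun z => g (c + z)) rho r 0 r0 rrho.
rewrite modulus0 => /(_ r0 dg'); rewrite addr0.
rewrite (@eq_cint _ _ (fun t => g (c + circle r t) - g c)); last first.
  move=> t; rewrite /kernel subr0 divff ?mul1r// .
  by rewrite mulf_neq0 ?cis_neq0//; apply/eqP => /(congr1 (@complex.Re R)) /= /eqP; rewrite gt_eqF.
have cc t : ccont (fun t => g (c + circle r t)) t.
  have [|d hd] := dg (c + circle r t).
    by rewrite (addrC c) addrK modulus_circle gtr0_norm.
  by apply: ccont_comp hd; apply: ccontD; [exact: ccont_cst|exact: ccont_circle].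
rewrite cintB//; last by move=> t; exact: ccont_cst.
by rewrite cint_cst => /eqP; rewrite subr_eq0 => /eqP.
Qed.

Lemma cint_cisX n : cint (fun t => (cis t : C) ^+ n.+1) = 0.
Proof.
have d z : exists d, cderiv (fun z : C => z ^+ n.+1) z d.
  exists (('X^(n.+1))^`().[z]).
  have := cderiv_horner 'X^(n.+1) z.
  by rewrite (_ : (fun z => _) = (fun z => z ^+ n.+1))//; apply/funext => x; rewrite hornerXn.
have := @mean_value (fun z : C => z ^+ n.+1) 0 2 1 ltr01 ltac:(lra) (fun z _ => d z).
rewrite expr0n mulr0 => <-; apply: eq_cint => t.
by rewrite add0r /circle ofR1 mul1r.
Qed.

Lemma cisN (t : R) : (cis (- t) : C) = (cis t)^-1.
Proof.
apply: (mulfI (cis_neq0 t)); rewrite -cisD subrr cis0 divff//.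
exact: cis_neq0.
Qed.

Lemma ccont_cisV t : ccont (fun t : R => (cis t : C)^-1) t.
Proof. by apply: ccontV; [exact: ccont_cis|exact: cis_neq0]. Qed.

Lemma cint_cisVX n : cint (fun t => (cis t : C)^-1 ^+ n.+1) = 0.
Proof.
have cX (t : R) : (cis t : C)^-1 ^+ n.+1 = conjc (cis t ^+ n.+1).
  rewrite -cisN rmorphXn /=; congr (_ ^+ _).
  by rewrite /cis cosN sinN.
have h := cint_cisX n.
apply: complex_eq.
  move/(congr1 (@complex.Re R)): h => /= h.
  by rewrite /= -[RHS]h; apply: eq_segint => t _; rewrite cX; case: (_ ^+ _).
move/(congr1 (@complex.Im R)): h => /= h.
transitivity (- (0 : R)); last by rewrite oppr0.
rewrite /= -[X in - X]h -[RHS]mulN1r -segintZ.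
  by apply: eq_segint => t _; rewrite cX mulN1r; case: (_ ^+ _).
by apply: cont_on_Im => t; apply: ccontX; exact: ccont_cis.
Qed.

Lemma circleV (r t : R) : (circle r t : C)^-1 = ofR r^-1 * (cis t)^-1.
Proof. by rewrite /circle invfM /ofR fmorphV. Qed.

Lemma ccont_circleV r t : ccont (fun t : R => (circle r t : C)^-1) t.
Proof.
rewrite (_ : (fun t : R => _) = fun t => ofR r^-1 * (cis t)^-1).
  by apply: ccontM; [exact: ccont_cst|exact: ccont_cisV].
by apply/funext => x; rewrite circleV.
Qed.

Section expansion.
Variables (zeta : C) (r : R).
Hypothesis r0 : 0 < r.
Hypothesis zr : modulus zeta < r.
Local Notation x := (modulus zeta / r).

(** The geometric series of ratio [zeta / circle r t] with its exact remainder.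
    It serves twice: to integrate the kernel, and to produce the approximating
    polynomials. *)
Lemma kernel_geometric N t : kernel zeta r t =
  \sum_(n < N) zeta ^+ n * (circle r t)^-1 ^+ n + (zeta / circle r t) ^+ N * kernel zeta r t.
Proof.
have c0 : circle r t != 0.
  apply/eqP => h; have := modulus_circle r t.
  by rewrite h modulus0 gtr0_norm// => /esym/eqP; rewrite gt_eqF.
elim: N => [|N IH]; first by rewrite big_ord0 add0r expr0 mul1r.
rewrite [LHS]IH big_ord_recr /= -addrA; congr (_ + _).
rewrite exprS -exprMn.
rewrite (_ : zeta / circle r t * _ * _ = (zeta / circle r t) ^+ N * (zeta / circle r t * kernel zeta r t));
  last by ring.
rewrite -[X in _ = X + _]mulr1 -mulrDr; congr (_ * _).
by rewrite /kernel; field; rewrite c0 circle_sub_neq0.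
Qed.

Lemma ccont_quot N t : ccont (fun t => (zeta / circle r t) ^+ N) t.
Proof.
apply: ccontX; apply: ccontM; first exact: ccont_cst.
exact: ccont_circleV.
Qed.

Lemma quot_bound t N : modulus ((zeta / circle r t) ^+ N) = x ^+ N.
Proof. by rewrite modulusX modulusM modulusV modulus_circle gtr0_norm. Qed.

Lemma ratio_small (B : R) : (forall N, B <= (4 * pi * (r / (r - modulus zeta))) * x ^+ N) ->
  B <= 0.
Proof.
move=> h; rewrite leNgt; apply/negP => B0.
have m0 := modulus_ge0 zeta.
set c := 4 * pi * (r / (r - modulus zeta)) in h.
have c0 : 0 < c.
  apply: mulr_gt0; first by rewrite mulr_gt0 ?pi_gt0.
  by rewrite divr_gt0 ?subr_gt0.
have x1 : `|x| < 1.
  by rewrite (ger0_norm (divr_ge0 m0 (ltW r0))) ltr_pdivrMr// mul1r.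
have := cvg_expr x1; move/cvgrPdist_lt => /(_ _ (divr_gt0 B0 c0)) [N _ /(_ N (leqnn N))] /=.
rewrite sub0r normrN ltr_pdivlMr// => hN.
have := lt_le_trans hN (h N); rewrite mulrC ltr_pM2l// => hx.
by have := ler_norm (x ^+ N); rewrite leNgt hx.
Qed.

(** In the geometric expansion all the terms but the constant one integrate to
    [0], being powers of [cis], and the remainder is arbitrarily small. *)
Lemma cint_kernel : cint (kernel zeta r) = ofR (2 * pi).
Proof.
have ck := ccont_kernel r0 zr.
apply/eqP; rewrite -subr_eq0; apply/eqP; apply: modulus_eq0; apply/eqP.
rewrite eq_le modulus_ge0 andbT; apply: ratio_small => -[|N].
  have b := cint_bound ck (kernel_bound r0 zr).
  have : cint (fun t => kernel zeta r t - 1) = cint (kernel zeta r) - ofR (2 * pi).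
    rewrite cintB//; last by move=> t; exact: ccont_cst.
    by rewrite cint_cst mulr1.
  move=> <-; rewrite expr0 mulr1; apply: cint_bound => [t|t].
    by apply: ccontB => //; exact: ccont_cst.
  have -> : kernel zeta r t - 1 = zeta / (circle r t - zeta).
    by rewrite /kernel; field; exact: circle_sub_neq0.
  rewrite modulusM modulusV.
  have z0 : 0 < r - modulus zeta by rewrite subr_gt0.
  apply: ler_pM; [exact: modulus_ge0|by rewrite invr_ge0 modulus_ge0|exact: ltW|].
  by rewrite lef_pV2 ?posrE ?circle_sub_ge ?(lt_le_trans z0 (circle_sub_ge zeta r0 t)).
have cterm n t : ccont (fun t => zeta ^+ n * (circle r t)^-1 ^+ n) t.
  by apply: ccontM; [exact: ccont_cst|apply: ccontX; exact: ccont_circleV].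
have crem t : ccont (fun t => (zeta / circle r t) ^+ N.+1 * kernel zeta r t) t.
  by apply: ccontM => //; exact: ccont_quot.
rewrite (eq_cint (kernel_geometric N.+1)) cintD//; last first.
  by move=> t; exact: (@ccont_sum _ N.+1 (fun n t => zeta ^+ n * (circle r t)^-1 ^+ n)).
rewrite (@cint_sum _ N.+1 (fun n t => zeta ^+ n * (circle r t)^-1 ^+ n))//.
rewrite big_ord_recl big1 => [|i _]; last first.
  have cV (j : nat) (t : R) : ccont (fun t : R => (circle r t : C)^-1 ^+ j) t.
    by apply: ccontX; exact: ccont_circleV.
  have cW (j : nat) (t : R) : ccont (fun t : R => (cis t : C)^-1 ^+ j) t.
    by apply: ccontX; exact: ccont_cisV.
  rewrite (cintZ _ (cV _)).
  rewrite (@eq_cint _ _ (fun t => ofR r^-1 ^+ i.+1 * (cis t)^-1 ^+ i.+1)); last first.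
    by move=> t; rewrite circleV exprMn.
  by rewrite (cintZ _ (cW _)) cint_cisVX !mulr0.
rewrite addr0 (@eq_cint _ _ (fun=> 1)) => [|t]; last by rewrite !expr0 mulr1.
rewrite cint_cst mulr1 addrAC subrr add0r.
rewrite -mulrA; apply: cint_bound => // t.
rewrite modulusM quot_bound mulrC; apply: ler_wpM2r; last exact: kernel_bound.
by rewrite exprn_ge0// divr_ge0 ?modulus_ge0// ltW.
Qed.

End expansion.

End polynomial_approximation.

Section polynomial_approximation.
Context {R : realType}.
Local Notation C := (Cplx R).

Lemma continuous_segment_bounded (f : R -> R) (a b : R) : a <= b -> cont_on a b f ->
  exists2 M, 0 < M & forall t, a <= t <= b -> f t <= M.
Proof.
move=> ab cf; have [|c _ hc] := @EVT_max R f a b ab.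
  by apply: continuous_in_subspaceT => t; rewrite inE /= in_itv /=; exact: cf.
exists (Num.max 1 (f c)) => [|t ht]; first by rewrite lt_max ltr01.
by rewrite le_max hc ?orbT// in_itv.
Qed.

(** Cauchy's formula on a circle of intermediate radius [R1], with the kernel
    expanded: the partial sums are polynomials in [z], and the remainder is of
    order [(r / R1) ^+ N] uniformly on the smaller disc. *)
Lemma holomorphic_poly_approx (g : C -> C) (rho r e : R) : 0 < r -> r < rho -> 0 < e ->
  (forall z, modulus z < rho -> exists d, cderiv g z d) ->
  exists P : {poly C}, forall z, modulus z <= r -> modulus (g z - P.[z]) <= e.
Proof.
move=> r0 rrho e0 dg.
pose R1 := (r + rho) / 2.
have R10 : 0 < R1 by rewrite /R1; lra.
have rR1 : r < R1 by rewrite /R1; lra.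
have R1rho : R1 < rho by rewrite /R1; lra.
have cg t : ccont (fun t => g (circle R1 t)) t.
  have [|d hd] := dg (circle R1 t); first by rewrite modulus_circle gtr0_norm.
  by apply: ccont_comp hd; exact: ccont_circle.
have [M M0 hM] : exists2 M, 0 < M & forall t, 0 <= t <= 2 * pi -> modulus (g (circle R1 t)) <= M.
  apply: continuous_segment_bounded (ltW pi2_gt0) _ => t _.
  by apply: ccont_modulus.
pose B := R1 / (R1 - r).
have B0 : 0 < B by rewrite divr_gt0// subr_gt0.
pose y := r / R1.
have y0 : 0 <= y by rewrite divr_ge0// ltW.
have y1 : `|y| < 1 by rewrite ger0_norm// ltr_pdivrMr// mul1r.
have BM0 : 0 < 2 * B * M := mulr_gt0 (mulr_gt0 (ltr0Sn R 1) B0) M0.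
have eB : 0 < e / (2 * B * M) by rewrite divr_gt0.
have := cvg_expr y1; move/cvgrPdist_lt => /(_ _ eB) [N _ /(_ N (leqnn N))] /=.
rewrite sub0r normrN (ger0_norm (exprn_ge0 _ y0)) ltr_pdivlMr// => hN.
pose c n := cint (fun t => (circle R1 t)^-1 ^+ n * g (circle R1 t)).
exists (\sum_(n < N) ((ofR (2 * pi))^-1 * c n) *: 'X^n) => z zr.
have zR1 : modulus z < R1 by apply: le_lt_trans zr _.
have := @cauchy R g rho R1 z R10 R1rho zR1 dg.
have ck := ccont_kernel R10 zR1.
rewrite (@eq_cint _ _ (fun t => kernel z R1 t * g (circle R1 t) - g z * kernel z R1 t)); last first.
  by move=> t; ring.
rewrite cintB; first last.
- by move=> t; apply: ccontM => //; exact: ccont_cst.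
- by move=> t; apply: ccontM.
rewrite (cintZ _ ck) cint_kernel// => /eqP; rewrite subr_eq0 => /eqP.
have cterm n t : ccont (fun t => (circle R1 t)^-1 ^+ n * g (circle R1 t)) t.
  by apply: ccontM => //; apply: ccontX; exact: ccont_circleV.
have cterm' n t : ccont (fun t => z ^+ n * ((circle R1 t)^-1 ^+ n * g (circle R1 t))) t.
  by apply: ccontM => //; exact: ccont_cst.
rewrite (@eq_cint _ _ (fun t =>
   \sum_(n < N) z ^+ n * ((circle R1 t)^-1 ^+ n * g (circle R1 t)) +
   (z / circle R1 t) ^+ N * kernel z R1 t * g (circle R1 t))); last first.
  move=> t; rewrite {1}(kernel_geometric R10 zR1 N) mulrDl mulr_suml; congr (_ + _).
  by apply: eq_bigr => i _; rewrite mulrA.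
have crem t : ccont (fun t => (z / circle R1 t) ^+ N * kernel z R1 t * g (circle R1 t)) t.
  by apply: ccontM => //; apply: ccontM => //; exact: ccont_quot.
rewrite cintD//; last first.
  by move=> t; exact: (@ccont_sum _ N (fun n t => z ^+ n * ((circle R1 t)^-1 ^+ n * g (circle R1 t)))).
rewrite (@cint_sum _ N (fun n t => z ^+ n * ((circle R1 t)^-1 ^+ n * g (circle R1 t))))//.
under eq_bigr do rewrite cintZ//.
have pi0 : (ofR (2 * pi) : C) != 0.
  by apply/eqP => /(congr1 (@complex.Re R)) /= /eqP; rewrite (gt_eqF pi2_gt0).
have -> : (\sum_(n < N) ((ofR (2 * pi))^-1 * c n) *: 'X^n).[z] =
   (ofR (2 * pi))^-1 * \sum_(n < N) z ^+ n * c n.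
  rewrite horner_sum mulr_sumr; apply: eq_bigr => i _.
  by rewrite hornerZ hornerXn; ring.
set S := \sum_(n < N) _; set Rem := cint _ => hS.
have -> : g z - (ofR (2 * pi))^-1 * S = (ofR (2 * pi))^-1 * Rem.
  have -> : Rem = g z * ofR (2 * pi) - S by rewrite -hS addrC addKr.
  by rewrite mulrBr mulrCA mulVf// mulr1.
have bR : modulus Rem <= 4 * pi * (y ^+ N * B * M).
  apply: cint_bound_in => // t ht; rewrite modulusM [X in X * _]modulusM quot_bound//.
  have zR0 : 0 < R1 - modulus z by rewrite subr_gt0.
  have rR0 : 0 < R1 - r by rewrite subr_gt0.
  have x0 : 0 <= modulus z / R1 := divr_ge0 (modulus_ge0 z) (ltW R10).
  have xy : modulus z / R1 <= y by apply: ler_wpM2r => //; rewrite invr_ge0 ltW.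
  have xyN : (modulus z / R1) ^+ N <= y ^+ N by apply: lerXn2r.
  have kB : modulus (kernel z R1 t) <= B.
    apply: le_trans (kernel_bound R10 zR1 t) _; apply: ler_wpM2l; first exact: ltW.
    by rewrite lef_pV2 ?posrE// lerB.
  have k0 := modulus_ge0 (kernel z R1 t); have xN0 := exprn_ge0 N x0.
  exact: ler_pM (mulr_ge0 xN0 k0) (modulus_ge0 _) (ler_pM xN0 k0 xyN kB) (hM t ht).
rewrite modulusM modulusV modulus_ofR (gtr0_norm pi2_gt0) mulrC ler_pdivrMr ?pi2_gt0//.
apply: le_trans bR _.
have -> : 4 * pi * (y ^+ N * B * M) = y ^+ N * (2 * B * M) * (2 * pi) by ring.
by apply: ler_wpM2r; [exact: ltW pi2_gt0|exact: ltW].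
Qed.

(** Since [kernel z r t - kernel 0 r t = z / (circle r t - z)], Cauchy's formula
    bounds [f (c + z) - f c] by a multiple of [modulus z], and the derivative
    inherits the bound. *)
Lemma cauchy_estimate (f : C -> C) (c d : C) (rho M : R) : 0 < rho ->
  (forall z, modulus (z - c) < rho -> exists d, cderiv f z d) ->
  (forall z, modulus (z - c) < rho -> modulus (f z) <= M) ->
  cderiv f c d -> modulus d <= 8 * M / rho.
Proof.
move=> rho0 df hM hd.
pose r := rho / 2.
have r0 : 0 < r by rewrite /r; lra.
have rrho : r < rho by rewrite /r; lra.
have df' z : modulus z < rho -> exists d, cderiv (fun z => f (c + z)) z d.
  move=> zr; have [|d' hd'] := df (c + z); first by rewrite (addrC c) addrK.
  by exists d'; exact: cderiv_shift.
have M0 : 0 <= M.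
  by apply: le_trans (modulus_ge0 (f c)) (hM c _); rewrite subrr modulus0.
have cf t : ccont (fun t => f (c + circle r t)) t.
  have [|d' hd'] := df' (circle r t); first by rewrite modulus_circle gtr0_norm.
  by apply: (@ccont_comp _ (fun z => f (c + z))) hd'; exact: ccont_circle.
have key z : modulus z < r -> modulus (f (c + z) - f c) <= 2 * (modulus z / (r - modulus z)) * M.
  move=> zr.
  have h1 := @cauchy R (fun z => f (c + z)) rho r z r0 rrho zr df'.
  have h0 := @mean_value R f c rho r r0 rrho df.
  have ck := ccont_kernel r0 zr.
  have h2 : cint (fun t => kernel z r t * f (c + circle r t)) = f (c + z) * ofR (2 * pi).
    apply/eqP; rewrite -subr_eq0 -(cint_kernel r0 zr) -cintZ// -cintB; first last.
    - by move=> t; apply: ccontM => //; exact: ccont_cst.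
    - by move=> t; apply: ccontM.
    by apply/eqP; rewrite -[RHS]h1; apply: eq_cint => t; ring.
  have h3 : cint (fun t => (kernel z r t - 1) * f (c + circle r t)) =
      ofR (2 * pi) * (f (c + z) - f c).
    rewrite mulrBr -h0 [ofR _ * _]mulrC -h2 -cintB//; last by move=> t; apply: ccontM.
    by apply: eq_cint => t; ring.
  have h4 : modulus (ofR (2 * pi) * (f (c + z) - f c)) <=
      4 * pi * (modulus z / (r - modulus z) * M).
    rewrite -h3; apply: cint_bound => t.
      by apply: ccontM => //; apply: ccontB => //; exact: ccont_cst.
    have zr0 : 0 < r - modulus z by rewrite subr_gt0.
    rewrite modulusM; apply: ler_pM; rewrite ?modulus_ge0//; last first.
      by apply: hM; rewrite (addrC c) addrK modulus_circle gtr0_norm.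
    rewrite (_ : kernel z r t - 1 = z / (circle r t - z)); last first.
      by rewrite /kernel; field; exact: circle_sub_neq0.
    rewrite modulusM modulusV; apply: ler_wpM2l; first exact: modulus_ge0.
    by rewrite lef_pV2 ?posrE ?circle_sub_ge ?(lt_le_trans zr0 (circle_sub_ge z r0 t)).
  move: h4; rewrite modulusM modulus_ofR (gtr0_norm pi2_gt0).
  have -> : 4 * pi * (modulus z / (r - modulus z) * M) =
     2 * pi * (2 * (modulus z / (r - modulus z)) * M) by ring.
  by rewrite ler_pM2l ?pi2_gt0.
(* the derivative is tested along small positive reals *)
apply/ler_addgt0Pr => e e0.
have [h h0 hh] := hd e e0.
pose x := Num.min (h / 2) (r / 2).
have x0 : 0 < x by rewrite lt_min !divr_gt0.
have xh : x < h by rewrite gt_min; apply/orP; left; lra.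
have xr : x <= r / 2 by rewrite ge_min lexx orbT.
have mx : modulus (ofR x : C) = x by rewrite modulus_ofR gtr0_norm.
have := hh (c + ofR x); rewrite (addrC c) addrK mx => /(_ xh) hx.
have := key (ofR x); rewrite mx => /(_ ltac:(lra)); rewrite (addrC c) => kx.
have : modulus (d * ofR x) <= modulus (f (ofR x + c) - f c) + e * x.
  rewrite (_ : d * ofR x = (f (ofR x + c) - f c) - (f (ofR x + c) - f c - d * ofR x)); last by ring.
  by apply: le_trans (modulusB _ _) _; apply: lerD.
rewrite modulusM mx => b.
have {}kx : modulus (f (ofR x + c) - f c) <= 2 * (x / (r / 2)) * M.
  apply: le_trans kx _; apply: ler_wpM2r => //; apply: ler_wpM2l => //.
  apply: ler_wpM2l; first exact: ltW.
  by rewrite lef_pV2 ?posrE; lra.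
rewrite -(ler_pM2r x0) mulrDl; apply: le_trans b _; apply: lerD => //.
apply: le_trans kx _; rewrite le_eqVlt; apply/orP; left; apply/eqP.
by rewrite /r; field; rewrite gt_eqF.
Qed.

(** A uniform approximation on a slightly larger disc also controls the
    derivatives, by Cauchy's estimate. *)
Lemma holomorphic_poly_approx1 (g : C -> C) (rho r e : R) : 0 < r -> r < rho -> 0 < e ->
  (forall z, modulus z < rho -> exists d, cderiv g z d) ->
  exists P : {poly C}, forall z, modulus z <= r ->
    modulus (g z - P.[z]) <= e /\ modulus (derive1 g z - P^`().[z]) <= e.
Proof.
move=> r0 rrho e0 dg.
pose r' := (r + rho) / 2.
have r'0 : 0 < r' by rewrite /r'; lra.
have r'rho : r' < rho by rewrite /r'; lra.
have rr' : 0 < r' - r by rewrite /r'; lra.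
pose e' := Num.min e (e * (r' - r) / 8).
have e'0 : 0 < e' by rewrite lt_min e0 /= divr_gt0// mulr_gt0.
have e'e : e' <= e by rewrite ge_min lexx.
have e'e2 : e' <= e * (r' - r) / 8 by rewrite ge_min lexx orbT.
have [P hP] := holomorphic_poly_approx r'0 r'rho e'0 dg.
exists P => z zr; split; first by apply: le_trans (hP z _) _ => //; lra.
have inr' w : modulus (w - z) < r' - r -> modulus w <= r'.
  by move=> wz; have := modulusD (w - z) z; rewrite subrK; lra.
have dgP w : modulus w <= r' -> cderiv (fun w => g w - P.[w]) w (derive1 g w - P^`().[w]).
  move=> wr; have [|d hd] := dg w; first lra.
  by rewrite (cderiv_derive1 hd); apply: cderivB => //; exact: cderiv_horner.
apply: le_trans (@cauchy_estimate (fun w => g w - P.[w]) z _ (r' - r) e' rr' _ _ (dgP z _)) _.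
- by move=> w /inr' wr; eexists; exact: dgP.
- by move=> w /inr' wr; exact: hP.
- lra.
rewrite ler_pdivrMr//; lra.
Qed.

End polynomial_approximation.

(** * Change of variables and polar coordinates *)

Section measure_restriction.
Context d (T : measurableType d) (R : realType).
Variables (m : {measure set T -> \bar R}) (E : set T) (mE : measurable E).

Lemma ge0_integral_mrestr (F : T -> \bar R) : measurable_fun setT F ->
  (forall x, (0 <= F x)%E) ->
  (\int[mrestr m mE]_x F x = \int[m]_(x in E) F x)%E.
Proof.
move=> mF F0.
rewrite -[in LHS](setUv E) ge0_integral_setU//=; last 3 first.
- exact: measurableC.
- by rewrite setUv.
- by apply/disj_setPCl.
rewrite [X in (_ + X)%E](_ : _ = 0%E) ?adde0.
  apply: eq_measure_integral => A mA AE.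
  by rewrite /= /mrestr classical_sets.setIidl.
apply: null_set_integral; [exact: measurableC|exact: measurable_funTS|].
by rewrite /= /mrestr classical_sets.setICl measure0.
Qed.
End measure_restriction.

Section substitution.
Context {R : realType}.
Local Notation mu := (@lebesgue_measure R).
Local Notation TR := (measurableTypeR R).
Variables (D : set TR) (phi w : TR -> TR).
Hypotheses (mD : measurable D) (mphi : measurable_fun setT phi)
  (mw : measurable_fun setT w) (w0 : forall x, D x -> 0 <= w x).

Let E : set (TR * TR) := [set p | D p.1 /\ 0 <= p.2 < w p.1].

Let mE : measurable E.
Proof.
rewrite (_ : E = (D `*` setT) `&` (setT `*` `[0, +oo[) `&`
   ((fun p : TR * TR => p.2 < w p.1) @^-1` [set true])).
  apply: measurableI; first by apply: measurableI; exact: measurableX.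
  rewrite -[X in measurable X]setTI; apply: measurable_fun_ltr => //.
  exact: measurableT_comp.
apply/seteqP; split => [[x y] [Dx /andP[y0 yw]]|[x y] [[[Dx _] [_]]]] /=;
  rewrite ?in_itv /=.
  by rewrite y0.
by rewrite andbT => y0 yw; split => //; rewrite y0 yw.
Qed.

Let Phi (p : TR * TR) : TR := phi p.1.

Let mPhi : measurable_fun setT Phi.
Proof. exact: measurableT_comp. Qed.

(** The measure of density [w] pushed forward by [phi]. Realising it as an image
    of the planar measure restricted to the region under the graph of [w] gives
    its countable additivity for free. *)
Let hypograph_measure : exists nu : {measure set TR -> \bar R},
  forall H : TR -> \bar R, measurable_fun setT H -> (forall x, 0 <= H x)%E ->
  (\int[nu]_y H y = \int[mu]_(x in D) (H (phi x) * (w x)%:E))%E.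
Proof.
pose m := mrestr (mu \x mu)%E mE.
have [nu hnu] : exists nu : {measure set TR -> \bar R},
    forall A, nu A = m (Phi @^-1` A).
  unshelve (eexists (pushforward m Phi)). all: try exact: mPhi. by [].
exists nu => H mH H0.
have mHP : measurable_fun setT (H \o Phi) by exact: measurableT_comp.
transitivity (\int[pushforward m Phi]_y H y)%E.
  by apply: eq_measure_integral => A _ _; rewrite hnu.
rewrite ge0_integral_pushforward//.
rewrite preimage_setT ge0_integral_mrestr//; last by move=> x; exact: H0.
rewrite integral_mkcond fubini_tonelli1.
- rewrite [RHS]integral_mkcond; apply: eq_integral => x _.
  rewrite /fubini_F.
  transitivity (\int[mu]_y ((H (phi x)) * (\1_(xsection E x) y)%:E))%E.
    apply: eq_integral => y _; rewrite /patch /= indicE.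
    case: ifPn => h; first by rewrite mem_xsection h mule1.
    by rewrite mem_xsection (negbTE h) mule0.
  rewrite ge0_integralZl//; last first.
    apply/measurable_EFinP; apply: measurable_indic.
    exact: measurable_xsection.
  rewrite integral_indic//; last exact: measurable_xsection.
  rewrite setIT /patch; case: ifPn => [|] Dx.
    congr (_ * _)%E; move: Dx; rewrite inE => Dx.
    rewrite (_ : xsection E x = `[0, w x[%classic).
      rewrite [LHS]lebesgue_measure_itv /= lte_fin.
      by case: ltgtP (w0 Dx) => [_ _|//|<- _]; rewrite ?oppr0 ?adde0.
    apply/seteqP; split => y; rewrite /xsection /= inE /E /= in_itv /=.
      by case.
    by [].
  rewrite (_ : xsection E x = set0) ?measure0 ?mule0//.
  apply/seteqP; split => y //; rewrite /xsection /= inE => -[/= Dx' _].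
  by move: Dx; rewrite notin_setE.
- apply/(measurable_restrict _ mE measurableT) => //; rewrite ?setTI//.
  exact: measurable_funTS.
- by move=> p; rewrite /patch; case: ifP => // _; exact: H0.
Qed.

(** Both sides are integrals of [H], against Lebesgue measure and against [nu];
    by hypothesis the two measures agree on intervals, hence they are equal. The
    densities to which this is applied are only known to be measurable. *)
Lemma ge0_integral_substitution :
  (forall a b : R, a < b ->
     (\int[mu]_(x in D `&` phi @^-1` `]a, b]) (w x)%:E = (b - a)%:E)%E) ->
  forall H : TR -> \bar R, measurable_fun setT H -> (forall x, 0 <= H x)%E ->
  (\int[mu]_y H y = \int[mu]_(x in D) (H (phi x) * (w x)%:E))%E.
Proof.
move=> hab H mH H0; have [nu hnu] := hypograph_measure.
rewrite -hnu//; apply: eq_measure_integral => A mA _.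
apply: lebesgue_measure_unique => // X [[a b] _ <-].
have mX : measurable (`]a, b] : set TR) by exact: measurable_itv.
have := hnu (fun x => (\1_(`]a, b]%classic) x)%:E).
rewrite integral_indic// setIT => -> //; last first.
  by apply/measurable_EFinP; exact: measurable_indic.
transitivity (\int[mu]_(x in D `&` phi @^-1` `]a, b]) (w x)%:E)%E.
  have [ab|ba] := ltP a b; first by rewrite hab// lebesgue_measure_itv /= lte_fin ab.
  rewrite [in RHS]set_itv_ge ?bnd_simp -?leNgt// preimage_set0 setI0 integral_set0.
  by rewrite [in LHS]set_itv_ge ?bnd_simp -?leNgt// measure0.
rewrite integral_mkcondr; apply: eq_integral => x _.
rewrite /patch indicE; case: ifPn => h.
  by rewrite (_ : phi x \in _ = true) ?mul1e//; move: h; rewrite !inE.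
by rewrite (_ : phi x \in _ = false) ?mul0e//; move: h; rewrite !notin_setE => h;
  apply/negbTE; rewrite notin_setE.
Qed.

End substitution.

Section changes_of_variable.
Context {R : realType}.
Local Notation mu := (@lebesgue_measure R).
Implicit Type H : R -> \bar R.

Lemma ge0_integral_scale c H : 0 < c -> measurable_fun setT H ->
  (forall x, (0 <= H x)%E) ->
  (\int[mu]_x H x = \int[mu]_x (H (c * x)%R * c%:E))%E.
Proof.
move=> c0 mH H0.
have := @ge0_integral_substitution R setT (fun x => c * x) (fun=> c) measurableT _ _ _ _ H mH H0.
move=> ->//.
- exact: measurable_funM.
- by move=> x _; exact: ltW.
- move=> a b ab; rewrite setTI (_ : _ @^-1` _ = `]a / c, b / c]%classic); last first.
    apply/seteqP; split => x /=; rewrite !in_itv /= ltr_pdivrMr// ler_pdivlMr//.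
      by rewrite ![x * c]mulrC.
    by rewrite ![x * c]mulrC.
  rewrite integral_cst//= lebesgue_measure_itv /= lte_fin ltr_pM2r ?invr_gt0// ab.
  by rewrite -EFinB -EFinM; congr (_%:E); field; rewrite gt_eqF.
Qed.

Lemma ge0_integral_shift c H : measurable_fun setT H -> (forall x, (0 <= H x)%E) ->
  (\int[mu]_x H x = \int[mu]_x H (x + c)%R)%E.
Proof.
move=> mH H0.
have := @ge0_integral_substitution R setT (fun x => x + c) (fun=> 1) measurableT _ _ _ _ H mH H0.
move=> ->//.
- by apply: eq_integral => x _; rewrite mule1.
- exact: measurable_funD.
- move=> a b ab; rewrite setTI (_ : _ @^-1` _ = `]a - c, b - c]%classic); last first.
    by apply/seteqP; split => x /=; rewrite !in_itv /= ltrBlDr lerBrDr.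
  rewrite integral_cst//= lebesgue_measure_itv /= lte_fin ltrD2r ab.
  by rewrite -EFinB mul1e; congr (_%:E); ring.
Qed.

Lemma ge0_integral_opp H : measurable_fun setT H -> (forall x, (0 <= H x)%E) ->
  (\int[mu]_x H x = \int[mu]_x H (- x)%R)%E.
Proof.
move=> mH H0.
have := @ge0_integral_substitution R setT (fun x => - x) (fun=> 1) measurableT _ _ _ _ H mH H0.
move=> ->//.
- by apply: eq_integral => x _; rewrite mule1.
- exact: measurable_funN.
- move=> a b ab; rewrite setTI (_ : _ @^-1` _ = `[- b, - a[%classic); last first.
    by apply/seteqP; split => x /=; rewrite !in_itv /= ltrNr lerNl andbC.
  rewrite integral_cst//= lebesgue_measure_itv /= lte_fin ltrN2 ab.
  by rewrite -EFinB mul1e; congr (_%:E); ring.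
Qed.

Definition halfturn : set R := `]- (pi / 2), (pi / 2)[.

(** Cut off outside the half turn, so as to be measurable on the whole line. *)
Definition tan0 : R -> R := tan \_ halfturn.

Lemma cos_halfturn t : halfturn t -> 0 < cos t.
Proof. by rewrite /halfturn /= in_itv /= => ?; exact: cos_gt0_pihalf. Qed.

Lemma tan0E t : halfturn t -> tan0 t = tan t.
Proof. by move=> h; rewrite /tan0 /patch mem_set. Qed.

Lemma measurable_tan0 : measurable_fun setT tan0.
Proof.
apply/(measurable_restrict _ _ measurableT) => //; first exact: measurable_itv.
rewrite setTI; apply: open_continuous_measurable_fun; first exact: itv_open.
move=> t; rewrite inE => /cos_halfturn ct.
by apply: continuous_tan; rewrite gt_eqF.
Qed.

Lemma ge0_integral_tan (x : R) H : 0 < x -> measurable_fun setT H ->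
  (forall y, (0 <= H y)%E) ->
  (\int[mu]_y H y =
   \int[mu]_(t in halfturn) (H (x * tan0 t)%R * (x * (1 + tan0 t ^+ 2))%:E))%E.
Proof.
move=> x0 mH H0.
have mt := measurable_tan0.
have := @ge0_integral_substitution R halfturn (fun t => x * tan0 t)
  (fun t => x * (1 + tan0 t ^+ 2)) _ _ _ _ _ H mH H0.
move=> ->//.
- exact: measurable_itv.
- exact: measurable_funM.
- apply: measurable_funM => //; apply: measurable_funD => //.
  exact: measurable_funX.
- by move=> t _; rewrite mulr_ge0 ?ltW// ltr_pwDl ?sqr_ge0.
move=> a b ab.
have E : halfturn `&` (fun t => x * tan0 t) @^-1` `]a, b] =
   `]atan (a / x), atan (b / x)]%classic.
  apply/seteqP; split => t /=; rewrite !in_itv /=.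
    move=> [ht]; rewrite tan0E// => /andP[h1 h2]; move: (ht); rewrite /halfturn /= in_itv /= => ht'.
    have at' : atan (tan t) = t by rewrite tanK// in_itv.
    rewrite -[in X in _ < X]at' -[in X in X <= _]at'.
    rewrite lt_atan 1?ler_wpM2r//= ?le_atan ?invr_ge0//.
    - by rewrite ler_pdivlMr// mulrC.
    - by rewrite ltr_pdivrMr// mulrC.
  move=> /andP[h1 h2].
  have ht : halfturn t.
    rewrite /halfturn /= in_itv /=; apply/andP; split.
      exact: lt_trans (atan_gtNpi2 _) h1.
    exact: le_lt_trans h2 (atan_ltpi2 _).
  split => //; rewrite tan0E//.
  have ait (y : R) : atan y \in `](- (pi / 2)), (pi / 2)[.
    by rewrite in_itv /= atan_gtNpi2 atan_ltpi2.
  have hti : t \in `](- (pi / 2)), (pi / 2)[ by [].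
  rewrite mulrC -ltr_pdivrMr// -ler_pdivlMr//; apply/andP; split.
    by have := ltr_tan (ait (a / x)) hti; rewrite atanK => ->.
  by have := ltr_tan (ait (b / x)) hti; rewrite atanK leNgt => ->; rewrite -leNgt.
rewrite E.
have abx : atan (a / x) < atan (b / x) by rewrite lt_atan// ltr_pM2r ?invr_gt0.
set al := atan (a / x) in abx *; set be := atan (b / x) in abx *.
have sub t : al <= t <= be -> halfturn t.
  move=> /andP[h1 h2]; rewrite /halfturn /= in_itv /=; apply/andP; split.
    exact: lt_le_trans (atan_gtNpi2 _) h1.
  exact: le_lt_trans h2 (atan_ltpi2 _).
rewrite (@integral_itv_obnd_cbnd R al (BRight be)); last first.
  apply/measurable_EFinP/measurable_funTS; apply: measurable_funM => //.
  by apply: measurable_funD => //; exact: measurable_funX.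
transitivity (\int[mu]_(t in `[al, be]) (x * (cos t) ^- 2)%:E)%E.
  apply: eq_integral => t; rewrite inE /= in_itv /= => /sub ht.
  by rewrite tan0E// -cos2_tan2// gt_eqF// cos_halfturn.
have cn0 t : al <= t <= be -> cos t != 0.
  by move=> /sub/cos_halfturn/gt_eqF ->.
have dt t : al <= t <= be -> is_derive t 1 (fun t => x * tan t) (x * (cos t) ^- 2).
  move=> /cn0 ct; have := is_derive_tan ct => dt.
  have := @is_deriveZ R R R tan x t 1 _ dt.
  by rewrite /GRing.scale /=.
rewrite (@continuous_FTC2 R _ (fun t => x * tan t))//.
- by rewrite !atanK -EFinB; congr (_%:E); field; rewrite gt_eqF.
- apply: continuous_in_subspaceT => t; rewrite inE /= in_itv /= => /cn0 ct.
  suff : {for t, continuous (fun t : R => x * (cos t * cos t)^-1)}.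
    by apply: cvg_trans.
  apply: continuousM; first exact: cst_continuous.
  apply: continuousV; first by rewrite mulf_neq0.
  by apply: continuousM; exact: continuous_cos.
- split.
  + move=> t; rewrite in_itv /= => /andP[h1 h2].
    by have [] := dt t ltac:(by rewrite !ltW).
  + apply: cvg_at_right_filter; apply: continuousM; first exact: cst_continuous.
    by apply: continuous_tan; apply: cn0; rewrite lexx ltW.
  + apply: cvg_at_left_filter; apply: continuousM; first exact: cst_continuous.
    by apply: continuous_tan; apply: cn0; rewrite lexx ltW.
- move=> t; rewrite in_itv /= => /andP[h1 h2].
  have ht : al <= t <= be by rewrite !ltW.
  have dtt := dt t ht.
  by rewrite derive1E derive_val.
Qed.

End changes_of_variable.

Section polar.
Context {R : realType}.
Local Notation mu := (@lebesgue_measure R).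
Local Notation T2 := (measurableTypeR R * measurableTypeR R)%type.
Implicit Type F : T2 -> \bar R.

Lemma measurable_cos : measurable_fun setT (@cos R).
Proof. by apply: continuous_measurable_fun; exact: continuous_cos. Qed.

Lemma measurable_sin : measurable_fun setT (@sin R).
Proof. by apply: continuous_measurable_fun; exact: continuous_sin. Qed.

Definition ray F (t : R) : \bar R :=
  (\int[mu]_(r in `]0%R, +oo[) (F ((r * cos t)%R, (r * sin t)%R) * r%:E))%E.

Lemma mule_indic (A : set R) (x : R) (y : \bar R) :
  (y * (\1_A x)%:E)%E = if x \in A then y else 0%E.
Proof. by rewrite indicE; case: (x \in A); rewrite ?mule1 ?mule0. Qed.

Lemma integral_indic_mul (A : set R) (f : R -> \bar R) :
  (\int[mu]_(x in A) f x = \int[mu]_x (f x * (\1_A x)%:E))%E.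
Proof.
by rewrite integral_mkcond; apply: eq_integral => x _; rewrite mule_indic.
Qed.

Lemma measurable_pos : measurable (`]0, +oo[%classic : set R).
Proof. exact: measurable_itv. Qed.

Lemma measurable_halfturn : measurable (@halfturn R).
Proof. exact: measurable_itv. Qed.

Lemma measurable_indicE (A : set R) d (T : measurableType d) (f : T -> R) :
  measurable A -> measurable_fun setT f ->
  measurable_fun setT (fun x => (\1_A (f x))%:E : \bar R).
Proof.
move=> mA mf; apply/measurable_EFinP.
by apply: (@measurableT_comp _ _ _ _ _ _ (\1_A : R -> R)).
Qed.

(** Two one-dimensional substitutions separated by an exchange of integrals: [y
    = x tan t] for fixed [x], then [x = r cos t] for fixed [t]. *)
Lemma half_plane_polar F : measurable_fun setT F -> (forall p, (0 <= F p)%E) ->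
  (\int[mu]_(x in `]0%R, +oo[) \int[mu]_y F (x, y) =
   \int[mu]_(t in @halfturn R) ray F t)%E.
Proof.
move=> mF F0.
have mt := @measurable_tan0 R.
have mpos := measurable_pos; have mht := measurable_halfturn.
pose G (p : T2) : \bar R := (F (p.1, p.1 * tan0 p.2)%R * (p.1 * (1 + tan0 p.2 ^+ 2))%:E
   * (\1_`]0, +oo[%classic p.1)%:E * (\1_halfturn p.2)%:E)%E.
have mt2 : measurable_fun [set: T2] (fun p : T2 => tan0 p.2).
  exact: measurableT_comp.
have mG : measurable_fun setT G.
  apply: emeasurable_funM; last exact: measurable_indicE.
  apply: emeasurable_funM; last exact: measurable_indicE.
  apply: emeasurable_funM.
    apply: (measurableT_comp mF); apply: measurable_fun_pair => //.
    exact: measurable_funM.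
  apply/measurable_EFinP; apply: measurable_funM => //.
  by apply: measurable_funD => //; exact: measurable_funX.
have G0 p : (0 <= G p)%E.
  rewrite /G mule_indic; case: ifP => // _; rewrite mule_indic; case: ifP => //.
  rewrite inE /= in_itv /= andbT => p0; apply: mule_ge0; first exact: F0.
  by rewrite lee_fin mulr_ge0 ?ltW// ltr_pwDl ?sqr_ge0.
transitivity (\int[mu]_x \int[mu]_t G (x, t))%E.
  rewrite integral_indic_mul; apply: eq_integral => x _.
  rewrite mule_indic; case: ifPn => [|nx].
    rewrite inE /= in_itv /= andbT => x0.
    rewrite (ge0_integral_tan x0)//; last exact: measurableT_comp (pair1_measurable x).
    rewrite integral_indic_mul; apply: eq_integral => t _.
    by rewrite /G /= [(\1_`]0, +oo[%classic x)]indicE mem_set ?mule1//= in_itv /= x0.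
  rewrite (@eq_integral _ _ _ _ _ (fun=> 0%E)) ?integral0// => t _.
  by rewrite /G /= [(\1_`]0, +oo[%classic x)]indicE (negbTE nx) mule0 mul0e.
rewrite (fubini_tonelli G mG G0) [RHS]integral_indic_mul; apply: eq_integral => t _.
rewrite mule_indic; case: ifPn => [|nt]; last first.
  rewrite (@eq_integral _ _ _ _ _ (fun=> 0%E)) ?integral0// => x _.
  by rewrite /G /= [(\1_halfturn t)]indicE (negbTE nt) mule0.
rewrite inE => ht; have c0 := cos_halfturn ht.
pose H x := G (x, t).
have mH : measurable_fun setT H by exact: measurableT_comp (pair2_measurable t).
rewrite (ge0_integral_scale c0 mH) => [|x]; last exact: G0.
rewrite /ray [RHS]integral_indic_mul; apply: eq_integral => r _.
rewrite /H /G /= [(\1_halfturn t)]indicE mem_set// mule1 !mule_indic.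
have -> : (cos t * r \in `]0, +oo[%classic) = (r \in `]0, +oo[%classic).
  by apply/idP/idP; rewrite !inE /= !in_itv /= !andbT pmulr_rgt0.
case: ifP => // _; last by rewrite mul0e.
rewrite tan0E// -muleA -EFinM; congr (F (_, _) * _%:E)%E.
- by rewrite mulrC.
- by rewrite /tan; field; rewrite gt_eqF.
- rewrite -cos2_tan2 ?gt_eqF//; field; rewrite gt_eqF//.
Qed.

Lemma measurable_polar_map : measurable_fun [set: T2]
  (fun p : T2 => (p.1 * cos p.2, p.1 * sin p.2) : T2).
Proof.
have mc : measurable_fun [set: T2] (fun p : T2 => cos p.2).
  by apply: (measurableT_comp measurable_cos).
have ms : measurable_fun [set: T2] (fun p : T2 => sin p.2).
  by apply: (measurableT_comp measurable_sin).
by apply: measurable_fun_pair; exact: measurable_funM.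
Qed.

Lemma measurable_ray F : measurable_fun setT F -> (forall p, (0 <= F p)%E) ->
  measurable_fun setT (ray F).
Proof.
move=> mF F0.
pose G (p : T2) : \bar R := (F (p.1 * cos p.2, p.1 * sin p.2)%R * p.1%:E
   * (\1_`]0, +oo[%classic p.1)%:E)%E.
have mG : measurable_fun setT G.
  apply: emeasurable_funM; last exact: measurable_indicE measurable_pos _.
  apply: emeasurable_funM; last exact/measurable_EFinP.
  exact: measurableT_comp mF measurable_polar_map.
have G0 p : (0 <= G p)%E.
  rewrite /G mule_indic; case: ifP => //.
  rewrite inE /= in_itv /= andbT => p0; apply: mule_ge0; first exact: F0.
  by rewrite lee_fin ltW.
rewrite (_ : ray F = fun t => \int[mu]_x G (x, t))%E.
  exact: (measurable_fun_fubini_tonelli_G _ mG).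
by apply/funext => t; rewrite /ray integral_indic_mul.
Qed.

Lemma ray_ge0 F t : (forall p, (0 <= F p)%E) -> (0 <= ray F t)%E.
Proof.
move=> F0; apply: integral_ge0 => r; rewrite /= in_itv /= andbT => r0.
by apply: mule_ge0; [exact: F0|rewrite lee_fin ltW].
Qed.

Lemma rayDpi F t : ray F (t + pi) = ray (fun p => F (- p.1, - p.2)) t.
Proof. by apply: eq_integral => r _; rewrite cosDpi sinDpi !mulrN. Qed.

Lemma rayD2pi F t : ray F (t + 2 * pi) = ray F t.
Proof.
by apply: eq_integral => r _; rewrite mulr_natl cosD2pi sinD2pi.
Qed.

Lemma integral_itv_shift (f : R -> \bar R) (u v c : R) : measurable_fun setT f ->
  (forall x, (0 <= f x)%E) ->
  (\int[mu]_(x in `[(u + c)%R, (v + c)%R[) f x = \int[mu]_(x in `[u, v[) f (x + c)%R)%E.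
Proof.
move=> mf f0; rewrite [LHS]integral_indic_mul (ge0_integral_shift c).
- rewrite [RHS]integral_indic_mul; apply: eq_integral => x _.
  rewrite !indicE; congr (_ * (nat_of_bool _)%:R%:E)%E.
  by apply/idP/idP; rewrite !inE /= !in_itv /= lerD2r ltrD2r.
- by apply: emeasurable_funM => //; apply: measurable_indicE.
- by move=> x; rewrite mule_indic; case: ifP.
Qed.

Lemma integral_itv_split (f : R -> \bar R) (u v c : R) : measurable_fun setT f ->
  (forall x, (0 <= f x)%E) -> u <= c -> c <= v ->
  (\int[mu]_(x in `[u, v[) f x = \int[mu]_(x in `[u, c[) f x + \int[mu]_(x in `[c, v[) f x)%E.
Proof.
move=> mf f0 uc cv; rewrite -ge0_integral_setU//.
- congr (integral mu _ f); apply/seteqP; split => x /=; rewrite !in_itv /=.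
    move=> /andP[ux xv]; case: (ltP x c) => xc; [left|right]; rewrite ?ux//=.
  by move=> [|] /andP[h1 h2]; apply/andP; split; lra.
- exact: measurable_funTS.
- apply/disj_setPRL => x /=; rewrite !in_itv /= => /andP[h1 h2] /andP[h3 h4].
  by lra.
Qed.

(** The two half planes give the half turns centred at [0] and at [pi]. The
    origin [a] of the period is left free so that a given arc can be made its
    initial part. *)
Lemma full_polar F (a : R) : measurable_fun setT F -> (forall p, (0 <= F p)%E) ->
  (\int[(mu \x mu)%E]_p F p = \int[mu]_(t in `[a, (a + 2 * pi)%R[) ray F t)%E.
Proof.
move=> mF F0.
have mr := measurable_ray mF F0; have r0 t := @ray_ge0 F t F0.
pose h := pi / 2 : R.
have h0 : 0 < h by rewrite divr_gt0 ?pi_gt0.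
have pih : pi = 2 * h by rewrite /h; field.
have oo (g : R -> \bar R) : measurable_fun setT g ->
    (\int[mu]_(t in @halfturn R) g t = \int[mu]_(t in `[(- h)%R, h[) g t)%E.
  by move=> mg; rewrite [RHS]integral_itv_bndoo//; exact: measurable_funTS.
clearbody h.
have hh1 : - h <= h by rewrite -subr_ge0 opprK addr_ge0 ?ltW.
have hh2 : h <= - h + 2 * pi by rewrite pih; lra.
have e1 : - h + pi = h by rewrite pih; ring.
have e2 : h + pi = - h + 2 * pi by rewrite pih; ring.
transitivity (\int[mu]_(t in `[(- h)%R, (- h + 2 * pi)%R[) ray F t)%E.
  rewrite (fubini_tonelli1 F mF F0) /fubini_F.
  set f := fun x => _.
  have mf : measurable_fun setT f by exact: measurable_fun_fubini_tonelli_F.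
  have f0 x : (0 <= f x)%E by apply: integral_ge0.
  transitivity (\int[mu]_(x in `]0%R, +oo[) f x + \int[mu]_(x in `]-oo, 0%R[) f x)%E.
    rewrite -[RHS]ge0_integral_setU//; last 2 first.
    - exact: measurable_funTS.
    - apply/disj_setPRL => x /=; rewrite !in_itv /= andbT => xp xn.
      by move: (lt_trans xp xn); rewrite ltxx.
    rewrite -(@integral_setD1 R f 0 setT); last 2 first.
    - exact: measurableD.
    - exact: measurable_funTS.
    congr (integral mu _ f); apply/seteqP; split => x /=; rewrite !in_itv /= ?andbT.
      by move=> [_ /eqP]; case: ltgtP => //; auto.
    by move=> [|] xn; split=> // x0; rewrite x0 ltxx in xn.
  rewrite half_plane_polar//.
  pose F' (p : T2) := F (- p.1, - p.2).
  have mF' : measurable_fun setT F'.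
    apply: (measurableT_comp mF); apply: measurable_fun_pair; exact: measurable_funN.
  have F'0 p : (0 <= F' p)%E by exact: F0.
  have -> : (\int[mu]_(x in `]-oo, 0%R[) f x = \int[mu]_(t in @halfturn R) ray F' t)%E.
    rewrite -(half_plane_polar mF' F'0) integral_indic_mul ge0_integral_opp.
    - rewrite [RHS]integral_indic_mul; apply: eq_integral => x _; congr (_ * _)%E.
        by apply: ge0_integral_opp => //; exact: measurableT_comp mF (pair1_measurable _).
      rewrite !indicE; congr ((nat_of_bool _)%:R%:E).
      by apply/idP/idP; rewrite !inE /= !in_itv /= andbT oppr_lt0.
    - by apply: emeasurable_funM => //; apply: measurable_indicE.
    - by move=> x; rewrite mule_indic; case: ifP.
  rewrite !oo//; last exact: measurable_ray.
  rewrite (integral_itv_split mr r0 hh1 hh2).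
  apply: (f_equal2 adde erefl).
  transitivity (\int[mu]_(x in `[(- h + pi)%R, (h + pi)%R[) ray F x)%E.
    rewrite (integral_itv_shift _ _ _ mr r0); apply: eq_integral => t _.
    by rewrite rayDpi.
  by rewrite e1 e2.
(* starting points less than a period apart, then any two by whole turns *)
have per (b c : R) : c <= b -> b <= c + 2 * pi ->
    (\int[mu]_(t in `[b, (b + 2 * pi)%R[) ray F t = \int[mu]_(t in `[c, (c + 2 * pi)%R[) ray F t)%E.
  move=> cb bc.
  have cb2 : c + 2 * pi <= b + 2 * pi by rewrite lerD2r.
  rewrite (integral_itv_split mr r0 cb bc) (integral_itv_split mr r0 bc cb2).
  rewrite addeC; congr (_ + _)%E.
  rewrite (integral_itv_shift _ _ _ mr r0); apply: eq_integral => t _.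
  by rewrite rayD2pi.
have p2 : 0 < 2 * pi :> R by rewrite mulr_gt0 ?pi_gt0.
have shiftk (b : R) (k : nat) : (\int[mu]_(t in `[b, (b + 2 * pi)%R[) ray F t =
    \int[mu]_(t in `[(b + (2 * pi) *+ k)%R, (b + (2 * pi) *+ k + 2 * pi)%R[) ray F t)%E.
  elim: k => [|k ->]; first by rewrite mulr0n addr0.
  apply/esym; rewrite mulrSr addrA; apply: per; last exact: lexx.
  by rewrite lerDl; exact: ltW p2.
have key (b c : R) : c <= b ->
    (\int[mu]_(t in `[b, (b + 2 * pi)%R[) ray F t = \int[mu]_(t in `[c, (c + 2 * pi)%R[) ray F t)%E.
  move=> cb; pose k := Num.truncn ((b - c) / (2 * pi)).
  have := truncn_itv (_ : 0 <= (b - c) / (2 * pi)); rewrite divr_ge0 ?subr_ge0 ?(ltW p2)// => /(_ isT).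
  rewrite -/k ler_pdivlMr// ltr_pdivrMr// => /andP[k1 k2].
  rewrite (shiftk c k); apply: per; rewrite -[_ *+ k]mulr_natl; first lra.
  by move: k2; rewrite -natr1 mulrDl mul1r; lra.
by case: (leP a (- h)) => [/key|/ltW/key] ->.
Qed.

End polar.

(** * Arguments and integration over Carleson squares *)

Section argument.
Context {R : realType}.
Local Notation mu := (@lebesgue_measure R).
Local Notation T2 := (measurableTypeR R * measurableTypeR R)%type.
Local Notation C := (Cplx R).

Lemma measurable_invr : measurable_fun setT (@GRing.inv R).
Proof.
pose A := [set x : R | x != 0].
have oA : open A by rewrite /A; have := @open_neq R 0; apply.
have mA : measurable A by exact: open_measurable.
rewrite (_ : GRing.inv = GRing.inv \_ A); last first.
  apply/funext => x; rewrite /patch; case: ifPn => //; rewrite notin_setE /A /=.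
  by move=> /negP; rewrite negbK => /eqP ->; rewrite invr0.
apply/(measurable_restrict _ mA measurableT) => //; rewrite setTI.
apply: open_continuous_measurable_fun => // x; rewrite inE => x0.
exact: inv_continuous.
Qed.

Lemma measurable_atan : measurable_fun setT (@atan R).
Proof. by apply: continuous_measurable_fun => x; exact: continuous_atan. Qed.

Lemma measurable_sqrt : measurable_fun setT (@Num.sqrt R).
Proof. by apply: continuous_measurable_fun; exact: sqrt_continuous. Qed.

(** The half-angle formula for the argument in the open interval from [- pi] to
    [pi]; it is clearly measurable, and correct off the negative real axis. *)
Definition arg0 (z : C) : R :=
  2 * atan (complex.Im z / (modulus z + complex.Re z)).

Lemma measurable_modulus : measurable_fun [set: T2] (fun p => modulus (plane p)).
Proof.
apply: (measurableT_comp measurable_sqrt).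
by apply: measurable_funD; exact: measurable_funX.
Qed.

Lemma measurable_arg0 d (T : measurableType d) (f : T -> C) :
  measurable_fun setT (fun x => complex.Re (f x)) ->
  measurable_fun setT (fun x => complex.Im (f x)) ->
  measurable_fun setT (fun x => arg0 (f x)).
Proof.
move=> mR mI.
have mM : measurable_fun setT (fun x => modulus (f x)).
  rewrite (_ : (fun x => _) = (fun x => Num.sqrt (complex.Re (f x) ^+ 2 + complex.Im (f x) ^+ 2))).
    apply: (measurableT_comp measurable_sqrt).
    by apply: measurable_funD; exact: measurable_funX.
  by apply/funext => x; rewrite /modulus; case: (f x).
apply: measurable_funM => //; apply: (measurableT_comp measurable_atan).
apply: measurable_funM => //; apply: (measurableT_comp measurable_invr).
exact: measurable_funD.
Qed.

Lemma cos_2atan (x : R) : cos (2 * atan x) = 2 / (1 + x ^+ 2) - 1.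
Proof.
have x0 : 0 <= 1 + x ^+ 2 by rewrite addr_ge0// sqr_ge0.
by rewrite mulr_natl cos_mulr2n cos_atan exprVn sqr_sqrtr// -mulr_natl.
Qed.

Lemma sin_2atan (x : R) : sin (2 * atan x) = 2 * x / (1 + x ^+ 2).
Proof.
have x0 : 0 < 1 + x ^+ 2 by rewrite ltr_pwDl// sqr_ge0.
have c0 : cos (atan x) != 0.
  by rewrite gt_eqF// cos_gt0_pihalf// atan_gtNpi2 atan_ltpi2.
have sE : sin (atan x) = x * cos (atan x).
  by move: (atanK x); rewrite /tan => /(congr1 (fun y => y * cos (atan x))); rewrite divfK.
rewrite mulr_natl sin_mulr2n sE (_ : cos (atan x) * _ = x * cos (atan x) ^+ 2); last by ring.
rewrite cos_atan exprVn sqr_sqrtr ?ltW// -mulr_natl; ring.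
Qed.

Lemma modulus_sqr (z : C) : modulus z ^+ 2 = complex.Re z ^+ 2 + complex.Im z ^+ 2.
Proof. by rewrite /modulus; case: z => a b /=; rewrite sqr_sqrtr// addr_ge0// sqr_ge0. Qed.

Lemma arg0P (z : C) : 0 < modulus z + complex.Re z ->
  z = ofR (modulus z) * cis (arg0 z) /\ - pi < arg0 z < pi.
Proof.
move=> h; set w := complex.Im z / (modulus z + complex.Re z).
split; last first.
  rewrite /arg0 -/w; have := atan_gtNpi2 w; have := atan_ltpi2 w.
  by move=> h1 h2; apply/andP; split; lra.
have m0 : 0 < modulus z.
  rewrite lt_neqAle modulus_ge0 andbT; apply/eqP => z0.
  by move: h; rewrite -z0 add0r (modulus_eq0 (esym z0)) ltxx.
have m2 := modulus_sqr z.
have w2 : 1 + w ^+ 2 = 2 * modulus z / (modulus z + complex.Re z).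
  rewrite /w; apply: (@mulIf _ ((modulus z + complex.Re z) ^+ 2)); first by rewrite expf_neq0// gt_eqF.
  have sn0' : modulus z + complex.Re z != 0 by rewrite gt_eqF.
  rewrite mulrDl mul1r expr_div_n divfK ?expf_neq0//.
  rewrite [RHS](_ : _ = 2 * modulus z * (modulus z + complex.Re z)); last by field.
  have i2 : complex.Im z ^+ 2 = modulus z ^+ 2 - complex.Re z ^+ 2 by rewrite m2; ring.
  by rewrite i2; ring.
have mn0 : modulus z != 0 by rewrite gt_eqF.
have sn0 : modulus z + complex.Re z != 0 by rewrite gt_eqF.
apply/eqP; rewrite eq_complex; apply/andP; split; apply/eqP.
  rewrite ReM /= mul0r subr0 /arg0 -/w cos_2atan w2.
  by field; rewrite mn0 sn0.
rewrite ImM /= mul0r addr0 /arg0 -/w sin_2atan w2 /w.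
by field; rewrite mn0 sn0.
Qed.

Lemma cos_lt1 (x : R) : 0 < x -> x < 2 * pi -> cos x < 1.
Proof.
move=> x0 xp.
have -> : cos x = 1 - 2 * sin (x / 2) ^+ 2.
  rewrite (_ : cos x = cos ((x / 2) *+ 2)); last by congr cos; rewrite -mulr_natl; field.
  by rewrite cos_mulr2n cos2sin2 -mulr_natl; ring.
have s0 : 0 < sin (x / 2) by rewrite sin_gt0_pi//; apply/andP; split; lra.
by have := exprn_gt0 2 s0; lra.
Qed.

Lemma cis_inj (s t : R) : `|s - t| < 2 * pi -> cis s = cis t :> C -> s = t.
Proof.
wlog st : s t / s <= t => [h|].
  by case: (leP s t) => [/h//|/ltW /h h' d /esym e]; apply/esym/h' => //; rewrite distrC.
move=> d e; apply/eqP; move: st; rewrite le_eqVlt => /predU1P[->//|st].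
have t2 : t - s < 2 * pi by rewrite distrC gtr0_norm// in d; lra.
have := cos_lt1 (_ : 0 < t - s) t2; rewrite subr_gt0 => /(_ st).
have : cis (t - s) = 1 :> C.
  by rewrite cisD -e -cisD subrr cis0.
by move=> /(congr1 (@complex.Re R)) /= ->; rewrite ltxx.
Qed.

Lemma arg0_circle (r t : R) : 0 < r -> - pi < t < pi ->
  0 < modulus (ofR r * cis t : C) + complex.Re (ofR r * cis t : C) /\
  arg0 (ofR r * cis t) = t.
Proof.
move=> r0 /andP[t1 t2]; set z : C := ofR r * cis t.
have mz : modulus z = r by rewrite modulusM modulus_ofR modulus_cis mulr1 gtr0_norm.
have h : 0 < modulus z + complex.Re z.
  rewrite mz /z ReM /= mul0r subr0.
  have ct : - 1 < cos t.
    have := @cos_lt1 (t + pi) ltac:(lra) ltac:(lra); rewrite cosDpi; lra.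
  by have := ltr_pM2l r0 (- 1) (cos t); rewrite ct; lra.
split => //; have [e /andP[a1 a2]] := arg0P h.
apply: cis_inj; first by rewrite ltr_norml; apply/andP; split; lra.
have rn : (ofR r : C) != 0.
  by apply/eqP => /(congr1 (@complex.Re R)) /= /eqP; rewrite gt_eqF.
by apply: (mulfI rn); rewrite -/z {2}e mz.
Qed.

Lemma arg0_rotated (z : C) (m : R) : exists t : R,
  z = ofR (modulus z) * cis t /\ m - pi < t <= m + pi.
Proof.
pose y := z * cis (- m).
have my : modulus y = modulus z by rewrite modulusM modulus_cis mulr1.
have zy : z = y * cis m by rewrite /y -mulrA -cisD addNr cis0 mulr1.
clearbody y.
have p0 := pi_gt0 R.
have [h|h] := ltP 0 (modulus y + complex.Re y).
  have [e /andP[a1 a2]] := arg0P h.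
  exists (m + arg0 y); split; last by apply/andP; split; lra.
  by rewrite {1}zy {1}e my -mulrA -cisD addrC.
exists (m + pi); split; last by apply/andP; split; lra.
have yR : complex.Re y = - modulus y.
  by have := Re_le_modulus y; rewrite ler_norml => /andP[h1 _]; lra.
have yI : complex.Im y = 0.
  have := modulus_sqr y; rewrite yR sqrrN => /eqP; rewrite addrC -subr_eq subrr eq_sym.
  by rewrite sqrf_eq0 => /eqP.
have yE : y = ofR (modulus y) * cis pi.
  apply/eqP; rewrite eq_complex; apply/andP; split; apply/eqP.
    by rewrite ReM /= cospi yR; ring.
  by rewrite ImM /= sinpi yI; ring.
by rewrite {1}zy {1}yE my -mulrA -cisD addrC.
Qed.

End argument.

Section sector.
Context {R : realType}.
Local Notation mu := (@lebesgue_measure R).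
Local Notation T2 := (measurableTypeR R * measurableTypeR R)%type.
Local Notation C := (Cplx R).

Local Arguments modulus : simpl never.
Local Arguments plane : simpl never.

Lemma between_interval_measurable (a b : R) (J : set R) :
  `]a, b[ `<=` J -> J `<=` `[a, b] -> measurable J.
Proof.
move=> h1 h2; apply: is_interval_measurable => x y Jx Jy z /andP[xz zy].
have := h2 _ Jx; have := h2 _ Jy; rewrite /= !in_itv /= => /andP[y1 y2] /andP[x1 x2].
move: xz zy; rewrite !le_eqVlt => /predU1P[<-//|xz] /predU1P[->//|zy].
by apply: h1; rewrite /= in_itv /=; apply/andP; split; lra.
Qed.

Lemma ofR_neq0 (r : R) : 0 < r -> (ofR r : C) != 0.
Proof.
by move=> r0; apply/eqP => /(congr1 (@complex.Re R)) /= /eqP; rewrite gt_eqF.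
Qed.

Lemma modulus_polar (r t : R) : 0 <= r -> modulus (ofR r * cis t : C) = r.
Proof. by move=> r0; rewrite modulusM modulus_ofR modulus_cis mulr1 ger0_norm. Qed.

Lemma Re_polar (r t : R) : complex.Re (ofR r * cis t : C) = r * cos t.
Proof. by rewrite ReM /= mul0r subr0. Qed.

Lemma Im_polar (r t : R) : complex.Im (ofR r * cis t : C) = r * sin t.
Proof. by rewrite ImM /= mul0r addr0. Qed.

Lemma measurable_Re_plane (c : C) :
  measurable_fun [set: T2] (fun p => complex.Re (plane p * c)).
Proof.
rewrite (_ : (fun p : T2 => _) = (fun p : T2 => p.1 * complex.Re c - p.2 * complex.Im c)).
  by apply: measurable_funB; exact: measurable_funM.
by apply/funext => p; rewrite ReM.
Qed.

Lemma measurable_Im_plane (c : C) :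
  measurable_fun [set: T2] (fun p => complex.Im (plane p * c)).
Proof.
rewrite (_ : (fun p : T2 => _) = (fun p : T2 => p.1 * complex.Im c + p.2 * complex.Re c)).
  by apply: measurable_funD; exact: measurable_funM.
by apply/funext => p; rewrite ImM.
Qed.

Lemma measurable_preimage_set (f : T2 -> R) (A : set R) : measurable_fun setT f ->
  measurable A -> measurable [set p : T2 | A (f p)].
Proof.
move=> mf mA; rewrite (_ : [set p | _] = setT `&` f @^-1` A); first exact: mf.
by rewrite setTI.
Qed.

Lemma measurable_preimage_itv (f : T2 -> R) (i : interval R) : measurable_fun setT f ->
  measurable [set p : T2 | f p \in i].
Proof.
by move=> mf; apply: (@measurable_preimage_set f [set` i]) => //; exact: measurable_itv.
Qed.

Definition midangle (a l : R) : R := a + l / 2.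
Definition rotated (m : R) (p : T2) : C := plane p * cis (- m).
Local Arguments rotated : simpl never.
Definition rotRe (m : R) (p : T2) : R := complex.Re (rotated m p).
Local Arguments midangle : simpl never.
Local Arguments rotRe : simpl never.

Section arc.
Variables (a l : R) (J : set R).
Hypotheses (l0 : 0 < l) (l2 : l <= 2 * pi).
Hypotheses (J1 : `]a, (a + l)[ `<=` J) (J2 : J `<=` `[a, (a + l)]).
Local Notation I := (cis @` J : set C).
Local Notation S := (plane @^-1` carleson_square I l : set T2).
Local Notation m := (midangle a l).
Local Notation y := (rotated m).

Let yE p : plane p = y p * cis m.
Proof. by rewrite /rotated -mulrA -cisD addNr cis0 mulr1. Qed.

Let ym p : modulus (y p) = modulus (plane p).
Proof. by rewrite /rotated modulusM modulus_cis mulr1. Qed.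

Let pi0 : 0 < pi :> R. Proof. exact: pi_gt0. Qed.

Let J0 : J m.
Proof. by apply: J1; rewrite /= in_itv /= /midangle; apply/andP; split; move: l0; lra. Qed.

(** After a rotation which centres the arc at the angle [0], membership is read
    off the modulus and [arg0]. The ray opposite to the centre, on which [arg0]
    is meaningless, and the origin are listed apart. *)
Let carlesonE : S = (([set p | modulus (plane p) \in `[1 - l, 1[] `&`
  (([set p | modulus (plane p) + rotRe m p \in `]0, +oo[] `&` [set p | J (m + arg0 (y p))])
   `|` ([set p | modulus (plane p) + rotRe m p \in `]-oo, 0]] `&`
        [set p | modulus (plane p) \in `]0, +oo[] `&` [set _ | J (m + pi) \/ J (m - pi)])))
   `|` ([set p | modulus (plane p) \in `]-oo, 0]] `&` [set _ | 1 - l <= 0])).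
Proof.
have ll := l2; have lp := l0; have pp := pi0.
apply/seteqP; split => p.
  move=> [r [t' [zE [t Jt tt'] r0 /andP[r1 r2]]]].
  rewrite -tt' in zE; rewrite /= !in_itv /=.
  have mz : modulus (plane p) = r by rewrite zE modulus_polar.
  have [rp|rn] := ltP 0 r; last first.
    by right; rewrite mz rn; split => //; lra.
  move: rp => {}r0.
  left; rewrite mz r1 r2 r0 !andbT; split => //.
  have yp : y p = ofR r * cis (t - m) by rewrite /rotated zE -mulrA -cisD.
  have := J2 Jt; rewrite /= in_itv /= => /andP[ta tb].
  have [tm|tm] := ltP (`|t - m|) pi.
    have [] := @arg0_circle R r (t - m) r0; first by rewrite -ltr_norml.
    rewrite -yp ym mz => h1 h2; left; rewrite /rotRe; split => //.
    by rewrite h2 addrC subrK.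
  have h : t = m + pi \/ t = m - pi.
    move: tm; rewrite /midangle; have [tm|tm] := leP 0 (t - (a + l / 2)).
      by rewrite ger0_norm// => h; left; lra.
    by rewrite ltr0_norm// => h; right; lra.
  right; split; last by case: h => <-; auto.
    rewrite /rotRe yp ReM /= mul0r subr0.
  have -> : cos (t - m) = - 1.
    case: h => ->; first by rewrite (addrC m) addrK cospi.
    by rewrite (addrC m) addrK cosN cospi.
  by split => //; lra.
move=> [|]; rewrite /= !in_itv /= ?andbT /rotRe.
  move=> [/andP[r1 r2] [[h Jm]|[[h1 h2] h3]]].
    have h' : 0 < modulus (y p) + complex.Re (y p) by rewrite ym.
    have [e _] := arg0P h'.
    rewrite ym in e; exists (modulus (plane p)), (m + arg0 (y p)); split.
    - by rewrite {1}yE {1}e ?ym// -mulrA -cisD addrC.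
    - by exists (m + arg0 (y p)).
    - exact: modulus_ge0.
    - by rewrite r1.
  have yR : complex.Re (y p) = - modulus (y p).
    by have := Re_le_modulus (y p); rewrite ler_norml ym => /andP[h4 _]; lra.
  have yI : complex.Im (y p) = 0.
    have := modulus_sqr (y p); rewrite yR sqrrN => /eqP; rewrite addrC -subr_eq subrr eq_sym.
    by rewrite sqrf_eq0 => /eqP.
  have yp (u : R) : cos u = -1 -> sin u = 0 -> y p = ofR (modulus (y p)) * cis u.
    move=> cu su.
    apply/eqP; rewrite eq_complex; apply/andP; split; apply/eqP.
      by rewrite Re_polar cu yR; ring.
    by rewrite Im_polar su yI; ring.
  case: h3 => Jm.
    exists (modulus (plane p)), (m + pi); split; [|by exists (m + pi)|exact: modulus_ge0|by rewrite r1].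
    by rewrite {1}yE {1}(yp pi (cospi _) (sinpi _)) ym -mulrA -cisD addrC.
  exists (modulus (plane p)), (m - pi); split; [|by exists (m - pi)|exact: modulus_ge0|by rewrite r1].
  by rewrite {1}yE {1}(yp (- pi)) ?cosN ?sinN ?cospi ?sinpi ?oppr0// ym -mulrA -cisD addrC.
move=> [h1 h2]; have z0 : plane p = 0.
  by apply: modulus_eq0; apply/eqP; rewrite eq_le h1 modulus_ge0.
exists 0, m; split; [by rewrite z0 ofR0 mul0r|by exists m|by []|].
by rewrite h2 ltr01.
Qed.

Lemma measurable_carleson_arc : measurable S.
Proof.
have mM := @measurable_modulus R.
have mR : measurable_fun [set: T2] (fun p => modulus (plane p) + rotRe m p).
  by apply: measurable_funD => //; exact: measurable_Re_plane.
have mA : measurable_fun [set: T2] (fun p => m + arg0 (y p)).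
  apply: measurable_funD => //; apply: measurable_arg0.
    exact: measurable_Re_plane.
  exact: measurable_Im_plane.
have mcst (P : Prop) : measurable [set _ : T2 | P].
  by have [p|p] := pselect P; [rewrite (_ : [set _ | P] = setT)//|rewrite (_ : [set _ | P] = set0)//];
     apply/seteqP; split.
rewrite carlesonE; apply: measurableU.
  apply: measurableI; first exact: measurable_preimage_itv.
  apply: measurableU.
    apply: measurableI; first exact: measurable_preimage_itv.
    apply: measurable_preimage_set => //.
    exact: between_interval_measurable J1 J2.
  apply: measurableI => //; apply: measurableI; exact: measurable_preimage_itv.
by apply: measurableI => //; exact: measurable_preimage_itv.
Qed.

(** The angle [a + l] is left out because the end point may or may not belong to
    the arc; one angle is negligible in the integrals. *)
Lemma carleson_polar (r t : R) : 0 < r -> a < t < a + 2 * pi -> t != a + l ->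
  carleson_square I l (ofR r * cis t) <-> t < a + l /\ 1 - l <= r < 1.
Proof.
move=> r0 /andP[t1 t2] tl; split.
  move=> [r' [t' [e [s Js st] r'0 r'1]]].
  have rr : r = r' by have := congr1 (@modulus R) e; rewrite !modulus_polar// ltW.
  rewrite -rr in e r'1; split => //.
  have ec : cis s = cis t :> C by rewrite st; apply: (mulfI (ofR_neq0 r0)).
  have := J2 Js; rewrite /= in_itv /= => /andP[s1 s2].
  have ts : s = t.
    apply: cis_inj ec; rewrite ltr_norml; apply/andP.
    by move: l2; split; lra.
  by rewrite ts le_eqVlt (negbTE tl) in s2.
move=> [tal r1]; exists r, t; split => //; last exact: ltW.
by exists t => //; apply: J1; rewrite /= in_itv /= t1.
Qed.

Lemma carleson_modulus z : carleson_square I l z -> modulus z < 1.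
Proof. by move=> [r [t [-> _ r0 /andP[_ r1]]]]; rewrite modulus_polar. Qed.

End arc.

Lemma measurable_unit_disc : measurable (plane @^-1` unit_disc : set T2).
Proof.
have := @measurable_preimage_itv _ `]-oo, 1[ (@measurable_modulus R).
by congr measurable; apply/seteqP; split => p; rewrite /= in_itv.
Qed.

Definition inner_radius (l : R) : R := Num.max 0 (1 - l).

Definition sect (f : C -> \bar R) (l t : R) : \bar R :=
  (\int[mu]_(r in `]inner_radius l, 1%R[) (f (ofR r * cis t)%R * r%:E))%E.

(** Polar coordinates over the period starting at [a]: the arc is the initial
    part of the period, and the remaining angles contribute nothing. *)
Lemma sector_integral (a l : R) (J : set R) (f : C -> \bar R) :
  0 < l -> l <= 2 * pi -> `]a, (a + l)[ `<=` J -> J `<=` `[a, (a + l)] ->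
  measurable_fun (plane @^-1` unit_disc : set T2) (f \o plane) ->
  (forall z, unit_disc z -> (0 <= f z)%E) ->
  area_integral (carleson_square (cis @` J) l) f =
  ((pi^-1)%:E * \int[mu]_(t in `]a, (a + l)%R[) sect f l t)%E.
Proof.
move=> l0 l2 J1 J2 mf f0.
set S := carleson_square _ _.
have mS : measurable (plane @^-1` S : set T2) by exact: (measurable_carleson_arc l0 l2 J1 J2).
have SD : (plane @^-1` S : set T2) `<=` plane @^-1` unit_disc.
  by move=> p; apply: carleson_modulus.
have mfS : measurable_fun (plane @^-1` S : set T2) (f \o plane).
  by apply: measurable_funS mf => //; exact: measurable_unit_disc.
rewrite /area_integral ge0_integral_mscale//=; last by move=> p /SD; exact: f0.
congr (_ * _)%E.
pose F : T2 -> \bar R := (f \o plane) \_ (plane @^-1` S).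
have mF : measurable_fun setT F.
  by apply/(measurable_restrict _ mS measurableT) => //; rewrite setTI.
have F0 p : (0 <= F p)%E.
  by rewrite /F /patch; case: ifPn => //; rewrite inE => /SD; exact: f0.
rewrite integral_mkcond -/F (full_polar a mF F0).
have mr := measurable_ray mF F0; have r0 t := @ray_ge0 _ F t F0.
have al : a <= a + l by rewrite lerDl ltW.
have al2 : a + l <= a + 2 * pi by rewrite lerD2l.
rewrite (integral_itv_split mr r0 al al2).
have FE (r t : R) : 0 < r -> a < t < a + 2 * pi -> t != a + l ->
   F (r * cos t, r * sin t) =
   if (t < a + l) && (1 - l <= r < 1) then f (ofR r * cis t)%R else 0%E.
  move=> rp ht tl; have pE : plane (r * cos t, r * sin t) = ofR r * cis t.
    by apply/eqP; rewrite eq_complex /=; apply/andP; split; apply/eqP; ring.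
  have := carleson_polar l2 J1 J2 rp ht tl => hS.
  rewrite /F /patch /= pE; case: ifPn => [|].
    by rewrite inE /= pE => /hS[-> ->].
  rewrite notin_setE /= pE => nS; case: ifP => // /andP[h1 h2].
  by exfalso; apply: nS; apply/hS.
have mi (c d : R) : measurable (`]c, d[%classic : set R) by exact: measurable_itv.
rewrite (@integral_itv_bndoo R (a + l)); last exact: measurable_funTS.
rewrite (@integral_itv_bndoo R a); last exact: measurable_funTS.
rewrite [X in (_ + X)%E](_ : _ = 0%E) ?adde0; last first.
  rewrite (@eq_integral _ _ _ _ _ (fun=> 0%E)) ?integral0// => t.
  rewrite inE /= in_itv /= => /andP[t1 t2].
  rewrite /ray (@eq_integral _ _ _ _ _ (fun=> 0%E)) ?integral0// => r.
  rewrite inE /= in_itv /= andbT => rp; rewrite FE//.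
  - by rewrite ltNge (ltW t1) mul0e.
  - by rewrite t2 andbT; apply: lt_trans t1; rewrite ltrDl.
  - by rewrite gt_eqF.
apply: eq_integral => t; rewrite inE /= in_itv /= => /andP[t1 t2].
have ht : a < t < a + 2 * pi by rewrite t1 (lt_le_trans t2).
have tl : t != a + l by rewrite lt_eqF.
rewrite /ray /sect.
have mFt : measurable_fun setT (fun r : R => F (r * cos t, r * sin t)%R * r%:E)%E.
  apply: emeasurable_funM; last exact/measurable_EFinP.
  apply: (measurableT_comp mF); apply: measurable_fun_pair; exact: measurable_funM.
(* the radii of the square: from [1 - l] on when this is positive, else all positive ones *)
transitivity (\int[mu]_(r in [set` Interval (BSide (l < 1)%R (inner_radius l)) (BLeft 1%R)])
   (F (r * cos t, r * sin t)%R * r%:E))%E.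
  rewrite [LHS]integral_indic_mul [RHS]integral_indic_mul; apply: eq_integral => r _.
  rewrite !mule_indic.
  have [rp|rn] := ltP 0 r; last first.
    rewrite memNset; last by rewrite /= in_itv /= andbT; apply/negP; rewrite -leNgt.
    case: ifPn => //; rewrite inE /= in_itv /inner_radius /= => /andP[h h']; exfalso.
    move: h; case: (ltP l 1) => l1 /=; first by rewrite ge_max; lra.
    by rewrite gt_max; lra.
  rewrite mem_set; last by rewrite /= in_itv /= rp.
  case: ifPn => // rI; rewrite FE// t2 /=; case: ifP => [/andP[r1 r2]|]; last by rewrite mul0e.
  exfalso; move: rI; apply/negP; rewrite negbK inE /= in_itv /inner_radius /=.
  case: (ltP l 1) => l1 /=; first by rewrite ge_max (ltW rp) r1 r2.
  by rewrite gt_max rp r2 andbT /=; lra.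
rewrite (@integral_itv_bndoo R); last exact: measurable_funTS.
apply: eq_integral => r; rewrite inE /= in_itv /= => /andP[r1 r2].
have rp : 0 < r by apply: le_lt_trans r1; rewrite /inner_radius le_max lexx.
rewrite FE// t2 r2 andbT /=.
by have -> : 1 - l <= r by apply: ltW; apply: le_lt_trans r1; rewrite /inner_radius le_max lexx orbT.
Qed.

End sector.

(** * Mean value inequalities over discs *)

Section polynomial_limits.
Context {R : realType}.
Local Notation mu := (@lebesgue_measure R).
Local Notation T2 := (measurableTypeR R * measurableTypeR R)%type.
Local Notation C := (Cplx R).
Local Arguments modulus : simpl never.
Local Arguments plane : simpl never.

(** Derivatives of holomorphic functions on the disc and their dilates are of
    this kind, and so are the differences considered below; measurability and
    the mean value inequality pass from polynomials to such functions. *)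
Definition poly_limit (phi : C -> C) := forall r e : R, 0 < r -> r < 1 -> 0 < e ->
  exists P : {poly C}, forall z, modulus z <= r -> modulus (phi z - P.[z]) <= e.

Lemma measurable_poly_ReIm (c : C) (P : {poly C}) :
  measurable_fun [set: T2] (fun p => complex.Re P.[plane p + c]) /\
  measurable_fun [set: T2] (fun p => complex.Im P.[plane p + c]).
Proof.
elim/poly_ind: P => [|P d [IH1 IH2]].
  by split; under eq_fun do rewrite horner0; exact: measurable_cst.
have m1 : measurable_fun [set: T2] (fun p : T2 => p.1 + complex.Re c).
  exact: measurable_funD.
have m2 : measurable_fun [set: T2] (fun p : T2 => p.2 + complex.Im c).
  exact: measurable_funD.
split.
  rewrite (_ : (fun p : T2 => _) = (fun p : T2 => complex.Re P.[plane p + c] * (p.1 + complex.Re c)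
     - complex.Im P.[plane p + c] * (p.2 + complex.Im c) + complex.Re d)).
    by apply: measurable_funD => //; apply: measurable_funB; exact: measurable_funM.
  by apply/funext => p; rewrite !hornerE ReD ReM ReD ImD.
rewrite (_ : (fun p : T2 => _) = (fun p : T2 => complex.Re P.[plane p + c] * (p.2 + complex.Im c)
     + complex.Im P.[plane p + c] * (p.1 + complex.Re c) + complex.Im d)).
  by apply: measurable_funD => //; apply: measurable_funD; exact: measurable_funM.
by apply/funext => p; rewrite !hornerE ImD ImM ReD ImD.
Qed.

Lemma measurable_poly_sqr (c : C) (P : {poly C}) :
  measurable_fun [set: T2] (fun p => modulus P.[plane p + c] ^+ 2).
Proof.
have [mR mI] := measurable_poly_ReIm c P.
under eq_fun do rewrite modulus_sqr.
by apply: measurable_funD; exact: measurable_funX.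
Qed.

Lemma measurable_poly_limit (phi : C -> C) : poly_limit phi ->
  measurable_fun (plane @^-1` unit_disc : set T2) (fun p => modulus (phi (plane p)) ^+ 2).
Proof.
move=> hphi.
have ex n : exists P : {poly C}, forall z, modulus z <= 1 - (n.+2%:R)^-1 ->
    modulus (phi z - P.[z]) <= n.+2%:R^-1.
  have i0 : 0 < (n.+2%:R)^-1 :> R by rewrite invr_gt0 ltr0n.
  have i1 : (n.+2%:R)^-1 < 1 :> R by rewrite invf_lt1 ?ltr0n// ltr1n.
  by move: (n.+2%:R)^-1 i0 i1 => x x0 x1; apply: hphi; lra.
have [P hP] := choice ex.
apply: (@measurable_fun_cvg _ T2 R _ (fun n (p : T2) => modulus (P n).[plane p] ^+ 2)).
  move=> n; apply: measurable_funTS; have := measurable_poly_sqr 0 (P n).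
  by under eq_fun do rewrite addr0.
move=> p /= pD.
have : modulus (P n).[plane p] @[n --> \oo] --> modulus (phi (plane p)).
  apply/cvgrPdist_le => e e0.
  have d0 : 0 < Num.min e (1 - modulus (plane p)) by rewrite lt_min e0 subr_gt0.
  have := near_infty_natSinv_lt (PosNum d0); apply: filterS => n /= hn.
  have hn' : (n.+2%:R)^-1 <= Num.min e (1 - modulus (plane p)) :> R.
    apply: le_trans (ltW hn); rewrite lef_pV2 ?posrE ?ltr0n// ler_nat//.
  have h1 : (n.+2%:R)^-1 <= e :> R by apply: le_trans hn' _; rewrite ge_min lexx.
  have h2 : (n.+2%:R)^-1 <= 1 - modulus (plane p) by apply: le_trans hn' _; rewrite ge_min lexx orbT.
  apply: le_trans h1.
  have := hP n (plane p) (_ : _ <= _); rewrite lerBrDr addrC -lerBrDr => /(_ h2).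
  apply: le_trans.
  have a1 := modulusD (phi (plane p) - (P n).[plane p]) (P n).[plane p].
  have a2 := modulusD ((P n).[plane p] - phi (plane p)) (phi (plane p)).
  rewrite !subrK (modulus_dist (P n).[_]) in a1 a2.
  by rewrite ler_norml; apply/andP; split; lra.
move=> h; apply: (cvg_comp _ (fun x : R => x ^+ 2) h).
exact: exprn_continuous.
Qed.

Lemma plane_translation (F : T2 -> \bar R) (a b : R) : measurable_fun setT F ->
  (forall p, (0 <= F p)%E) ->
  (\int[(mu \x mu)%E]_p F p = \int[(mu \x mu)%E]_p F (p.1 + a, p.2 + b)%R)%E.
Proof.
move=> mF F0.
have mF' : measurable_fun setT (fun p : T2 => F (p.1 + a, p.2 + b)).
  apply: (measurableT_comp mF).
  by apply: measurable_fun_pair; exact: measurable_funD.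
rewrite (fubini_tonelli1 F mF F0) (fubini_tonelli1 _ mF') => [|p]; last exact: F0.
rewrite (ge0_integral_shift a).
- apply: eq_integral => x _; rewrite /fubini_F /=.
  apply: (@ge0_integral_shift _ b (fun y => F (x + a, y))) => //.
  exact: measurableT_comp mF (pair1_measurable _).
- exact: measurable_fun_fubini_tonelli_F.
- by move=> x; apply: integral_ge0.
Qed.

Definition disc (u : C) (eta : R) : set C := [set z | modulus (z - u) < eta].

Lemma measurable_disc u eta : measurable (plane @^-1` disc u eta : set T2).
Proof.
have h : measurable_fun [set: T2] (fun p => modulus (plane p - u) ^+ 2).
  have := measurable_poly_sqr (- u) 'X.
  by under eq_fun do rewrite hornerX.
have [e0|e0] := ltP 0 eta; last first.
  rewrite (_ : _ @^-1` _ = set0)//; apply/seteqP; split => // p /= pe.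
  by have := lt_le_trans pe e0; rewrite ltNge modulus_ge0.
have := measurable_preimage_itv `]-oo, (eta ^+ 2)[ h.
congr measurable; apply/seteqP; split => p; rewrite /= in_itv /= /disc /=.
  by rewrite ltr_pXn2r// nnegrE ?modulus_ge0// ltW.
by rewrite ltr_pXn2r// nnegrE ?modulus_ge0// ltW.
Qed.

(** The mean value property of [P ^+ 2]. The constant is [pi] instead of [2 *
    pi] because the integrals of the real and of the imaginary part are bounded
    separately. *)
Lemma poly_circle_mean (P : {poly C}) (u : C) (s : R) : 0 < s ->
  ((pi * modulus P.[u] ^+ 2)%:E <=
   \int[mu]_(t in `[0%R, (0 + 2 * pi)%R[) (modulus P.[u + ofR s * cis t] ^+ 2)%:E)%E.
Proof.
move=> s0; rewrite add0r.
have dP z : exists d, cderiv (fun z => P.[z] * P.[z]) z d.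
  by eexists; apply: cderivM; exact: cderiv_horner.
have := @mean_value R (fun z => P.[z] * P.[z]) u (s + 1) s s0 ltac:(lra) (fun z _ => dP z).
have cc t : ccont (fun t => u + circle s t) t.
  by apply: ccontD; [exact: ccont_cst|exact: ccont_circle].
have cP t : ccont (fun t => P.[u + circle s t]) t.
  by apply: (@ccont_comp _ (fun z => P.[z]) _ t _ (cc t)); exact: cderiv_horner.
have cPP t : ccont (fun t => P.[u + circle s t] * P.[u + circle s t]) t by exact: ccontM.
have cm : cont_on 0 (2 * pi) (fun t => modulus (P.[u + circle s t] * P.[u + circle s t])).
  by move=> t _; apply: ccont_modulus; exact: cPP.
have cmN : cont_on 0 (2 * pi) (fun t => - modulus (P.[u + circle s t] * P.[u + circle s t])).
  by move=> t ht; apply: continuousN; exact: cm.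
have p0 : 0 < pi :> R := pi_gt0 R.
set I := segint 0 (2 * pi) (fun t => modulus (P.[u + circle s t] * P.[u + circle s t])).
have bnd (f : R -> R) : cont_on 0 (2 * pi) f ->
    (forall t, `|f t| <= modulus (P.[u + circle s t] * P.[u + circle s t])) ->
    `|segint 0 (2 * pi) f| <= I.
  move=> cf hf; rewrite ler_norml; apply/andP; split; last first.
    by apply: le_segint => // t _; apply: le_trans (hf t); exact: ler_norm.
  rewrite -mulN1r -segintZ//; apply: le_segint => //.
    by apply: cont_onZ.
  by move=> t _; rewrite mulN1r; have := hf t; rewrite ler_norml => /andP[].
move=> mv.
have mI : modulus (cint (fun t => P.[u + circle s t] * P.[u + circle s t])) <= I + I.
  apply: le_trans (modulus_le_ReIm _) _; apply: lerD => /=; apply: bnd.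
  - exact: cont_on_Re.
  - by move=> t; exact: Re_le_modulus.
  - exact: cont_on_Im.
  - by move=> t; exact: Im_le_modulus.
rewrite mv !modulusM modulus_ofR gtr0_norm ?pi2_gt0// -expr2 in mI.
have -> : (\int[mu]_(t in `[0%R, (2 * pi)%R[) (modulus P.[u + ofR s * cis t] ^+ 2)%:E)%E = I%:E.
  rewrite /I /segint /Rintegral fineK.
    transitivity (\int[mu]_(t in `[0%R, (2 * pi)%R[)
        (modulus (P.[u + circle s t] * P.[u + circle s t]))%:E)%E.
      by apply: eq_integral => t _; rewrite modulusM expr2.
    apply: integral_itv_bndo_bndc.
    have /integrableP[h _] := cont_on_integrable cm.
    by apply: measurable_funS h => //; apply: subset_itv; rewrite bnd_simp.
  by apply: integrable_fin_num => //; exact: cont_on_integrable.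
by rewrite lee_fin; lra.
Qed.

(** The circular means integrated against [r dr]. *)
Lemma poly_disc_mean (P : {poly C}) (u : C) (eta : R) : 0 < eta ->
  ((pi * modulus P.[u] ^+ 2 * eta ^+ 2 / 2)%:E <=
   \int[(mu \x mu)%E]_(p in plane @^-1` disc u eta) (modulus P.[plane p] ^+ 2)%:E)%E.
Proof.
move=> e0.
pose F (p : T2) : \bar R := ((modulus P.[plane p + u] ^+ 2)%:E * (\1_`]-oo, eta[%classic (modulus (plane p)))%:E)%E.
have mF : measurable_fun setT F.
  apply: emeasurable_funM; first by apply/measurable_EFinP; exact: measurable_poly_sqr.
  by apply: measurable_indicE => //; exact: measurable_modulus.
have F0 p : (0 <= F p)%E.
  by rewrite /F mule_indic; case: ifP => // _; rewrite lee_fin sqr_ge0.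
have -> : (\int[(mu \x mu)%E]_(p in plane @^-1` disc u eta) (modulus P.[plane p] ^+ 2)%:E
   = \int[(mu \x mu)%E]_p F p)%E.
  have mG : measurable_fun setT ((fun p : T2 => (modulus P.[plane p] ^+ 2)%:E : \bar R) \_ (plane @^-1` disc u eta)).
    apply/(measurable_restrict _ (measurable_disc u eta) measurableT) => //; rewrite setTI.
    apply: measurable_funTS; apply/measurable_EFinP; have := measurable_poly_sqr 0 P.
    by under eq_fun do rewrite addr0.
  rewrite integral_mkcond (@plane_translation _ (complex.Re u) (complex.Im u) mG); last first.
    by move=> p; rewrite /patch; case: ifP => // _; rewrite lee_fin sqr_ge0.
  apply: eq_integral => p _; rewrite /F mule_indic /patch.
  have -> : plane (p.1 + complex.Re u, p.2 + complex.Im u) = plane p + u by case: (u).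
  congr (if _ then _ else _); apply/idP/idP; rewrite !inE /= in_itv /= /disc /=.
    by rewrite (_ : plane (p.1 + complex.Re u, p.2 + complex.Im u) = plane p + u) ?addrK//; case: (u).
  by rewrite (_ : plane (p.1 + complex.Re u, p.2 + complex.Im u) = plane p + u) ?addrK//; case: (u).
rewrite (full_polar 0 mF F0) /ray.
pose G (p : T2) : \bar R := (F (p.1 * cos p.2, p.1 * sin p.2)%R * p.1%:E
   * (\1_`]0, +oo[%classic p.1)%:E * (\1_`[0%R, (0 + 2 * pi)%R[%classic p.2)%:E)%E.
have mG : measurable_fun setT G.
  apply: emeasurable_funM; last exact: measurable_indicE.
  apply: emeasurable_funM; last exact: measurable_indicE.
  apply: emeasurable_funM; last exact/measurable_EFinP.
  exact: measurableT_comp mF (@measurable_polar_map R).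
have G0 p : (0 <= G p)%E.
  rewrite /G mule_indic; case: ifP => // _; rewrite mule_indic; case: ifP => //.
  rewrite inE /= in_itv /= andbT => p0; apply: mule_ge0; first exact: F0.
  by rewrite lee_fin ltW.
have -> : (\int[mu]_(t in `[0%R, (0 + 2 * pi)%R[)
     \int[mu]_(r in `]0%R, +oo[) (F (r * cos t, r * sin t)%R * r%:E) =
   \int[mu]_t \int[mu]_r G (r, t))%E.
  rewrite integral_indic_mul; apply: eq_integral => t _; rewrite mule_indic; case: ifPn => ht.
    rewrite integral_indic_mul; apply: eq_integral => r _.
    by rewrite /G /= [(\1_`[0%R, (0 + 2 * pi)%R[%classic t)]indicE ht mule1.
  rewrite (@eq_integral _ _ _ _ _ (fun=> 0%E)) ?integral0// => r _.
  by rewrite /G /= [(\1_`[0%R, (0 + 2 * pi)%R[%classic t)]indicE (negbTE ht) mule0.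
rewrite -fubini_tonelli//.
apply: (@le_trans _ _ (\int[mu]_(r in `]0%R, eta[) ((pi * modulus P.[u] ^+ 2)%:E * r%:E))%E).
  rewrite ge0_integralZl//; first last.
  - by rewrite lee_fin mulr_ge0 ?pi_ge0// sqr_ge0.
  - by move=> r; rewrite /= in_itv /= lee_fin => /andP[/ltW].
  have -> : (\int[mu]_(r in `]0%R, eta[) r%:E = (eta ^+ 2 / 2)%:E)%E.
    rewrite -(@integral_itv_bndoo R 0 eta _ true false); last exact/measurable_EFinP.
    have csq : continuous (fun r : R => r ^+ 2 / 2).
      by move=> x; apply: cvgM; [exact: exprn_continuous|exact: cvg_cst].
    rewrite (@continuous_FTC2 R id (fun r => r ^+ 2 / 2))//.
    - by rewrite expr0n /= mul0r sube0.
    - by apply: continuous_subspaceT => x; exact: cvg_id.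
    - split.
      + by move=> x _; apply: derivableM => //; exact: derivableX.
      + by apply: cvg_at_right_filter; exact: csq.
      + by apply: cvg_at_left_filter; exact: csq.
    - move=> x _; rewrite derive1E.
      rewrite (_ : (fun r : R => r ^+ 2 / 2) = (2^-1 : R) \*: (fun r : R => r ^+ 2)); last first.
        by apply/funext => r; rewrite mulrC.
      by rewrite deriveZ//= exp_derive /GRing.scale /=; field.
  by rewrite -EFinM lee_fin le_eqVlt; apply/orP; left; apply/eqP; ring.
rewrite [leLHS]integral_indic_mul; apply: ge0_le_integral => //.
- move=> r _; rewrite mule_indic; case: ifP => //; rewrite inE /= in_itv /= => /andP[r0 _].
  by rewrite -EFinM lee_fin; exact: mulr_ge0 (mulr_ge0 (pi_ge0 R) (sqr_ge0 _)) (ltW r0).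
- apply: emeasurable_funM; last exact: measurable_indicE.
  by apply: emeasurable_funM => //; apply/measurable_EFinP.
- exact: measurable_fun_fubini_tonelli_F.
move=> r _; rewrite mule_indic; case: ifPn => [|_]; last by apply: integral_ge0.
rewrite inE /= in_itv /= => /andP[r0 re].
apply: (@le_trans _ _ ((\int[mu]_(t in `[0%R, (0 + 2 * pi)%R[) (modulus P.[u + ofR r * cis t] ^+ 2)%:E) * r%:E)%E).
  apply: lee_wpmul2r; first by rewrite lee_fin ltW.
  exact: poly_circle_mean.
rewrite muleC -ge0_integralZl//; first last.
- by rewrite lee_fin ltW.
- by move=> t _; rewrite lee_fin sqr_ge0.
- apply: measurable_funTS; apply/measurable_EFinP.
  rewrite (_ : (fun t : R => _) =
    (fun p : T2 => modulus P.[plane p + u] ^+ 2) \o (fun t : R => (r * cos t, r * sin t))).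
    apply: measurableT_comp; first exact: measurable_poly_sqr.
    apply: measurable_fun_pair; apply: measurable_funM => //.
      exact: measurable_cos.
    exact: measurable_sin.
  apply/funext => t /=; congr (modulus P.[_] ^+ 2); rewrite addrC; congr (_ + _).
  by apply/eqP; rewrite eq_complex /=; apply/andP; split; apply/eqP; ring.
rewrite [leLHS]integral_indic_mul le_eqVlt; apply/orP; left; apply/eqP.
apply: eq_integral => t _; rewrite /G /=; congr (_ * _)%E.
rewrite [(\1_`]0, +oo[%classic r)]indicE mem_set ?mule1; last by rewrite /= in_itv /= r0.
have pE : plane (r * cos t, r * sin t) = ofR r * cis t.
  by apply/eqP; rewrite eq_complex /=; apply/andP; split; apply/eqP; ring.
rewrite /F mule_indic pE modulus_polar ?ltW//.
rewrite mem_set; last by rewrite /= in_itv.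
by rewrite muleC addrC.
Qed.

Lemma disc_area_le u eta : 0 < eta ->
  ((mu \x mu)%E (plane @^-1` disc u eta : set T2) <= (4 * eta ^+ 2)%:E)%E.
Proof.
move=> e0.
apply: (@le_trans _ _ ((mu \x mu)%E (`](complex.Re u - eta), (complex.Re u + eta)[ `*`
    `](complex.Im u - eta), (complex.Im u + eta)[ : set T2))).
  apply: le_measure; rewrite ?inE; first exact: measurable_disc.
    by apply: measurableX; exact: measurable_itv.
  move=> p /= hp; have h1 := Re_le_modulus (plane p - u); have h2 := Im_le_modulus (plane p - u).
  move: (le_lt_trans h1 hp) (le_lt_trans h2 hp); rewrite ReB ImB /=.
  by rewrite !ltr_norml => /andP[a1 a2] /andP[b1 b2]; rewrite !in_itv /=; split; apply/andP; split; lra.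
rewrite product_measure1E//; try exact: measurable_itv.
have hl (x : R) : mu `](x - eta), (x + eta)[%classic = (2 * eta)%:E.
  rewrite lebesgue_measure_itv /= lte_fin (_ : x - eta < x + eta); last by lra.
  by rewrite -EFinB; congr (_%:E); ring.
rewrite (_ : (4 * eta ^+ 2)%:E = (2 * eta)%:E * (2 * eta)%:E)%E; last first.
  by rewrite -EFinM; congr (_%:E); ring.
by rewrite le_eqVlt; apply/orP; left; apply/eqP; congr (_ * _)%E; exact: hl.
Qed.

(** Replacing [phi] by a polynomial costs a factor [2] on either side, on top of
    the factor [2] present for polynomials. *)
Lemma poly_limit_disc_mean (phi : C -> C) (u : C) (eta : R) : poly_limit phi ->
  0 < eta -> modulus u + eta < 1 ->
  ((pi * modulus (phi u) ^+ 2 * eta ^+ 2)%:E <=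
   8%:E * \int[(mu \x mu)%E]_(p in plane @^-1` disc u eta) (modulus (phi (plane p)) ^+ 2)%:E)%E.
Proof.
move=> hphi e0 ue.
have u0 := modulus_ge0 u; have p0 := pi_gt0 R.
have mphi := measurable_poly_limit hphi.
have mD := measurable_disc u eta.
have Du (p : T2) : (plane @^-1` disc u eta) p -> modulus (plane p) <= modulus u + eta.
  by rewrite /= /disc /= => hp; have := modulusD (plane p - u) u; rewrite subrK; lra.
have DD : (plane @^-1` disc u eta : set T2) `<=` plane @^-1` unit_disc.
  by move=> p /Du h; rewrite /= /unit_disc /=; exact: le_lt_trans h ue.
have mphiD : measurable_fun (plane @^-1` disc u eta : set T2) (fun p => (modulus (phi (plane p)) ^+ 2)%:E : \bar R).
  apply/measurable_EFinP; apply: measurable_funS mphi => //; exact: measurable_unit_disc.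
set K := (\int[_]_(p in _) _)%E.
have K0 : (0 <= K)%E by apply: integral_ge0 => p _; rewrite lee_fin sqr_ge0.
have [Kf|] := boolP (K \is a fin_num); last first.
  rewrite ge0_fin_numE// -leNgt leye_eq => /eqP ->.
  by rewrite mulry gtr0_sg// mul1e leey.
rewrite -(fineK Kf) -EFinM lee_fin.
have k0 : 0 <= fine K by rewrite fine_ge0.
apply/ler_addgt0Pr => d d0.
pose c := 2 * pi * eta ^+ 2 + 32 * eta ^+ 2.
have c0 : 0 < c.
  by rewrite addr_gt0 ?mulr_gt0 ?exprn_gt0.
pose e := Num.min 1 (d / c).
have ep : 0 < e by rewrite lt_min ltr01 divr_gt0.
have e1 : e ^+ 2 * c <= d.
  rewrite -ler_pdivlMr//; apply: (@le_trans _ _ e); last by rewrite ge_min lexx orbT.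
  have e_1 : e <= 1 by rewrite ge_min lexx.
  by have := ler_wpM2l (ltW ep) e_1; rewrite mulr1 expr2.
have [P hP] := hphi (modulus u + eta) e ltac:(lra) ue ep.
have sq (x y : C) : modulus (x - y) <= e -> modulus x ^+ 2 <= 2 * modulus y ^+ 2 + 2 * e ^+ 2.
  move=> h; have := modulusD (x - y) y; rewrite subrK => h1.
  have x0 := modulus_ge0 x; have y0 := modulus_ge0 y.
  apply: (@le_trans _ _ ((e + modulus y) ^+ 2)).
    by rewrite ler_pXn2r ?nnegrE//; lra.
  by have := sqr_ge0 (e - modulus y); nra.
have h1 := sq _ _ (hP u ltac:(lra)).
have h2 := poly_disc_mean P u e0.
have h3 : (\int[(mu \x mu)%E]_(p in plane @^-1` disc u eta) (modulus P.[plane p] ^+ 2)%:E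
   <= (2 * fine K + 2 * e ^+ 2 * (4 * eta ^+ 2))%:E)%E.
  apply: (@le_trans _ _ (\int[(mu \x mu)%E]_(p in plane @^-1` disc u eta)
      (2%:E * (modulus (phi (plane p)) ^+ 2)%:E + (2 * e ^+ 2)%:E))%E).
    apply: ge0_le_integral => //.
    - by move=> p _; rewrite lee_fin sqr_ge0.
    - apply: measurable_funTS; apply/measurable_EFinP; have := measurable_poly_sqr 0 P.
      by under eq_fun do rewrite addr0.
    - by apply: emeasurable_funD => //; apply: emeasurable_funM.
    - move=> p pD; rewrite -EFinM -EFinD lee_fin; apply: sq.
      by rewrite modulus_dist; apply: hP; exact: Du.
  rewrite ge0_integralD//; last 3 first.
  - by move=> p _; rewrite -EFinM lee_fin mulr_ge0// sqr_ge0.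
  - exact: emeasurable_funM.
  - by move=> p _; rewrite lee_fin mulr_ge0// sqr_ge0.
  rewrite ge0_integralZl//; last by move=> p _; rewrite lee_fin sqr_ge0.
  rewrite -/K integral_cst// -(fineK Kf) -EFinM [leRHS]EFinD leeD2l//.
  rewrite [leRHS]EFinM; apply: lee_wpmul2l; first by rewrite lee_fin mulr_ge0// sqr_ge0.
  exact: disc_area_le.
have h4 := le_trans h2 h3; rewrite lee_fin in h4.
have h5 : pi * modulus (phi u) ^+ 2 * eta ^+ 2 <=
   pi * (2 * modulus P.[u] ^+ 2 + 2 * e ^+ 2) * eta ^+ 2.
  by apply: ler_wpM2r; [exact: sqr_ge0|apply: ler_wpM2l => //; exact: ltW].
apply: le_trans h5 _; rewrite /c in e1.
by move: (modulus P.[u] ^+ 2) (e ^+ 2) (eta ^+ 2) (fine K) h4 e1 => *; nra.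
Qed.

End polynomial_limits.

(** * Tails of the weight and the associated weight *)

Section weights.
Context {R : realType}.
Local Notation mu := (@lebesgue_measure R).
Local Notation T2 := (measurableTypeR R * measurableTypeR R)%type.
Local Notation C := (Cplx R).
Local Arguments modulus : simpl never.
Local Arguments plane : simpl never.

Definition radw (w : C -> R) (s : R) : R := w (ofR s) * s.

Definition tail (w : C -> R) (r : R) : R :=
  fine (\int[mu]_(s in `]r, 1%R[) (radw w s)%:E)%E.

Variable w : C -> R.
Hypothesis hw : continuous_radial_weight w.

Lemma disc_ofR (s : R) : 0 <= s < 1 -> unit_disc (ofR s : C).
Proof. by move=> /andP[s0 s1]; rewrite /unit_disc /= modulus_ofR ger0_norm. Qed.

Lemma weight_pos z : unit_disc z -> 0 < w z.
Proof. by have [[h _] _ _] := hw; exact: h. Qed.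

Lemma radw_gt0 s : 0 < s < 1 -> 0 < radw w s.
Proof.
move=> /andP[s0 s1]; apply: mulr_gt0 => //; apply: weight_pos.
by apply: disc_ofR; rewrite s1 ltW.
Qed.

Lemma radw_continuous s : 0 <= s < 1 -> {for s, continuous (radw w)}.
Proof.
move=> hs; apply: continuousM; last exact: cvg_id.
apply: eps_continuous => e e0; have [_ _ cw] := hw.
have /cvgrPdist_le /(_ e e0) /nbhs_ballP[d /= d0 hd] := cw _ (disc_ofR hs).
have [r er] : exists r : R, d = ofR r.
  by exists (complex.Re d); apply/eqP; rewrite eq_complex /= eqxx /=;
     move: d0; rewrite ltcE /= => /andP[].
exists r => [|t' ht]; first by move: d0; rewrite er -ltcR.
rewrite distrC; apply: hd; rewrite /ball /= er normC_modulus -ofRB modulus_ofR distrC.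
by rewrite /ofR ltcR.
Qed.

Lemma measurable_radw : measurable_fun (`]0, 1[%classic : set R) (radw w).
Proof.
apply: open_continuous_measurable_fun; first exact: itv_open.
move=> s; rewrite inE /= in_itv /= => /andP[s0 s1].
by apply: radw_continuous; rewrite s1 ltW.
Qed.

Lemma measurable_radw_sub r : 0 <= r -> measurable_fun (`]r, 1[%classic : set R) (radw w).
Proof.
move=> r0; apply: measurable_funS measurable_radw => //.
by apply: subset_itv; rewrite bnd_simp.
Qed.

Lemma radw_ge0_sub r s : 0 <= r -> s \in `]r, 1[ -> 0 <= radw w s.
Proof.
move=> r0; rewrite in_itv /= => /andP[rs s1]; apply/ltW/radw_gt0.
by rewrite s1 (le_lt_trans r0 rs).
Qed.

(** The arc of full length turns statements about squares into statements about
    the disc. *)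
Lemma full_square : carleson_square (cis @` `[0, (0 + 2 * pi)] : set C) (2 * pi) = unit_disc.
Proof.
have p0 := pi_gt0 R.
apply/seteqP; split => z; first exact: carleson_modulus.
rewrite /unit_disc /= => z1; have [t [zE /andP[t1 t2]]] := arg0_rotated z pi.
exists (modulus z), t; split => //.
- by exists t => //; rewrite /= in_itv /=; apply/andP; split; lra.
- exact: modulus_ge0.
- by rewrite z1 andbT; have := modulus_ge0 z; have := @pi_ge2 R; lra.
Qed.

Lemma measurable_weight : measurable_fun (plane @^-1` unit_disc : set T2)
  (fun p => (w (plane p))%:E).
Proof. by have [[_ /integrableP[h _]] _ _] := hw. Qed.

Lemma weight_of_square (a l : R) (J : set R) : 0 < l -> l <= 2 * pi ->
  `]a, (a + l)[ `<=` J -> J `<=` `[a, (a + l)] ->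
  weight_of w (carleson_square (cis @` J) l) =
  ((pi^-1)%:E * (l%:E * \int[mu]_(r in `]inner_radius l, 1%R[) (radw w r)%:E))%E.
Proof.
move=> l0 l2 J1 J2; rewrite /weight_of (sector_integral l0 l2 J1 J2); last 2 first.
- exact: measurable_weight.
- by move=> z hz; rewrite lee_fin; apply/ltW/weight_pos.
congr (_ * _)%E.
have i0 : 0 <= inner_radius l by rewrite /inner_radius le_max lexx.
set K := (\int[mu]_(r in `]inner_radius l, 1%R[) (radw w r)%:E)%E.
rewrite (@eq_integral _ _ _ _ _ (fun=> K)); last first.
  move=> t _; apply: eq_integral => r; rewrite inE /= in_itv /= => /andP[r1 r2].
  have r0 : 0 <= r := ltW (le_lt_trans i0 r1).
  have [_ hr _] := hw.
  rewrite -EFinM hr; first by rewrite modulus_polar.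
  by rewrite /unit_disc /= modulus_polar.
rewrite integral_cst//= lebesgue_measure_itv /= lte_fin ltrDl l0.
by rewrite muleC -EFinB addrAC subrr add0r.
Qed.

Lemma arc_full : `]0, (0 + 2 * pi)[ `<=` (`[0, (0 + 2 * pi)] : set R).
Proof. by apply: subset_itv; rewrite bnd_simp. Qed.

Lemma inner_radius_full : inner_radius (2 * pi : R) = 0.
Proof.
have := @pi_ge2 R => h; rewrite /inner_radius max_l//; lra.
Qed.

Lemma radw_integrable : (\int[mu]_(r in `]0%R, 1%R[) (radw w r)%:E < +oo)%E.
Proof.
have := weight_of_square (@pi2_gt0 R) (lexx _) arc_full (@subset_refl _ _).
rewrite inner_radius_full full_square.
have : (weight_of w unit_disc < +oo)%E.
  have [[_ /integrableP[_ h]] _ _] := hw.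
  rewrite /weight_of /area_integral; move: h.
  under eq_integral => p pD.
    rewrite /abse ger0_norm; last by apply/ltW/weight_pos; move: pD; rewrite inE.
    over.
  by [].
move=> /[swap] ->; set K := (\int[mu]_(_ in _) _)%E.
have K0 : (0 <= K)%E.
  apply: integral_ge0 => s hs; rewrite lee_fin.
  by apply: (@radw_ge0_sub 0).
have [->|Kn] := eqVneq K +oo%E; last by move=> _; rewrite ltey.
rewrite gt0_muley ?lte_fin ?pi2_gt0// gt0_muley ?ltxx// lte_fin invr_gt0 pi_gt0//.
Qed.

Lemma tail_fin r : 0 <= r -> (\int[mu]_(s in `]r, 1%R[) (radw w s)%:E)%E \is a fin_num.
Proof.
move=> r0; rewrite ge0_fin_numE; last first.
  by apply: integral_ge0 => s hs; rewrite lee_fin; exact: radw_ge0_sub hs.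
apply: le_lt_trans radw_integrable; apply: ge0_subset_integral => //.
- by apply/measurable_EFinP; exact: measurable_radw.
- by move=> s hs; rewrite lee_fin; exact: (@radw_ge0_sub 0).
- by apply: subset_itv; rewrite bnd_simp.
Qed.

Lemma tailE r : 0 <= r -> (\int[mu]_(s in `]r, 1%R[) (radw w s)%:E)%E = (tail w r)%:E.
Proof. by move=> r0; rewrite /tail fineK// tail_fin. Qed.

Lemma tail_split r t : 0 <= r -> r <= t -> t < 1 ->
  ((tail w r)%:E = \int[mu]_(s in `]r, t]) (radw w s)%:E + (tail w t)%:E)%E.
Proof.
move=> r0 rt t1; rewrite -!tailE//; last exact: le_trans rt.
rewrite -ge0_integral_setU//.
- congr (integral mu _ _); apply/seteqP; split => x /=; rewrite !in_itv /=.
    by move=> /andP[rx x1]; rewrite rx x1 andbT; case: (leP x t); [left|right].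
  by move=> [|] /andP[h1 h2]; apply/andP; split; lra.
- rewrite (_ : _ `|` _ = `]r, 1[%classic); first by apply/measurable_EFinP; exact: measurable_radw_sub.
  apply/seteqP; split => x /=; rewrite !in_itv /=.
    by move=> [|] /andP[h1 h2]; apply/andP; split; lra.
  by move=> /andP[rx x1]; rewrite rx x1 andbT; case: (leP x t); [left|right].
- move=> x hx; rewrite lee_fin; apply: (@radw_ge0_sub r) => //.
  by move: hx => [|] /=; rewrite !in_itv /= => /andP[h1 h2]; apply/andP; split; lra.
- apply/disj_setPRL => x /=; rewrite !in_itv /= => /andP[h1 h2] /andP[h3 h4].
  by lra.
Qed.

Lemma tail_nonincreasing r t : 0 <= r -> r <= t -> t < 1 -> tail w t <= tail w r.
Proof.
move=> r0 rt t1; rewrite -lee_fin (tail_split r0 rt t1) leeDr//.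
apply: integral_ge0 => s /=; rewrite in_itv /= => /andP[h1 h2].
by rewrite lee_fin (@radw_ge0_sub r)// in_itv /= h1 (le_lt_trans h2 t1).
Qed.

Lemma tail_gt0 r : 0 <= r -> r < 1 -> 0 < tail w r.
Proof.
move=> r0 r1; pose a := (2 * r + 1) / 3; pose b := (r + 2) / 3.
have ab : a < b by rewrite /a /b; lra.
have ra : r < a by rewrite /a; lra.
have b1 : b < 1 by rewrite /b; lra.
have [|c hc hmin] := @EVT_min R (radw w) a b (ltW ab).
  apply: continuous_in_subspaceT => t; rewrite inE /= in_itv /= => /andP[h1 h2].
  by apply: radw_continuous; apply/andP; split; lra.
move: hc; rewrite in_itv /= => /andP[c1 c2].
have c0 : 0 < radw w c by apply: radw_gt0; apply/andP; split; lra.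
have : 0 < radw w c * (b - a) by rewrite mulr_gt0// subr_gt0.
move/lt_le_trans; apply; rewrite -lee_fin -tailE//.
have -> : (radw w c * (b - a))%:E = (\int[mu]_(s in `[a, b]) (radw w c)%:E)%E.
  by rewrite integral_cst//= lebesgue_measure_itv /= lte_fin ab -EFinB -EFinM.
apply: (@le_trans _ _ (\int[mu]_(s in `[a, b]) (radw w s)%:E)%E).
  apply: ge0_le_integral => //.
  - by move=> x _; rewrite lee_fin ltW.
  - apply/measurable_EFinP; apply: measurable_funS measurable_radw => //.
    by apply: subset_itv; rewrite bnd_simp; lra.
apply: ge0_subset_integral => //.
- by apply/measurable_EFinP; exact: measurable_radw_sub.
- by move=> s hs; rewrite lee_fin; exact: (@radw_ge0_sub r).
- by apply: subset_itv; rewrite bnd_simp; lra.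
Qed.

(** On the interval from [r] to [1 - q * (1 - r)] the density is at most [K *
    tail w r / (q * (1 - r))], and the interval has length [(1 - q) * (1 - r)];
    the chosen [q] makes this part at most half of the tail. Iterating reaches
    any [theta]. *)
Lemma tail_doubling (K r0 : R) : 0 < K -> 0 <= r0 -> r0 < 1 ->
  (forall s, r0 <= s < 1 -> radw w s <= K * tail w s / (1 - s)) ->
  forall theta : R, 0 < theta -> theta < 1 -> exists2 D : R, 0 < D &
    forall r, r0 <= r < 1 -> tail w r <= D * tail w (1 - theta * (1 - r)).
Proof.
move=> K0 r00 r01 hK theta th0 th1.
pose q := 2 * K / (2 * K + 1).
have qd : 0 < 2 * K + 1 by lra.
have q0 : 0 < q by rewrite divr_gt0// mulr_gt0.
have q1 : q < 1 by rewrite ltr_pdivrMr//; lra.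
have step r : r0 <= r < 1 -> tail w r <= 2 * tail w (1 - q * (1 - r)).
  move=> /andP[rr r1]; pose t := 1 - q * (1 - r).
  have r0' : 0 <= r by lra.
  have t1 : t < 1 by rewrite /t ltrBlDr ltrDl mulr_gt0// subr_gt0.
  have rt : r < t.
    by have := ltr_pM2r (_ : 0 < 1 - r) q 1; rewrite subr_gt0 q1 /t => /(_ r1); lra.
  have : ((tail w r)%:E <= (K * tail w r / (1 - t) * (t - r))%:E + (tail w t)%:E)%E.
    rewrite {1}(tail_split r0' (ltW rt) t1) leeD2r//.
    apply: (@le_trans _ _ (\int[mu]_(s in `]r, t]) (K * tail w r / (1 - t))%:E)%E).
      apply: ge0_le_integral => //.
      - move=> x /=; rewrite in_itv /= => /andP[h1 h2]; rewrite lee_fin.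
        by apply: (@radw_ge0_sub r) => //; rewrite in_itv /= h1 (le_lt_trans h2).
      - apply/measurable_EFinP; apply: measurable_funS measurable_radw => //.
        by apply: subset_itv; rewrite bnd_simp.
      - move=> x /=; rewrite in_itv /= => /andP[h1 h2]; rewrite lee_fin.
        have x1 : x < 1 := le_lt_trans h2 t1.
        apply: le_trans (hK x _) _; first by apply/andP; split; lra.
        have tx := tail_nonincreasing r0' (ltW h1) x1.
        have tx0 := tail_gt0 (ltW (le_lt_trans r0' h1)) x1.
        apply: ler_pM.
        + by rewrite mulr_ge0 ?ltW.
        + by rewrite invr_ge0 subr_ge0 ltW.
        + by apply: ler_wpM2l => //; exact: ltW.
        + by rewrite lef_pV2 ?posrE ?subr_gt0// lerB.
    by rewrite integral_cst//= lebesgue_measure_itv /= lte_fin rt -EFinB -EFinM.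
  rewrite -EFinD lee_fin.
  have -> : K * tail w r / (1 - t) * (t - r) = tail w r / 2.
    have x0 : 1 - r != 0 by rewrite subr_eq0 gt_eqF.
    have -> : 1 - t = q * (1 - r) by rewrite /t; ring.
    have -> : t - r = (1 - q) * (1 - r) by rewrite /t; ring.
    have qn0 : q != 0 by rewrite gt_eqF.
    have qK : (1 - q) * K = q / 2 by rewrite /q; field; rewrite gt_eqF.
    move: qn0 qK x0; move: (tail w r) (1 - r) (q) => T x q' qn0 qK x0.
    transitivity ((1 - q') * K * T / q'); first by field; rewrite x0 qn0.
    by rewrite qK; field.
  by rewrite -/t; lra.
have [n hn] : exists n, q ^+ n < theta.
  have qn : `|q| < 1 by rewrite gtr0_norm.
  have := cvg_expr qn; move/cvgrPdist_lt => /(_ _ th0) [n _ /(_ n (leqnn n))] /=.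
  by rewrite sub0r normrN gtr0_norm ?exprn_gt0// => h; exists n.
have iter k r : r0 <= r < 1 -> tail w r <= 2 ^+ k * tail w (1 - q ^+ k * (1 - r)).
  elim: k => [|k IH] hr; first by rewrite !expr0 !mul1r opprB addrC subrK.
  apply: le_trans (IH hr) _; rewrite exprS (mulrC 2) -mulrA.
  apply: ler_wpM2l; first by rewrite exprn_ge0.
  apply: le_trans (step _ _) _.
    move/andP: hr => [rr r1]; have qk0 : 0 < q ^+ k by rewrite exprn_gt0.
    have qk1 : q ^+ k <= 1 by rewrite exprn_ile1// ltW.
    have := ler_wpM2r (_ : 0 <= 1 - r) qk1; rewrite subr_ge0 ltW// => /(_ isT) h1.
    have := mulr_gt0 qk0 (_ : 0 < 1 - r); rewrite subr_gt0 => /(_ r1) h2.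
    by apply/andP; split; lra.
  by rewrite exprS le_eqVlt; apply/orP; left; apply/eqP; congr (2 * tail w _); ring.
exists (2 ^+ n); first by rewrite exprn_gt0.
move=> r hr; apply: le_trans (iter n r hr) _; apply: ler_wpM2l; first by rewrite exprn_ge0.
move/andP: hr => [rr r1]; have r1' : 0 < 1 - r by rewrite subr_gt0.
have h1 := ltr_pM2r r1' (q ^+ n) theta; rewrite hn in h1.
have h2 := ltr_pM2r r1' theta 1; rewrite th1 in h2.
have h3 := mulr_gt0 th0 r1'; have h4 := mulr_gt0 (exprn_gt0 n q0) r1'.
by apply: tail_nonincreasing; lra.
Qed.

End weights.

Section associated_weight.
Context {R : realType}.
Local Notation mu := (@lebesgue_measure R).
Local Notation T2 := (measurableTypeR R * measurableTypeR R)%type.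
Local Notation C := (Cplx R).
Local Arguments modulus : simpl never.
Local Arguments plane : simpl never.

Variable w : C -> R.
Hypothesis hw : continuous_radial_weight w.

Definition star (r : R) : \bar R :=
  (\int[mu]_(s in `]r, 1%R[) (w (ofR s) * ln (s / r) * s)%:E)%E.

Lemma wstarE z : wstar w z = star (modulus z).
Proof. by []. Qed.

Lemma ln_quot_ge0 (r s : R) : 0 <= r -> r < s -> 0 <= ln (s / r).
Proof.
rewrite le_eqVlt => /predU1P[<- _|r0 rs]; first by rewrite invr0 mulr0 ln0.
by apply: ln_ge0; rewrite ler_pdivlMr// mul1r ltW.
Qed.

Lemma starE r : star r = (\int[mu]_(s in `]r, 1%R[) (radw w s * ln (s / r))%:E)%E.
Proof. by apply: eq_integral => s _; rewrite /radw mulrAC. Qed.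

Let G (p : T2) : \bar R := (((radw w \_ `]0, 1[) p.2 * ln (p.2 / p.1))%:E
   * (\1_`]0, +oo[%classic (p.2 - p.1))%:E)%E.

Let mG : measurable_fun setT G.
Proof.
have m1 : measurable_fun setT (radw w \_ `]0, 1[).
  apply/(measurable_restrict _ (measurable_itv _) measurableT).
  by rewrite setTI; exact: (measurable_radw hw).
apply: emeasurable_funM; last first.
  apply: (@measurable_indicE R `]0, +oo[%classic _ T2 (fun p => p.2 - p.1)).
    exact: measurable_itv.
  exact: measurable_funB.
apply/measurable_EFinP; apply: measurable_funM.
  exact: (measurableT_comp m1).
apply: (measurableT_comp (@measurable_ln R)).
apply: measurable_funM => //.
exact: (measurableT_comp (@measurable_invr R)).
Qed.

Let G0 p : (0 <= G p)%E.
Proof.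
rewrite /G mule_indic; case: ifP => //; rewrite inE /= in_itv /= andbT subr_gt0 => h.
rewrite lee_fin /patch; case: ifPn => [|_]; last by rewrite mul0r.
rewrite inE /= in_itv /= => hs; apply: mulr_ge0; first by rewrite ltW// (radw_gt0 hw).
have [p0|p0] := leP 0 p.1; first exact: ln_quot_ge0.
by rewrite ln0// pmulr_rle0 ?invr_le0 ?ltW//; case/andP: hs.
Qed.

Let starG r : 0 <= r -> star r = (\int[mu]_s G (r, s))%E.
Proof.
move=> r0; rewrite starE integral_indic_mul; apply: eq_integral => s _.
rewrite /G /= !mule_indic.
have [sr|sr] := leP s r.
  rewrite memNset; last by rewrite /= in_itv /= ltNge sr.
  by rewrite memNset//= in_itv /= andbT subr_gt0 ltNge sr.
rewrite [s - r \in _]mem_set; last by rewrite /= in_itv /= subr_gt0 sr.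
rewrite /patch; have [s1|s1] := ltP s 1.
  rewrite mem_set; last by rewrite /= in_itv /= s1 sr.
  by rewrite mem_set//= in_itv /= s1 (le_lt_trans r0).
rewrite memNset; last by rewrite /= in_itv /= [s < 1]ltNge s1 andbF.
by rewrite memNset ?mul0r//= in_itv /= [s < 1]ltNge s1 andbF.
Qed.

Lemma measurable_star : measurable_fun [set: T2] (fun p => star (modulus (plane p))).
Proof.
rewrite (_ : (fun p => _) = (fun r : R => \int[mu]_s G (r, s))%E \o (fun p : T2 => modulus (plane p))).
  apply: measurableT_comp; last exact: measurable_modulus.
  exact: (measurable_fun_fubini_tonelli_F G mG).
by apply/funext => p /=; rewrite starG// modulus_ge0.
Qed.

Lemma measurable_star1 : measurable_fun (`[0, +oo[%classic : set R) star.
Proof.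
apply: (@eq_measurable_fun _ _ _ _ _ (fun r : R => \int[mu]_s G (r, s))%E).
  by move=> r; rewrite inE /= in_itv /= andbT => r0; rewrite starG.
apply: measurable_funTS; exact: (measurable_fun_fubini_tonelli_F G mG).
Qed.

Lemma measurable_star_integrand r : 0 <= r ->
  measurable_fun (`]r, 1[%classic : set R) (fun s => (radw w s * ln (s / r))%:E).
Proof.
move=> r0; apply/measurable_EFinP; apply: measurable_funM; first exact: (measurable_radw_sub hw).
apply: measurable_funTS; apply: (measurableT_comp (@measurable_ln R)).
exact: measurable_funM.
Qed.

Lemma star_integrand_ge0 r s : 0 <= r -> s \in `]r, 1[ ->
  (0 <= (radw w s * ln (s / r))%:E)%E.
Proof.
move=> r0 hs; rewrite lee_fin; apply: mulr_ge0; first exact: (@radw_ge0_sub _ _ hw r).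
by apply: ln_quot_ge0 => //; move: hs; rewrite in_itv /= => /andP[].
Qed.

Lemma star_ge0 r : 0 <= r -> (0 <= star r)%E.
Proof. by move=> r0; rewrite starE; apply: integral_ge0 => s hs; exact: star_integrand_ge0. Qed.

Lemma star_le_scaled r c : 0 <= r -> 0 <= c ->
  (forall s, r < s < 1 -> ln (s / r) <= c) ->
  (star r <= (c * tail w r)%:E)%E.
Proof.
move=> r0 c0 hc; rewrite starE EFinM -(tailE hw)// -ge0_integralZl//; last 2 first.
- by apply/measurable_EFinP; exact: (measurable_radw_sub hw).
- by move=> s hs; rewrite lee_fin; exact: (@radw_ge0_sub _ _ hw r).
apply: ge0_le_integral => //.
- by move=> s hs; exact: star_integrand_ge0.
- exact: measurable_star_integrand.
- apply: emeasurable_funM => //; apply/measurable_EFinP; exact: (measurable_radw_sub hw).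
- move=> s hs; rewrite -EFinM lee_fin [leRHS]mulrC; apply: ler_wpM2l.
    exact: (@radw_ge0_sub _ _ hw r).
  by apply: hc; move: hs; rewrite /= in_itv.
Qed.

(** Here [ln (s / r) <= (s - r) / r <= 2 * (1 - r)]. *)
Lemma star_le_tail r : 2^-1 <= r < 1 -> (star r <= (2 * (1 - r) * tail w r)%:E)%E.
Proof.
move=> /andP[r2 r1]; have r0 : 0 < r by lra.
apply: star_le_scaled; [exact: ltW|lra|].
move=> s /andP[rs s1].
have -> : s / r = 1 + (s - r) / r by field; rewrite gt_eqF.
have h : 0 <= (s - r) / r by apply: divr_ge0; [rewrite subr_ge0 ltW|exact: ltW].
apply: le_trans (le_ln1Dx _) _; first lra.
by rewrite ler_pdivrMr//; nra.
Qed.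

(** The factor [r], which comes from the area element, compensates the
    logarithmic singularity at the origin. *)
Lemma star_mul_le r : 0 <= r < 1 -> (star r * r%:E <= (tail w 0)%:E)%E.
Proof.
move=> /andP[r0 r1].
move: (r0); rewrite le_eqVlt => /predU1P[<-|rp].
  by rewrite mule0 lee_fin ltW// (tail_gt0 hw).
have h : (star r <= (r^-1 * tail w r)%:E)%E.
  apply: star_le_scaled => //; first by rewrite invr_ge0.
  move=> s /andP[rs s1].
  have sr : 0 < s / r by rewrite divr_gt0// (lt_trans rp).
  apply: le_trans (ltW (ln_sublinear sr)) _.
  by rewrite ler_piMl ?invr_ge0// ltW.
apply: le_trans (lee_wpmul2r _ h) _; first by rewrite lee_fin.
rewrite -EFinM lee_fin mulrAC mulVf ?gt_eqF// mul1r.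
exact: (tail_nonincreasing hw).
Qed.

(** Only the [s] beyond the midpoint of [r] and [1] are kept; for them [ln (s /
    r) >= 1 - r / s >= (1 - r) / 2]. *)
Lemma star_ge_tail r : 0 < r < 1 ->
  (((1 - r) / 2 * tail w ((1 + r) / 2))%:E <= star r)%E.
Proof.
move=> /andP[r0 r1]; pose m := (1 + r) / 2.
have m0 : 0 <= m by rewrite /m; lra.
have rm : r < m by rewrite /m; lra.
rewrite EFinM -(tailE hw)// -ge0_integralZl//; first last.
- by rewrite lee_fin; lra.
- by move=> s hs; rewrite lee_fin; exact: (@radw_ge0_sub _ _ hw m).
- by apply/measurable_EFinP; exact: (measurable_radw_sub hw).
rewrite starE.
apply: (@le_trans _ _ (\int[mu]_(s in `]m, 1%R[) (radw w s * ln (s / r))%:E)%E).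
  apply: ge0_le_integral => //.
  - move=> s hs; rewrite -EFinM lee_fin; apply: mulr_ge0; first lra.
    exact: (@radw_ge0_sub _ _ hw m).
  - apply: emeasurable_funM => //; apply/measurable_EFinP; exact: (measurable_radw_sub hw).
  - apply: measurable_funS (measurable_star_integrand (ltW r0)) => //.
    by apply: subset_itv; rewrite bnd_simp// ltW.
  - move=> s hs; rewrite -EFinM lee_fin mulrC; apply: ler_wpM2l.
      exact: (@radw_ge0_sub _ _ hw m).
    move: hs; rewrite /= in_itv /= => /andP[ms s1].
    have s0 : 0 < s by lra.
    have h : ln (r / s) <= (r - s) / s.
      have -> : r / s = 1 + (r - s) / s by field; rewrite gt_eqF.
      apply: le_ln1Dx; have -> : (r - s) / s = r / s - 1 by field; rewrite gt_eqF.
      by have := divr_gt0 r0 s0; lra.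
    have -> : ln (s / r) = - ln (r / s).
      by rewrite -lnV ?posrE ?divr_gt0// invf_div.
    rewrite lerNr; apply: le_trans h _; rewrite ler_pdivrMr// /m in ms *.
    nra.
apply: ge0_subset_integral => //.
- exact: measurable_star_integrand (ltW r0).
- by move=> s hs; apply: star_integrand_ge0 => //; exact: ltW.
- by apply: subset_itv; rewrite bnd_simp// ltW.
Qed.

Lemma star_nonincreasing r r' : 0 < r -> r <= r' -> r' < 1 -> (star r' <= star r)%E.
Proof.
move=> r0 rr r1; rewrite !starE.
have r'0 : 0 < r' by lra.
apply: (@le_trans _ _ (\int[mu]_(s in `]r', 1%R[) (radw w s * ln (s / r))%:E)%E).
  apply: ge0_le_integral => //.
  - by move=> s hs; apply: star_integrand_ge0 => //; exact: ltW.
  - exact: measurable_star_integrand (ltW r'0).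
  - apply: measurable_funS (measurable_star_integrand (ltW r0)) => //.
    by apply: subset_itv; rewrite bnd_simp.
  - move=> s hs; rewrite lee_fin; apply: ler_wpM2l.
      exact: (@radw_ge0_sub _ _ hw r' s (ltW r'0)).
    move: hs; rewrite /= in_itv /= => /andP[ms s1].
    have s0 : 0 < s by lra.
    rewrite ler_ln ?posrE ?divr_gt0//; apply: ler_wpM2l; first exact: ltW.
    by rewrite lef_pV2.
apply: ge0_subset_integral => //.
- exact: measurable_star_integrand (ltW r0).
- by move=> s hs; apply: star_integrand_ge0 => //; exact: ltW.
- by apply: subset_itv; rewrite bnd_simp.
Qed.

End associated_weight.

Section doubling.
Context {R : realType}.
Local Notation mu := (@lebesgue_measure R).
Local Notation C := (Cplx R).

(** In [psi] the weight is integrated without the factor [s], which is at least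
    [1 / 2] here. *)
Lemma psi_lower_tail (w : C -> R) (c r : R) : continuous_radial_weight w ->
  0 < c -> 2^-1 <= r < 1 -> c * (1 - r) <= psi w r ->
  radw w r <= 2 / c * tail w r / (1 - r).
Proof.
move=> hw c0 /andP[r2 r1]; have r0 : 0 <= r by lra.
have wr : 0 < w (ofR r) by apply: (weight_pos hw); apply: disc_ofR; rewrite r0.
rewrite /psi ler_pdivlMl// => h.
have mw : measurable_fun (`]r, 1[%classic : set R) (fun s => w (ofR s)).
  apply: (@eq_measurable_fun _ _ _ _ _ (fun s => radw w s * s^-1)).
    move=> s; rewrite inE /= in_itv /= => /andP[rs _].
    by rewrite /radw mulfK// gt_eqF// (le_lt_trans r0).
  apply: measurable_funM; first exact: (measurable_radw_sub hw).
  by apply: measurable_funTS; exact: measurable_invr.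
have wpos s : s \in `]r, 1[ -> 0 <= w (ofR s).
  rewrite in_itv /= => /andP[rs s1]; apply/ltW/(weight_pos hw)/disc_ofR.
  by rewrite s1 ltW// (le_lt_trans r0).
have le2 : (\int[mu]_(s in `]r, 1%R[) (w (ofR s))%:E <= (2 * tail w r)%:E)%E.
  rewrite EFinM -(tailE hw)// -ge0_integralZl//; last 2 first.
  - by apply/measurable_EFinP; exact: (measurable_radw_sub hw).
  - by move=> s hs; rewrite lee_fin; exact: (@radw_ge0_sub _ _ hw r).
  apply: ge0_le_integral => //.
  - exact/measurable_EFinP.
  - apply: emeasurable_funM => //; apply/measurable_EFinP; exact: (measurable_radw_sub hw).
  - move=> s hs; rewrite -EFinM lee_fin /radw; have w0 := wpos s hs.
    by move: hs; rewrite /= in_itv /= => /andP[rs s1]; nra.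
have h2 : \int[mu]_(s in `]r, 1[) w (ofR s) <= 2 * tail w r.
  rewrite /Rintegral -lee_fin fineK// ge0_fin_numE.
    by apply: le_lt_trans le2 _; rewrite ltry.
  by apply: integral_ge0 => s hs; rewrite lee_fin; exact: wpos.
have r1' : 0 < 1 - r by rewrite subr_gt0.
rewrite ler_pdivlMr// (_ : 2 / c * tail w r = c^-1 * (2 * tail w r)); last by ring.
rewrite ler_pdivlMl//.
have h3 : radw w r <= w (ofR r) by rewrite /radw ler_piMr// ltW.
have := ler_wpM2l (ltW (mulr_gt0 c0 r1')) h3.
rewrite (_ : c * (1 - r) * w (ofR r) = w (ofR r) * (c * (1 - r))); last by ring.
by move: h h2; lra.
Qed.

(** In both classes [psi w r] is at least a multiple of [1 - r] near the
    boundary, which is the density bound that makes the tail doubling. *)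
Lemma class_tail_doubling (w : C -> R) : class_I w \/ class_R w ->
  continuous_radial_weight w /\
  exists2 r0 : R, 2^-1 <= r0 < 1 &
   forall theta : R, 0 < theta -> theta < 1 -> exists2 D : R, 0 < D &
    forall r, r0 <= r < 1 -> tail w r <= D * tail w (1 - theta * (1 - r)).
Proof.
move=> hcl.
suff [hw [c c0 [r0 /andP[r02 r01] hr]]] : continuous_radial_weight w /\ exists2 c : R, 0 < c &
    exists2 r0, 2^-1 <= r0 < 1 & forall r, r0 <= r < 1 -> c * (1 - r) <= psi w r.
  split => //; exists r0; first by rewrite r02.
  apply: (@tail_doubling R w hw (2 / c)) => //; [by rewrite divr_gt0|lra|].
  move=> s /andP[s0 s1]; apply: psi_lower_tail => //; last by apply: hr; rewrite s0.
  by apply/andP; split; lra.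
case: hcl => [[hw hpsi]|[hw [K K1 hK]]]; split => //.
  exists 1 => //.
  have /cvgryPge /(_ 1) := hpsi => -[d /= d0 hd].
  exists (Num.max 2^-1 (1 - d / 2)).
    by rewrite le_max lexx gt_max; apply/andP; split; lra.
  move=> r; rewrite ge_max => /andP[/andP[r2 rd] r1].
  have := hd r; rewrite /= ger0_norm; last by lra.
  move=> /(_ ltac:(lra) r1); rewrite ler_pdivlMr// subr_gt0//.
exists K^-1; first by rewrite invr_gt0; lra.
exists 2^-1; first by apply/andP; split; lra.
by move=> r /andP[r2 r1]; have /andP[] := hK r ltac:(apply/andP; split; lra).
Qed.

End doubling.

(** * Energies over Carleson squares *)

Section energy.
Context {R : realType}.
Local Notation mu := (@lebesgue_measure R).
Local Notation T2 := (measurableTypeR R * measurableTypeR R)%type.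
Local Notation C := (Cplx R).
Local Arguments modulus : simpl never.
Local Arguments plane : simpl never.

Lemma area_integral_le (S : set C) (f g : C -> \bar R) :
  measurable (plane @^-1` S : set T2) -> S `<=` unit_disc ->
  measurable_fun (plane @^-1` unit_disc : set T2) (f \o plane) ->
  measurable_fun (plane @^-1` unit_disc : set T2) (g \o plane) ->
  (forall z, unit_disc z -> (0 <= f z)%E) ->
  (forall z, S z -> (f z <= g z)%E) ->
  (area_integral S f <= area_integral S g)%E.
Proof.
move=> mS SD mf mg f0 fg; apply: ge0_le_integral => //.
- by move=> p /SD; exact: f0.
- by apply: measurable_funS mf; [exact: measurable_unit_disc|move=> p /SD].
- by apply: measurable_funS mg; [exact: measurable_unit_disc|move=> p /SD].
- by move=> p; exact: fg.
Qed.

Lemma area_integral_subset (S S' : set C) (f : C -> \bar R) :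
  measurable (plane @^-1` S : set T2) -> measurable (plane @^-1` S' : set T2) ->
  S `<=` S' -> S' `<=` unit_disc ->
  measurable_fun (plane @^-1` unit_disc : set T2) (f \o plane) ->
  (forall z, unit_disc z -> (0 <= f z)%E) ->
  (area_integral S f <= area_integral S' f)%E.
Proof.
move=> mS mS' SS SD mf f0; apply: ge0_subset_integral => //.
- by apply: measurable_funS mf; [exact: measurable_unit_disc|move=> p /SD].
- by move=> p /SD; exact: f0.
- by move=> p; exact: SS.
Qed.

Lemma area_integralZ (S : set C) (c : R) (f : C -> \bar R) : 0 <= c ->
  measurable (plane @^-1` S : set T2) -> S `<=` unit_disc ->
  measurable_fun (plane @^-1` unit_disc : set T2) (f \o plane) ->
  (forall z, unit_disc z -> (0 <= f z)%E) ->
  area_integral S (fun z => c%:E * f z)%E = (c%:E * area_integral S f)%E.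
Proof.
move=> c0 mS SD mf f0; rewrite /area_integral ge0_integralZl//.
- by apply: measurable_funS mf; [exact: measurable_unit_disc|move=> p /SD].
- by move=> p /SD; exact: f0.
Qed.

Lemma area_integralD (S : set C) (f g : C -> \bar R) :
  measurable (plane @^-1` S : set T2) -> S `<=` unit_disc ->
  measurable_fun (plane @^-1` unit_disc : set T2) (f \o plane) ->
  measurable_fun (plane @^-1` unit_disc : set T2) (g \o plane) ->
  (forall z, unit_disc z -> (0 <= f z)%E) ->
  (forall z, unit_disc z -> (0 <= g z)%E) ->
  area_integral S (fun z => f z + g z)%E = (area_integral S f + area_integral S g)%E.
Proof.
move=> mS SD mf mg f0 g0; rewrite /area_integral ge0_integralD//.
- by move=> p /SD; exact: f0.
- by apply: measurable_funS mf; [exact: measurable_unit_disc|move=> p /SD].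
- by move=> p /SD; exact: g0.
- by apply: measurable_funS mg; [exact: measurable_unit_disc|move=> p /SD].
Qed.

Lemma square_measurable (I : set C) l : arc_of_length I l ->
  measurable (plane @^-1` carleson_square I l : set T2).
Proof. by move=> [/andP[l0 l2] [a [J [J1 J2 ->]]]]; exact: (measurable_carleson_arc l0 l2 J1 J2). Qed.

Lemma square_sub_disc (I : set C) l : carleson_square I l `<=` unit_disc.
Proof.
move=> z [r [t [-> _ r0 /andP[_ r1]]]].
by rewrite /unit_disc /= modulus_polar.
Qed.

Variable w : C -> R.
Hypothesis hw : continuous_radial_weight w.

Definition density (phi : C -> C) (z : C) : \bar R :=
  ((modulus (phi z) ^+ 2)%:E * wstar w z)%E.

Definition energy (phi : C -> C) (S : set C) : \bar R := area_integral S (density phi).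

Definition mass (l : R) : R := pi^-1 * (l * tail w (inner_radius l)).

Lemma inner_radius_ge0 l : 0 <= inner_radius l :> R.
Proof. by rewrite /inner_radius le_max lexx. Qed.

Lemma inner_radius_lt1 l : 0 < l -> inner_radius l < 1 :> R.
Proof. by move=> l0; rewrite /inner_radius gt_max ltr01 /=; lra. Qed.

Lemma inner_radius_small l : l <= 1 -> inner_radius l = 1 - l :> R.
Proof. by move=> l1; rewrite /inner_radius max_r// subr_ge0. Qed.

Lemma mass_gt0 l : 0 < l -> 0 < mass l.
Proof.
move=> l0; rewrite /mass mulr_gt0 ?invr_gt0 ?pi_gt0// mulr_gt0// (tail_gt0 hw)//.
  exact: inner_radius_ge0.
exact: inner_radius_lt1.
Qed.

Lemma arc_gt0 (I : set C) l : arc_of_length I l -> 0 < l.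
Proof. by case=> /andP[]. Qed.

Lemma weight_arc (I : set C) l : arc_of_length I l ->
  weight_of w (carleson_square I l) = (mass l)%:E.
Proof.
move=> [/andP[l0 l2] [a [J [J1 J2 ->]]]].
by rewrite (weight_of_square hw l0 l2 J1 J2) (tailE hw) ?inner_radius_ge0// -!EFinM.
Qed.

(** The weight of a square being positive and finite, quotients are traded for
    inequalities between energies. *)
Lemma quotient_le (g : C -> C) (I : set C) l c : arc_of_length I l ->
  (carleson_quotient w g I l <= c%:E)%E =
  (energy (derive1 g) (carleson_square I l) <= (c * mass l)%:E)%E.
Proof.
move=> hI; have m0 := mass_gt0 (arc_gt0 hI).
rewrite /carleson_quotient (weight_arc hI) inver gt_eqF//.
by rewrite lee_pdivrMr// -EFinM.
Qed.

Lemma quotient_lt (g : C -> C) (I : set C) l c : arc_of_length I l ->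
  (carleson_quotient w g I l < c%:E)%E =
  (energy (derive1 g) (carleson_square I l) < (c * mass l)%:E)%E.
Proof.
move=> hI; have m0 := mass_gt0 (arc_gt0 hI).
rewrite /carleson_quotient (weight_arc hI) inver gt_eqF//.
by rewrite lte_pdivrMr// -EFinM.
Qed.

Lemma measurable_density phi : poly_limit phi ->
  measurable_fun (plane @^-1` unit_disc : set T2) (density phi \o plane).
Proof.
move=> hphi; apply: emeasurable_funM.
  by apply/measurable_EFinP; exact: measurable_poly_limit.
by apply: measurable_funTS; exact: (measurable_star hw).
Qed.

Lemma wstar_ge0 z : (0 <= wstar w z)%E.
Proof. by rewrite wstarE; apply: (star_ge0 hw); exact: modulus_ge0. Qed.

Lemma density_ge0 phi z : (0 <= density phi z)%E.
Proof. by apply: mule_ge0; [rewrite lee_fin sqr_ge0|exact: wstar_ge0]. Qed.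

Lemma measurable_wstar_plane :
  measurable_fun (plane @^-1` unit_disc : set T2) (wstar w \o plane).
Proof. by apply: measurable_funTS; exact: (measurable_star hw). Qed.

(** This replaces the triangle inequality of the seminorm. *)
Lemma energy_le_sum phi phi1 phi2 S : measurable (plane @^-1` S : set T2) ->
  S `<=` unit_disc -> poly_limit phi -> poly_limit phi1 -> poly_limit phi2 ->
  (forall z, S z -> modulus (phi z) <= modulus (phi1 z) + modulus (phi2 z)) ->
  (energy phi S <= 2%:E * energy phi1 S + 2%:E * energy phi2 S)%E.
Proof.
move=> mS SD h h1 h2 hle.
have m1 := measurable_density h1; have m2 := measurable_density h2.
have d0 (psi : C -> C) z : unit_disc z -> (0 <= density psi z)%E by move=> _; exact: density_ge0.
have e0 (psi : C -> C) z : unit_disc z -> (0 <= 2%:E * density psi z)%E.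
  by move=> _; apply: mule_ge0 => //; exact: density_ge0.
have e1 := area_integralZ (ler0n R 2) mS SD m1 (d0 phi1).
have e2 := area_integralZ (ler0n R 2) mS SD m2 (d0 phi2).
have me1 : measurable_fun (plane @^-1` unit_disc : set T2)
    (fun p => 2%:E * density phi1 (plane p))%E by exact: emeasurable_funM.
have me2 : measurable_fun (plane @^-1` unit_disc : set T2)
    (fun p => 2%:E * density phi2 (plane p))%E by exact: emeasurable_funM.
rewrite /energy -e1 -e2 -area_integralD//; last 2 first.
- exact: e0.
- exact: e0.
apply: area_integral_le => //.
- exact: measurable_density.
- exact: (emeasurable_funD me1 me2).
- by move=> z _; exact: density_ge0.
move=> z Sz; rewrite /density !muleA -!EFinM -ge0_muleDl; last 2 first.
- by rewrite lee_fin mulr_ge0// sqr_ge0.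
- by rewrite lee_fin mulr_ge0// sqr_ge0.
apply: lee_wpmul2r; first exact: wstar_ge0.
rewrite -EFinD lee_fin; apply: (@le_trans _ _ ((modulus (phi1 z) + modulus (phi2 z)) ^+ 2)).
  by rewrite ler_pXn2r ?nnegrE ?addr_ge0 ?modulus_ge0//; exact: hle.
by have := sqr_ge0 (modulus (phi1 z) - modulus (phi2 z)); lra.
Qed.

Lemma energy_le_bound phi S B : measurable (plane @^-1` S : set T2) ->
  S `<=` unit_disc -> poly_limit phi -> 0 <= B ->
  (forall z, S z -> modulus (phi z) ^+ 2 <= B) ->
  (energy phi S <= B%:E * area_integral S (wstar w))%E.
Proof.
move=> mS SD h B0 hB; have mw := measurable_wstar_plane.
have s0 z : unit_disc z -> (0 <= wstar w z)%E by move=> _; exact: wstar_ge0.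
rewrite -area_integralZ//; apply: area_integral_le => //.
- exact: measurable_density.
- exact: (emeasurable_funM (measurable_cst _) mw).
- by move=> z _; exact: density_ge0.
- by move=> z Sz; apply: lee_wpmul2r; [exact: wstar_ge0|rewrite lee_fin; exact: hB].
Qed.

Lemma wstar_square_le (I : set C) l c : arc_of_length I l -> 0 <= c ->
  (forall r, inner_radius l < r < 1 -> (star w r * r%:E <= c%:E)%E) ->
  (area_integral (carleson_square I l) (wstar w) <=
   (pi^-1 * (l * (c * (1 - inner_radius l))))%:E)%E.
Proof.
move=> [/andP[l0 l2] [a [J [J1 J2 ->]]]] c0 hc.
have i0 := inner_radius_ge0 l; have i1 := inner_radius_lt1 l0.
rewrite (sector_integral l0 l2 J1 J2); last 2 first.
- exact: measurable_wstar_plane.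
- by move=> z _; exact: wstar_ge0.
rewrite EFinM; apply: lee_wpmul2l; first by rewrite lee_fin invr_ge0 pi_ge0.
have sE t : sect (wstar w) l t = (\int[mu]_(r in `]inner_radius l, 1%R[) (star w r * r%:E))%E.
  apply: eq_integral => r; rewrite inE /= in_itv /= => /andP[r1 _].
  by rewrite wstarE modulus_polar//; exact: ltW (le_lt_trans i0 r1).
rewrite (eq_integral (fun=> (\int[mu]_(r in `]inner_radius l, 1%R[) (star w r * r%:E))%E)) => [|t _]; last exact: sE.
rewrite integral_cst//= lebesgue_measure_itv /= lte_fin ltrDl l0 -EFinB addrAC subrr add0r.
rewrite muleC EFinM; apply: lee_wpmul2l; first by rewrite lee_fin ltW.
apply: (@le_trans _ _ (\int[mu]_(r in `]inner_radius l, 1%R[) c%:E)%E).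
  have rge0 r : r \in `]inner_radius l, 1[ -> 0 <= r.
    by rewrite in_itv /= => /andP[r1 _]; exact: ltW (le_lt_trans i0 r1).
  apply: ge0_le_integral => //.
  - by move=> r hr; apply: mule_ge0; [apply: (star_ge0 hw); exact: rge0|rewrite lee_fin; exact: rge0].
  - apply: emeasurable_funM; last exact/measurable_EFinP.
    apply: measurable_funS (measurable_star1 hw) => //.
    by move=> r hr; rewrite /= in_itv /= andbT; exact: rge0.
by rewrite integral_cst//= lebesgue_measure_itv /= lte_fin i1 -EFinB -EFinM.
Qed.

Lemma wstar_square_total (I : set C) l : arc_of_length I l ->
  (area_integral (carleson_square I l) (wstar w) <= (pi^-1 * (l * tail w 0))%:E)%E.
Proof.
move=> hI; have l0 := arc_gt0 hI.
have i0 := inner_radius_ge0 l; have i1 := inner_radius_lt1 l0.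
have t0 : 0 < tail w 0 by exact: (tail_gt0 hw).
apply: le_trans (wstar_square_le hI (ltW t0) _) _.
  by move=> r /andP[r1 r2]; apply: (star_mul_le hw); rewrite r2 (ltW (le_lt_trans i0 r1)).
rewrite lee_fin; apply: ler_wpM2l; first by rewrite invr_ge0 pi_ge0.
apply: ler_wpM2l; first exact: ltW.
by have := ler_wpM2l (ltW t0) (_ : 1 - inner_radius l <= 1); rewrite mulr1; apply; lra.
Qed.

(** On the square the weight is at most [2 * l * tail w (1 - l)], and the area
    is about [l ^+ 2]. The additional factor [l ^+ 2] is what makes bounded
    derivatives satisfy the vanishing condition. *)
Lemma wstar_square_small (I : set C) l : arc_of_length I l -> l <= 2^-1 ->
  (area_integral (carleson_square I l) (wstar w) <= (2 * l ^+ 2 * mass l)%:E)%E.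
Proof.
move=> hI lh; have l0 := arc_gt0 hI.
have iE : inner_radius l = 1 - l by apply: inner_radius_small; lra.
have t0 : 0 < tail w (1 - l) by apply: (tail_gt0 hw); lra.
apply: le_trans (@wstar_square_le I l (2 * l * tail w (1 - l)) hI _ _) _.
- by rewrite !mulr_ge0// ltW.
- rewrite iE => r /andP[r1 r2]; have r0 : 0 <= r by lra.
  have s0 := star_ge0 hw r0.
  apply: (@le_trans _ _ (star w r)).
    by rewrite -[leRHS]mule1; apply: lee_wpmul2l => //; rewrite lee_fin ltW.
  apply: le_trans (star_le_tail hw _) _; first by apply/andP; split; lra.
  rewrite lee_fin; have tt : tail w r <= tail w (1 - l) by apply: (tail_nonincreasing hw); lra.
  have tr : 0 < tail w r by apply: (tail_gt0 hw).
  by apply: ler_pM; lra.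
rewrite lee_fin /mass iE le_eqVlt; apply/orP; left; apply/eqP; ring.
Qed.

End energy.

(** * Energies of dilated functions *)

Section closure.
Context {R : realType}.
Local Notation C := (Cplx R).
Local Arguments modulus : simpl never.

Lemma poly_limit_horner (P : {poly C}) : poly_limit (fun z => P.[z]).
Proof. by move=> r e r0 r1 e0; exists P => z _; rewrite subrr modulus0 ltW. Qed.

Lemma poly_limitB (f g : C -> C) : poly_limit f -> poly_limit g ->
  poly_limit (fun z => f z - g z).
Proof.
move=> hf hg r e r0 r1 e0.
have [P hP] := hf r (e / 2) r0 r1 ltac:(lra); have [Q hQ] := hg r (e / 2) r0 r1 ltac:(lra).
exists (P - Q) => z zr; rewrite hornerD hornerN.
rewrite (_ : _ - _ = (f z - P.[z]) - (g z - Q.[z])); last by ring.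
by have := modulusB (f z - P.[z]) (g z - Q.[z]); have := hP z zr; have := hQ z zr; lra.
Qed.

Lemma poly_limitZ (f : C -> C) (r : R) : 0 <= r <= 1 -> poly_limit f ->
  poly_limit (fun z => ofR r * f z).
Proof.
move=> /andP[r0 r1] hf s e s0 s1 e0; have [P hP] := hf s e s0 s1 e0.
exists (ofR r *: P) => z zs; rewrite hornerZ -mulrBr modulusM modulus_ofR ger0_norm//.
have := ler_pM r0 (modulus_ge0 (f z - P.[z])) r1 (hP z zs); rewrite mul1r.
exact.
Qed.

Lemma poly_limit_dilate (f : C -> C) (r : R) : 0 <= r <= 1 -> poly_limit f ->
  poly_limit (dilate r f).
Proof.
move=> /andP[r0 r1] hf s e s0 s1 e0; have [P hP] := hf s e s0 s1 e0.
exists (P \Po (ofR r *: 'X)) => z zs; rewrite horner_comp hornerZ hornerX /dilate.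
apply: hP; rewrite modulusM modulus_ofR ger0_norm//.
by have := ler_pM r0 (modulus_ge0 z) r1 zs; rewrite mul1r.
Qed.

Lemma poly_limit_ext (f g : C -> C) : (forall z, unit_disc z -> f z = g z) ->
  poly_limit f -> poly_limit g.
Proof.
move=> fg hf s e s0 s1 e0; have [P hP] := hf s e s0 s1 e0; exists P => z zs.
by rewrite -fg ?hP// /unit_disc /=; exact: le_lt_trans s1.
Qed.

End closure.

Section annuli.
Context {R : realType}.
Local Notation mu := (@lebesgue_measure R).
Local Notation T2 := (measurableTypeR R * measurableTypeR R)%type.
Local Notation C := (Cplx R).
Local Arguments modulus : simpl never.
Local Arguments plane : simpl never.

Definition annulus (q : R) : set C := [set z | q < modulus z < 1].

Definition sectr (f : C -> \bar R) (q t : R) : \bar R :=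
  (\int[mu]_(r in `]q, 1%R[) (f (ofR r * cis t)%R * r%:E))%E.

Lemma measurable_annulus q : measurable (plane @^-1` annulus q : set T2).
Proof.
have := @measurable_preimage_itv R _ `]q, 1[ (@measurable_modulus R).
by congr measurable; apply/seteqP; split => p; rewrite /= in_itv.
Qed.

Definition annular (f : C -> \bar R) (q : R) : T2 -> \bar R :=
  (f \o plane) \_ (plane @^-1` annulus q).

Lemma plane_polar (r t : R) : plane (r * cos t, r * sin t) = ofR r * cis t.
Proof. by apply/eqP; rewrite eq_complex /=; apply/andP; split; apply/eqP; ring. Qed.

Section annular_integral.
Variables (f : C -> \bar R) (q : R).
Hypothesis mf : measurable_fun (plane @^-1` unit_disc : set T2) (f \o plane).
Hypothesis f0 : forall z, (0 <= f z)%E.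
Hypothesis q0 : 0 <= q.

Lemma measurable_annular : measurable_fun setT (annular f q).
Proof.
apply/(measurable_restrict _ (measurable_annulus q) measurableT); rewrite setTI.
apply: measurable_funS mf; first exact: measurable_unit_disc.
by move=> p /andP[_].
Qed.

Lemma annular_ge0 p : (0 <= annular f q p)%E.
Proof. by rewrite /annular /patch; case: ifP => // _; exact: f0. Qed.

Lemma annular_polar r t : 0 < r -> annular f q (r * cos t, r * sin t) =
  if q < r < 1 then f (ofR r * cis t)%R else 0%E.
Proof.
move=> r0; rewrite /annular /patch /= plane_polar; case: ifPn => h; case: ifPn => //.
  move=> /negP; case; move: h; rewrite inE /= plane_polar /annulus /= modulus_polar//.
  exact: ltW.
move=> h'; exfalso; move: h => /negP; apply; rewrite inE /= plane_polar /annulus /=.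
by rewrite modulus_polar//; exact: ltW.
Qed.

Lemma sectr_ray t : sectr f q t = ray (annular f q) t.
Proof.
rewrite /sectr /ray [LHS]integral_indic_mul [RHS]integral_indic_mul.
apply: eq_integral => r _; rewrite !mule_indic.
have [r0|r0] := ltP 0 r; last first.
  rewrite memNset; last by rewrite /= in_itv /= ltNge (le_trans r0 q0).
  by rewrite memNset//= in_itv /= andbT ltNge r0.
rewrite [r \in `]0, +oo[%classic]mem_set; last by rewrite /= in_itv /= r0.
rewrite annular_polar//; case: ifPn => [|h].
  by rewrite inE /= in_itv /= => ->.
case: ifP => [h'|_]; last by rewrite mul0e.
by move: h => /negP; case; rewrite inE /= in_itv.
Qed.

Lemma measurable_sectr : measurable_fun setT (sectr f q).
Proof.
rewrite (_ : sectr f q = ray (annular f q)); last by apply/funext => t; exact: sectr_ray.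
by apply: measurable_ray; [exact: measurable_annular|exact: annular_ge0].
Qed.

Lemma measurable_sectr_integrand t :
  measurable_fun setT (fun r : R => f (ofR r * cis t)%R * r%:E * (\1_`]q, 1[%classic r)%:E)%E.
Proof.
apply: (@eq_measurable_fun _ _ _ _ _ (fun r : R =>
    annular f q (r * cos t, r * sin t)%R * r%:E * (\1_`]q, 1[%classic r)%:E)%E).
  move=> r _; rewrite !mule_indic; case: ifP => //.
  rewrite inE /= in_itv /= => h; rewrite annular_polar ?h//.
  by case/andP: h => h _; exact: le_lt_trans h.
apply: emeasurable_funM; last exact: measurable_indicE.
apply: emeasurable_funM; last exact/measurable_EFinP.
apply: (measurableT_comp measurable_annular).
by apply: measurable_fun_pair; exact: measurable_funM.
Qed.

Lemma sectr_ge0 t : (0 <= sectr f q t)%E.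
Proof. by rewrite sectr_ray; apply: ray_ge0; exact: annular_ge0. Qed.

End annular_integral.

Lemma sectr_nonincreasing (f : C -> \bar R) (q q' t : R) :
  measurable_fun (plane @^-1` unit_disc : set T2) (f \o plane) ->
  (forall z, (0 <= f z)%E) -> 0 <= q -> q <= q' -> (sectr f q' t <= sectr f q t)%E.
Proof.
move=> mf f0 q0 qq; have q'0 := le_trans q0 qq.
rewrite /sectr [leLHS]integral_indic_mul [leRHS]integral_indic_mul; apply: ge0_le_integral => //.
- move=> r _; rewrite mule_indic; case: ifP => //; rewrite inE /= in_itv /= => /andP[h _].
  by apply: mule_ge0 => //; rewrite lee_fin ltW// (le_lt_trans q'0).
- exact: measurable_sectr_integrand.
- exact: measurable_sectr_integrand.
move=> r _; rewrite !mule_indic; case: ifPn => [|_].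
  rewrite inE /= in_itv /= => /andP[h1 h2].
  by rewrite mem_set//= in_itv /= h2 (le_lt_trans qq).
case: ifP => //; rewrite inE /= in_itv /= => /andP[h _].
by apply: mule_ge0 => //; rewrite lee_fin ltW// (le_lt_trans q0).
Qed.

Variable w : C -> R.
Hypothesis hw : continuous_radial_weight w.

(** After the substitution of [r * z] by [z] the weight is taken at a larger
    radius, and [star] is nonincreasing; the two powers of [r^-1] from the area
    element are at most [4]. *)
Lemma sectr_dilate (phi : C -> C) (r q t : R) : poly_limit phi ->
  2^-1 <= r < 1 -> 0 <= q ->
  (sectr (density w (dilate r phi)) q t <= 4%:E * sectr (density w phi) (r * q) t)%E.
Proof.
move=> hphi /andP[r2 r1] q0.
have r0 : 0 < r by lra.
have rq0 : 0 <= r * q by rewrite mulr_ge0// ltW.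
have hd : poly_limit (dilate r phi) by apply: poly_limit_dilate => //; rewrite !ltW.
have m1 := measurable_density hw hd; have m2 := measurable_density hw hphi.
have d0 (psi : C -> C) z : (0 <= density w psi z)%E by exact: density_ge0.
have mh := @measurable_sectr_integrand (density w (dilate r phi)) q m1 q0 t.
have mg := @measurable_sectr_integrand (density w phi) (r * q) m2 rq0 t.
set h := (fun x : R => _) in mh; set g := (fun x : R => _) in mg.
have h0 x : (0 <= h x)%E.
  rewrite /h mule_indic; case: ifP => //; rewrite inE /= in_itv /= => /andP[h1 _].
  by apply: mule_ge0 => //; rewrite lee_fin ltW// (le_lt_trans q0).
have g0 x : (0 <= g x)%E.
  rewrite /g mule_indic; case: ifP => //; rewrite inE /= in_itv /= => /andP[h1 _].
  by apply: mule_ge0 => //; rewrite lee_fin ltW// (le_lt_trans rq0).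
have ri0 : 0 < r^-1 by rewrite invr_gt0.
rewrite /sectr [leLHS]integral_indic_mul -/h [X in (_ * X)%E]integral_indic_mul -/g.
rewrite (ge0_integral_scale ri0 mh h0) -ge0_integralZl//; last by move=> x _; exact: g0.
apply: ge0_le_integral => //.
- by move=> x _; apply: mule_ge0; [exact: h0|rewrite lee_fin ltW].
- apply: emeasurable_funM => //; apply: (measurableT_comp mh); exact: measurable_funM.
- exact: emeasurable_funM.
move=> x _; rewrite /h mule_indic; case: ifPn => [|_]; last by rewrite mul0e; apply: mule_ge0 => //; exact: g0.
rewrite inE /= in_itv /= => /andP[x1 x2].
have xq : r * q < x by rewrite -ltr_pdivlMl.
have xr : x < r by rewrite -[r]mulr1 -ltr_pdivrMl.
have x0 : 0 < x by apply: le_lt_trans xq.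
rewrite /g mule_indic mem_set; last by rewrite /= in_itv /= xq (lt_trans xr).
have e1 : dilate r phi (ofR (r^-1 * x) * cis t) = phi (ofR x * cis t).
  by rewrite /dilate mulrA -ofRM mulrA divff ?gt_eqF// mul1r.
have rx0 : 0 < r^-1 * x by rewrite mulr_gt0.
rewrite /density e1 !wstarE (modulus_polar t (ltW x0)) (modulus_polar t (ltW rx0)).
have sx : (star w (r^-1 * x) <= star w x)%E.
  apply: (star_nonincreasing hw) => //.
  have r1i : 1 <= r^-1 by rewrite invf_ge1// ltW.
  by have := ler_wpM2r (ltW x0) r1i; rewrite mul1r.
have s0 := star_ge0 hw (ltW x0).
set m := modulus _ ^+ 2; have m0 : 0 <= m by exact: sqr_ge0.
clearbody m.
rewrite -!muleA -EFinM.
rewrite (_ : 4%:E * _ = m%:E * (star w x * (4 * x)%:E))%E; last first.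
  by rewrite EFinM (muleCA 4%:E m%:E) (muleCA 4%:E (star w x)).
apply: lee_wpmul2l; first by rewrite lee_fin.
apply: lee_pmul => //.
- by apply: (star_ge0 hw); exact: ltW.
- by rewrite lee_fin mulr_ge0// ltW.
rewrite lee_fin mulrAC; apply: ler_wpM2r; first exact: ltW.
have i2 : r^-1 <= 2 by rewrite invf_ple ?posrE.
by have := ler_pM (ltW ri0) (ltW ri0) i2 i2; lra.
Qed.

Lemma sect_sectr f l t : sect f l t = sectr f (inner_radius l) t.
Proof. by []. Qed.

(** When [1 - r <= l] the dilation moves the points of the square by at most
    [l], so that they stay in the square of twice the length. *)
Lemma energy_dilate_large (phi : C -> C) (r l : R) (I : set C) : poly_limit phi ->
  arc_of_length I l -> l <= 4^-1 -> 2^-1 <= r < 1 -> 1 - r <= l ->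
  exists I' : set C, arc_of_length I' (2 * l) /\
  (energy w (dilate r phi) (carleson_square I l) <=
   4%:E * energy w phi (carleson_square I' (2 * l)))%E.
Proof.
move=> hphi [/andP[l0 l2] [a [J [J1 J2 ->]]]] l4 r12 rl.
have [r2 r1] := andP r12; have r0 : 0 < r by lra.
have pi2 := @pi_ge2 R.
have hd : poly_limit (dilate r phi) by apply: poly_limit_dilate => //; rewrite !ltW.
have m1 := measurable_density hw hd; have m2 := measurable_density hw hphi.
have d0 (psi : C -> C) z : (0 <= density w psi z)%E by exact: density_ge0.
have d0' (psi : C -> C) z : unit_disc z -> (0 <= density w psi z)%E by move=> _.
have ll0 : 0 < 2 * l by lra.
have ll2 : 2 * l <= 2 * pi by lra.
have J1' : `]a, (a + 2 * l)[ `<=` (`[a, (a + 2 * l)] : set R).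
  by apply: subset_itv; rewrite bnd_simp.
exists (cis @` `[a, (a + 2 * l)]); split.
  by split; [rewrite ll0|exists a, `[a, (a + 2 * l)]%classic; split].
rewrite /energy (sector_integral l0 l2 J1 J2 m1 (d0' _)).
rewrite (sector_integral ll0 ll2 J1' (@subset_refl _ _) m2 (d0' _)).
rewrite muleCA; apply: lee_wpmul2l; first by rewrite lee_fin invr_ge0 pi_ge0.
have i1 : inner_radius l = 1 - l by apply: inner_radius_small; lra.
have i2 : inner_radius (2 * l) = 1 - 2 * l by apply: inner_radius_small; lra.
have q1 : 0 <= inner_radius l := inner_radius_ge0 l.
have q2 : 0 <= inner_radius (2 * l) := inner_radius_ge0 (2 * l).
have ms1 := measurable_sectr m1 (d0 _) q1.
have ms2 := measurable_sectr m2 (d0 _) q2.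
rewrite -ge0_integralZl//; last 2 first.
- exact: (measurable_funTS ms2).
- by move=> t _; exact: sectr_ge0.
apply: (@le_trans _ _ (\int[mu]_(t in `]a, (a + l)%R[) (4%:E * sectr (density w phi) (inner_radius (2 * l)) t))%E).
  apply: ge0_le_integral => //.
  - by move=> t _; exact: sectr_ge0.
  - exact: (measurable_funTS ms1).
  - by apply: emeasurable_funM => //; exact: measurable_funTS.
  - move=> t _; rewrite sect_sectr; apply: le_trans (sectr_dilate t hphi r12 q1) _.
    apply: lee_wpmul2l => //; apply: sectr_nonincreasing => //.
    rewrite i1 i2; nra.
apply: ge0_subset_integral => //.
- by apply: emeasurable_funM => //; exact: measurable_funTS.
- by move=> t _; apply: mule_ge0 => //; exact: sectr_ge0.
- by apply: subset_itv; rewrite bnd_simp; lra.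
Qed.

End annuli.

Section small_squares.
Context {R : realType}.
Local Notation mu := (@lebesgue_measure R).
Local Notation T2 := (measurableTypeR R * measurableTypeR R)%type.
Local Notation C := (Cplx R).
Local Arguments modulus : simpl never.
Local Arguments plane : simpl never.

Lemma atan_le (x : R) : 0 <= x -> 0 <= atan x <= x.
Proof.
rewrite le_eqVlt => /predU1P[<-|x0]; first by rewrite atan0 lexx.
have [c _] := @MVT R (@atan R) (fun x => (1 + x ^+ 2)^-1) 0 x x0
  (fun y _ => is_derive1_atan y) (continuous_subspaceT (@continuous_atan R)).
rewrite atan0 !subr0 => ->.
have c1 : 1 <= 1 + c ^+ 2 by rewrite lerDl sqr_ge0.
have c0 : 0 < 1 + c ^+ 2 by rewrite (lt_le_trans _ c1).
have i0 : 0 < (1 + c ^+ 2)^-1 by rewrite invr_gt0.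
have i1 : (1 + c ^+ 2)^-1 <= 1 by rewrite invf_le1.
by apply/andP; split; nra.
Qed.

Lemma arg0_le (z : C) : 0 < complex.Re z ->
  `|arg0 z| <= `|complex.Im z| / complex.Re z.
Proof.
move=> re0; have m0 : complex.Re z <= modulus z.
  by apply: le_trans (Re_le_modulus z); exact: ler_norm.
have s0 : 0 < modulus z + complex.Re z by lra.
rewrite /arg0 normrM (ger0_norm (_ : 0 <= 2))//.
set x := complex.Im z / _.
have ax : `|atan x| <= `|x|.
  have [x0|x0] := leP 0 x.
    by have /andP[a1 a2] := atan_le x0; rewrite !ger0_norm.
  have /andP[a1 a2] := @atan_le (- x) ltac:(rewrite oppr_ge0; exact: ltW).
  by rewrite -normrN -atanN ger0_norm// ltr0_norm.
have xE : `|x| = `|complex.Im z| / (modulus z + complex.Re z).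
  by rewrite /x normrM normfV (gtr0_norm s0).
have i0 := normr_ge0 (complex.Im z).
rewrite ler_pdivlMr// in ax *.
have : `|x| * (modulus z + complex.Re z) = `|complex.Im z| by rewrite xE divfK// gt_eqF.
have x0 := normr_ge0 x; nra.
Qed.

(** Seen from the origin the disc has half-width [arg0] at most [h], so that an
    angle of [3 * h] contains it. *)
Lemma disc_in_square (rho t h : R) : 0 < h -> h <= 8^-1 ->
  1 - 2 * h <= rho -> rho <= 1 - h ->
  disc (ofR rho * cis t) (h / 4) `<=`
   carleson_square (cis @` `[(t - 3 * h / 2), (t - 3 * h / 2 + 3 * h)]) (3 * h)
   `&` [set z | 0 < modulus z <= 1 - h / 2].
Proof.
move=> h0 h8 r1 r2 z; rewrite /disc /= => hz.
have rho0 : 0 < rho by lra.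
pose y := z * cis (- t).
have my : modulus y = modulus z by rewrite modulusM modulus_cis mulr1.
have zy : z = y * cis t by rewrite /y -mulrA -cisD addNr cis0 mulr1.
have hy : modulus (y - ofR rho) < h / 4.
  move: hz; rewrite {1}zy -mulrBl modulusM modulus_cis mulr1.
  exact.
clearbody y.
have mz1 : modulus z <= modulus (y - ofR rho) + rho.
  have := modulusD (y - ofR rho) (ofR rho); rewrite subrK my modulus_ofR gtr0_norm//.
have mz2 : rho <= modulus (y - ofR rho) + modulus z.
  have := modulusD (ofR rho - y) y; rewrite subrK my modulus_ofR gtr0_norm//.
  by rewrite modulus_dist.
have yR : rho - h / 4 < complex.Re y.
  have := le_lt_trans (Re_le_modulus (y - ofR rho)) hy.
  by rewrite ReB /= ltr_norml => /andP[]; lra.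
have yI : `|complex.Im y| < h / 4.
  have := le_lt_trans (Im_le_modulus (y - ofR rho)) hy.
  by rewrite ImB /= subr0.
have re0 : 0 < complex.Re y by lra.
have s0 : 0 < modulus y + complex.Re y by have := modulus_ge0 y; lra.
have [yE _] := arg0P s0.
have ay : `|arg0 y| <= h.
  apply: le_trans (arg0_le re0) _; rewrite ler_pdivrMr//.
  by have := normr_ge0 (complex.Im y); nra.
split; last by apply/andP; split; lra.
exists (modulus z), (t + arg0 y); split.
- by rewrite {1}zy {1}yE my -mulrA -cisD addrC.
- exists (t + arg0 y) => //; rewrite /= in_itv /=.
  by move: ay; rewrite ler_norml => /andP[a1 a2]; apply/andP; split; lra.
- exact: modulus_ge0.
- by apply/andP; split; lra.
Qed.

Variable w : C -> R.
Hypothesis hw : continuous_radial_weight w.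

(** The mean value inequality over a disc of radius [h / 4]. On this disc the
    weight is at least [h / 4 * tail w (1 - h / 4)], by doubling comparable with
    the mass of a square of length [3 * h] around it, and so the mean of
    [modulus phi ^ 2] over the disc is at most of order [e / h ^ 2]. *)
Lemma carleson_pointwise (phi : C -> C) (h e D : R) (u : C) : poly_limit phi ->
  0 < h -> h <= 16^-1 -> 0 <= e ->
  (forall I, arc_of_length I (3 * h) ->
     (energy w phi (carleson_square I (3 * h)) <= (e * mass w (3 * h))%:E)%E) ->
  tail w (1 - 3 * h) <= D * tail w (1 - h / 4) ->
  1 - 2 * h <= modulus u -> modulus u <= 1 - h ->
  modulus (phi u) ^+ 2 <= 1536 * D * e / h ^+ 2.
Proof.
move=> hphi h0 h16 e0 hI hD u1 u2.
have [t [uE _]] := arg0_rotated u 0.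
have sub := @disc_in_square (modulus u) t h h0 ltac:(lra) u1 u2.
rewrite -uE in sub.
set J := (_ @` _) in sub.
have aJ : arc_of_length J (3 * h).
  have p2 := @pi_ge2 R; split; first by apply/andP; split; lra.
  exists (t - 3 * h / 2), (`[(t - 3 * h / 2), (t - 3 * h / 2 + 3 * h)]%classic); split=> //.
  by apply: subset_itv; rewrite bnd_simp.
have mphi := measurable_poly_limit hphi.
have mDs := measurable_disc u (h / 4).
have SD := @square_sub_disc R J (3 * h).
have DD : disc u (h / 4) `<=` unit_disc by move=> z /sub[/SD].
have mden := measurable_density hw hphi.
have t1 : 0 < tail w (1 - h / 4) by apply: (tail_gt0 hw); lra.
have t3 : 0 < tail w (1 - 3 * h) by apply: (tail_gt0 hw); lra.
pose c := h / 4 * tail w (1 - h / 4).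
have c0 : 0 < c by rewrite mulr_gt0// divr_gt0.
have cstar z : disc u (h / 4) z -> (c%:E <= wstar w z)%E.
  move=> /sub[_ /= /andP[z0 z1]]; rewrite wstarE.
  apply: le_trans (star_nonincreasing hw z0 z1 _); last by lra.
  have := @star_ge_tail R w hw (1 - h / 2) ltac:(apply/andP; split; lra).
  apply: le_trans; rewrite lee_fin /c le_eqVlt; apply/orP; left; apply/eqP.
  by congr (_ * tail w _); field.
set K := (\int[(mu \x mu)%E]_(p in plane @^-1` disc u (h / 4)) (modulus (phi (plane p)) ^+ 2)%:E)%E.
have mphiD : measurable_fun (plane @^-1` disc u (h / 4) : set T2)
    (fun p => (modulus (phi (plane p)) ^+ 2)%:E : \bar R).
  by apply/measurable_EFinP; apply: measurable_funS mphi; [exact: measurable_unit_disc|move=> p /DD].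
have cK : (c%:E * K <= (pi * (e * mass w (3 * h)))%:E)%E.
  apply: (@le_trans _ _ (pi%:E * energy w phi (disc u (h / 4)))%E).
    rewrite /energy /area_integral ge0_integral_mscale//; last 2 first.
    - by apply: measurable_funS mden; [exact: measurable_unit_disc|move=> p /DD].
    - by move=> p _; exact: density_ge0.
    rewrite /= muleA -EFinM divff ?gt_eqF ?pi_gt0// mul1e.
    rewrite /K -ge0_integralZl//; last 2 first.
    - by move=> p _; rewrite lee_fin sqr_ge0.
    - by rewrite lee_fin ltW.
    apply: ge0_le_integral => //.
    - by move=> p _; rewrite -EFinM lee_fin; apply: mulr_ge0; [exact: ltW|exact: sqr_ge0].
    - exact: emeasurable_funM.
    - by apply: measurable_funS mden; [exact: measurable_unit_disc|move=> p /DD].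
    - move=> p hp; rewrite /density /= muleC; apply: lee_wpmul2l; first by rewrite lee_fin sqr_ge0.
      exact: cstar.
  rewrite EFinM; apply: lee_wpmul2l; first by rewrite lee_fin pi_ge0.
  apply: le_trans (hI J aJ); apply: area_integral_subset => //.
  - exact: square_measurable.
  - by move=> z /sub[].
  - by move=> z _; exact: density_ge0.
have m3 : pi * (e * mass w (3 * h)) = e * (3 * h * tail w (1 - 3 * h)).
  have pn0 : (pi : R) != 0 by rewrite gt_eqF ?pi_gt0.
  rewrite /mass inner_radius_small; last by lra.
  by rewrite mulrCA; congr (_ * _); rewrite mulrA divff// mul1r.
rewrite m3 in cK.
have KB : (K <= (12 * D * e)%:E)%E.
  have : (K <= (c^-1 * (e * (3 * h * tail w (1 - 3 * h))))%:E)%E.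
    by rewrite EFinM lee_pdivlMl.
  move/le_trans; apply; rewrite lee_fin ler_pdivrMl// /c.
  have -> : h / 4 * tail w (1 - h / 4) * (12 * D * e) =
     e * (3 * h * (D * tail w (1 - h / 4))) by field.
  by apply: ler_wpM2l => //; apply: ler_wpM2l => //; lra.
have := @poly_limit_disc_mean R phi u (h / 4) hphi ltac:(lra) ltac:(lra).
rewrite -/K => /le_trans /(_ (lee_wpmul2l _ KB)); rewrite lee_fin => /(_ (ler0n _ _)).
rewrite -EFinM lee_fin => hh.
have p1 : 1 <= pi :> R by have := @pi_ge2 R; lra.
have f0 := sqr_ge0 (modulus (phi u)).
rewrite ler_pdivlMr ?exprn_gt0//.
have : modulus (phi u) ^+ 2 * h ^+ 2 <= pi * (modulus (phi u) ^+ 2 * h ^+ 2).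
  by rewrite ler_peMl// mulr_ge0// sqr_ge0.
move/le_trans; apply.
have -> : pi * (modulus (phi u) ^+ 2 * h ^+ 2) = 16 * (pi * modulus (phi u) ^+ 2 * (h / 4) ^+ 2) by field.
lra.
Qed.

(** When [l <= h] the dilated function sees points at distance between [h] and
    [2 * h] from the circle, where it is bounded by [carleson_pointwise]; then
    [wstar_square_small] gives the factor [l ^+ 2 / h ^+ 2 <= 1]. *)
Lemma energy_dilate_small (phi : C -> C) (h l e D : R) (I : set C) : poly_limit phi ->
  0 < h -> h <= 16^-1 -> 0 <= e -> 0 <= D ->
  (forall I, arc_of_length I (3 * h) ->
     (energy w phi (carleson_square I (3 * h)) <= (e * mass w (3 * h))%:E)%E) ->
  tail w (1 - 3 * h) <= D * tail w (1 - h / 4) ->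
  arc_of_length I l -> l <= h ->
  (energy w (dilate (1 - h) phi) (carleson_square I l) <= (3072 * D * e * mass w l)%:E)%E.
Proof.
move=> hphi h0 h16 e0 D0 hI hD aI lh.
have l0 := arc_gt0 aI.
have hd : poly_limit (dilate (1 - h) phi) by apply: poly_limit_dilate => //; apply/andP; split; lra.
have B0 : 0 <= 1536 * D * e / h ^+ 2.
  by apply: divr_ge0; [exact: mulr_ge0 (mulr_ge0 (ler0n _ _) D0) e0|exact: sqr_ge0].
apply: le_trans (@energy_le_bound R w hw _ _ _ (square_measurable aI) (@square_sub_disc R I l) hd B0 _) _.
  move=> z hz; apply: (carleson_pointwise hphi h0 h16 e0 hI hD).
    case: hz => r [t [-> _ r0 /andP[r1 r2]]].
    rewrite modulusM modulus_ofR modulus_polar// ger0_norm; last lra.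
    nra.
  case: hz => r [t [-> _ r0 /andP[r1 r2]]].
  rewrite modulusM modulus_ofR modulus_polar// ger0_norm; last lra.
  nra.
apply: le_trans (lee_wpmul2l _ (wstar_square_small hw aI _)) _; rewrite ?lee_fin//; first lra.
have m0 := mass_gt0 hw l0.
have lh2 : l ^+ 2 <= h ^+ 2 by rewrite ler_pXn2r ?nnegrE// ltW.
have -> : 1536 * D * e / h ^+ 2 * (2 * l ^+ 2 * mass w l) =
  3072 * D * e * mass w l * (l ^+ 2 / h ^+ 2) by field; rewrite gt_eqF.
have q1 : l ^+ 2 / h ^+ 2 <= 1 by rewrite ler_pdivrMr ?mul1r// exprn_gt0.
have k0 := mulr_ge0 (mulr_ge0 (mulr_ge0 (ler0n R 3072) D0) e0) (ltW m0).
exact: ler_piMr.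
Qed.

End small_squares.

Section dilation_total.
Context {R : realType}.
Local Notation mu := (@lebesgue_measure R).
Local Notation T2 := (measurableTypeR R * measurableTypeR R)%type.
Local Notation C := (Cplx R).
Local Arguments modulus : simpl never.
Local Arguments plane : simpl never.

Lemma annulus_sub_disc q : annulus q `<=` (unit_disc : set C).
Proof. by move=> z /andP[]. Qed.

Lemma annulus_polar (f : C -> \bar R) (q : R) :
  measurable_fun (plane @^-1` unit_disc : set T2) (f \o plane) ->
  (forall z, (0 <= f z)%E) -> 0 <= q ->
  area_integral (annulus q) f =
  ((pi^-1)%:E * \int[mu]_(t in `[0%R, (0 + 2 * pi)%R[) sectr f q t)%E.
Proof.
move=> mf f0 q0; have mA := measurable_annulus q.
rewrite /area_integral ge0_integral_mscale//; last first.
  by apply: measurable_funS mf; [exact: measurable_unit_disc|move=> p /annulus_sub_disc].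
congr (_ * _)%E.
rewrite integral_mkcond (full_polar 0 (measurable_annular q mf) (annular_ge0 q f0)).
by apply: eq_integral => t _; rewrite sectr_ray.
Qed.

Variable w : C -> R.
Hypothesis hw : continuous_radial_weight w.

Lemma energy_dilate_annulus (phi : C -> C) (r q : R) : poly_limit phi ->
  2^-1 <= r < 1 -> 0 <= q ->
  (energy w (dilate r phi) (annulus q) <= 4%:E * energy w phi (annulus (r * q)))%E.
Proof.
move=> hphi r12 q0; have [r2 r1] := andP r12; have r0 : 0 < r by lra.
have rq0 : 0 <= r * q by rewrite mulr_ge0// ltW.
have hd : poly_limit (dilate r phi) by apply: poly_limit_dilate => //; rewrite !ltW.
have m1 := measurable_density hw hd; have m2 := measurable_density hw hphi.
have d0 (psi : C -> C) z : (0 <= density w psi z)%E by exact: density_ge0.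
rewrite /energy !annulus_polar// muleCA.
apply: lee_wpmul2l; first by rewrite lee_fin invr_ge0 pi_ge0.
have ms1 := measurable_sectr m1 (d0 _) q0.
have ms2 := measurable_sectr m2 (d0 _) rq0.
rewrite -ge0_integralZl//; last 2 first.
- exact: (measurable_funTS ms2).
- by move=> t _; exact: sectr_ge0.
apply: ge0_le_integral => //.
- by move=> t _; exact: sectr_ge0.
- exact: (measurable_funTS ms1).
- by apply: emeasurable_funM => //; exact: measurable_funTS.
- by move=> t _; exact: sectr_dilate.
Qed.

Definition closed_disc (q : R) : set C := [set z | modulus z <= q].

Lemma measurable_closed_disc q : measurable (plane @^-1` closed_disc q : set T2).
Proof.
have := @measurable_preimage_itv R _ `]-oo, q] (@measurable_modulus R).
by congr measurable; apply/seteqP; split => p; rewrite /= in_itv.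
Qed.

Lemma disc_split (f : C -> \bar R) q :
  measurable_fun (plane @^-1` unit_disc : set T2) (f \o plane) ->
  (forall z, (0 <= f z)%E) -> q < 1 ->
  (area_integral unit_disc f = area_integral (closed_disc q) f + area_integral (annulus q) f)%E.
Proof.
move=> mf f0 q1; rewrite /area_integral.
have -> : plane @^-1` unit_disc = (plane @^-1` closed_disc q `|` plane @^-1` annulus q) :> set T2.
  apply/seteqP; split => [p|p []]; rewrite /unit_disc /closed_disc /annulus /=.
  - by move=> p1; case: (leP (modulus (plane p)) q) => h; [left|right].
  - by move=> h; exact: le_lt_trans q1.
  - by case/andP.
rewrite ge0_integral_setU//.
- exact: measurable_closed_disc.
- exact: measurable_annulus.
- apply: measurable_funS mf; first exact: measurable_unit_disc.
  by move=> p [h|/andP[]//]; exact: le_lt_trans q1.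
- by apply/disj_setPS => p [/= h /andP[h' _]]; move: h' ; rewrite ltNge h.
Qed.

(** Monotone convergence on the discs exhausting the unit disc. *)
Lemma energy_annulus_small (phi : C -> C) (e : R) : poly_limit phi -> 0 < e ->
  (energy w phi unit_disc < +oo)%E ->
  exists q, 0 <= q < 1 /\ (energy w phi (annulus q) <= e%:E)%E.
Proof.
move=> hphi e0 fin; have m := measurable_density hw hphi.
have d0 z : (0 <= density w phi z)%E by exact: density_ge0.
pose q (n : nat) : R := 1 - n.+1%:R^-1.
have q1 n : q n < 1 by rewrite /q ltrBlDr ltrDl invr_gt0.
have q0 n : 0 <= q n by rewrite /q subr_ge0 invf_le1// ler1n.
pose F n : set T2 := plane @^-1` closed_disc (q n).
have sub n : F n `<=` plane @^-1` unit_disc by move=> p h; exact: le_lt_trans (q1 n).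
have FU : \bigcup_n F n = plane @^-1` unit_disc.
  apply/seteqP; split => [p [n _]|p]; first exact: sub.
  rewrite /unit_disc /= => p1; have [n hn] := ltr_add_invr p1.
  by exists n => //; rewrite /F /closed_disc /= /q lerBrDr; exact: ltW.
have mono : nondecreasing_seq F.
  apply/nondecreasing_seqP => n; rewrite subsetEset => p /= h; apply: le_trans h _.
  rewrite /q lerD2l lerN2 lef_pV2 ?posrE//; by rewrite ler_nat.
have cv := @ge0_nondecreasing_set_cvg_integral _ _ _ F (density w phi \o plane) (@dA R) mono
  (fun n => measurable_closed_disc (q n)) (fun n => measurable_funS measurable_unit_disc (sub n) m)
  (fun n p _ => d0 (plane p)).
rewrite FU in cv.
have I0 : (0 <= energy w phi unit_disc)%E by apply: integral_ge0 => p _; exact: d0.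
have IE : energy w phi unit_disc = (fine (energy w phi unit_disc))%:E.
  by rewrite fineK// ge0_fin_numE.
set I := fine _ in IE.
have splitn n := disc_split m d0 (q1 n).
have part n : (0 <= area_integral (closed_disc (q n)) (density w phi))%E.
  by apply: integral_ge0 => p _; exact: d0.
have partA n : (0 <= area_integral (annulus (q n)) (density w phi))%E.
  by apply: integral_ge0 => p _; exact: d0.
have Ie : ((I - e)%:E < energy w phi unit_disc)%E by rewrite IE lte_fin; lra.
have [n hn] : exists n, ((I - e)%:E < energy w phi (closed_disc (q n)))%E.
  have : \forall n \near \oo, ((I - e)%:E < energy w phi (closed_disc (q n)))%E.
    exact: (cv [set x | ((I - e)%:E < x)%E] (open_ereal_gt' Ie)).
  by case=> N _ hN; exists N; apply: hN => /=.
exists (q n); split; first by rewrite q0 q1.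
have := splitn n; rewrite -/(energy w phi unit_disc) IE.
rewrite -/(energy w phi (closed_disc (q n))) -/(energy w phi (annulus (q n))).
have := part n; have := partA n; move: hn; rewrite -/(energy _ _ _) -/(energy w phi (annulus (q n))).
case: (energy w phi (closed_disc (q n))) => [x||] //; case: (energy w phi (annulus (q n))) => [y||] //.
by rewrite -EFinD lte_fin => h _ _ [h']; rewrite lee_fin; lra.
Qed.

(** Both bounds are proved together, as the induction step for the second uses
    the first. *)
Lemma poly_dilate_lipschitz (P : {poly C}) : exists2 K : R, 0 <= K &
  forall z r, modulus z <= 1 -> 0 <= r <= 1 ->
  modulus P.[z] <= K /\ modulus (P.[z] - P.[ofR r * z]) <= K * (1 - r).
Proof.
elim/poly_ind: P => [|P c [K K0 hK]].
  by exists 0 => // z r _ _; rewrite !horner0 subrr modulus0 mul0r.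
exists (2 * K + modulus c); first by rewrite addr_ge0 ?modulus_ge0// mulr_ge0.
move=> z r z1 r01; have [r0 r1] := andP r01; have [h1 h2] := hK z r z1 r01.
have rz : modulus (ofR r * z) <= 1.
  by rewrite modulusM modulus_ofR ger0_norm//; have := modulus_ge0 z; nra.
have [h3 _] := hK _ r rz r01.
have c0 := modulus_ge0 c; have z0 := modulus_ge0 z.
rewrite !hornerMXaddC; split.
  apply: le_trans (modulusD _ _) _; rewrite modulusM; have := modulus_ge0 P.[z]; nra.
rewrite (_ : _ - _ = (P.[z] - P.[ofR r * z]) * z + P.[ofR r * z] * z * ofR (1 - r)); last first.
  by rewrite ofRB ofR1; ring.
apply: le_trans (modulusD _ _) _; rewrite !modulusM modulus_ofR ger0_norm ?subr_ge0//.
have a0 := modulus_ge0 (P.[z] - P.[ofR r * z]); have b0 := modulus_ge0 P.[ofR r * z].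
have k1 : modulus (P.[z] - P.[ofR r * z]) * modulus z <= K * (1 - r).
  by rewrite -[leRHS]mulr1; apply: ler_pM.
have k2 : modulus P.[ofR r * z] * modulus z <= K by rewrite -[leRHS]mulr1; apply: ler_pM.
have k3 : modulus P.[ofR r * z] * modulus z * (1 - r) <= K * (1 - r).
  by apply: ler_wpM2r => //; lra.
have k4 : 0 <= modulus c * (1 - r) by apply: mulr_ge0 => //; lra.
lra.
Qed.

(** Inside a smaller disc [phi] is uniformly close to a polynomial, hence to its
    dilates; in the remaining annulus both [phi] and its dilates have little
    energy. *)
Lemma energy_total_dilate (phi : C -> C) (e : R) : poly_limit phi -> 0 < e ->
  (energy w phi unit_disc < +oo)%E ->
  exists2 d, 0 < d & forall r, 1 - d < r < 1 ->
  (energy w (fun z => phi z - ofR r * dilate r phi z)%R unit_disc <= e%:E)%E.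
Proof.
move=> hphi e0 fin.
have [q0 [/andP[q00 q01] hq0]] := energy_annulus_small hphi (ltac:(lra) : 0 < e / 20) fin.
pose q := (1 + q0) / 2.
have q1 : q < 1 by rewrite /q; lra.
have qp : 0 < q by rewrite /q; lra.
have qq : q0 <= q by rewrite /q; lra.
have qE : q0 + (1 - q0) / 2 = q by rewrite /q; field.
clearbody q.
have T0 : 0 < tail w 0 by apply: (tail_gt0 hw).
set T := tail w 0 in T0.
pose e1 := Num.sqrt (e / (64 * T)).
have T64 : 0 < 64 * T by rewrite mulr_gt0.
have e1E : e1 ^+ 2 = e / (64 * T) by rewrite sqr_sqrtr// divr_ge0// ltW.
have e10 : 0 < e1 by rewrite sqrtr_gt0 divr_gt0.
(* [e1] is such that [(4 * e1) ^+ 2 * (2 * T) = e / 2] *)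
have [P hP] := hphi q e1 qp q1 e10.
have [K K0 hK] := poly_dilate_lipschitz P.
have K1 : 0 < K + 1 by lra.
have de : 0 < e1 / (2 * (K + 1)) by rewrite divr_gt0// mulr_gt0.
exists (Num.min (Num.min 2^-1 ((1 - q0) / 2)) (e1 / (2 * (K + 1)))).
  by rewrite !lt_min de andbT; apply/andP; split; lra.
move=> r /andP[+ r1]; rewrite ltrBlDr addrC -ltrBlDr !lt_min => /andP[/andP[rh rq] rK].
have r0 : 0 < r by lra.
have r12 : 2^-1 <= r < 1 by apply/andP; split; lra.
have r01 : 0 <= r <= 1 by apply/andP; split; lra.
have hd : poly_limit (dilate r phi) by exact: poly_limit_dilate.
have hrd : poly_limit (fun z => ofR r * dilate r phi z) by exact: poly_limit_ext (poly_limitZ r01 hd).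
have hdiff := poly_limitB hphi hrd.
have m := measurable_density hw hdiff.
rewrite /energy (disc_split m (density_ge0 hw _) q1) -!/(energy _ _ _).
have -> : e = e / 2 + e / 2 by field.
rewrite EFinD; apply: leeD; last first.
  apply: le_trans (energy_le_sum hw (measurable_annulus q) (@annulus_sub_disc q) hdiff hphi hd _) _.
    move=> z _; apply: le_trans (modulusB _ _) _; rewrite lerD2l modulusM modulus_ofR gtr0_norm//.
    by have := modulus_ge0 (dilate r phi z); nra.
  have sub q' : q0 <= q' -> (energy w phi (annulus q') <= (e / 20)%:E)%E.
    move=> hq'; apply: le_trans hq0; apply: area_integral_subset.
    - exact: measurable_annulus.
    - exact: measurable_annulus.
    - by move=> z /andP[z1 z2]; rewrite /annulus /= z2 (le_lt_trans hq').
    - exact: annulus_sub_disc.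
    - exact: measurable_density.
    - by move=> z _; exact: density_ge0.
  have s1 := sub q qq.
  have s2 : (energy w phi (annulus (r * q)) <= (e / 20)%:E)%E by apply: sub; nra.
  have s3 := energy_dilate_annulus hphi r12 (ltW qp).
  have s4 := le_trans s3 (lee_wpmul2l _ s2); rewrite lee_fin in s4.
  apply: (@le_trans _ _ (2%:E * (e / 20)%:E + 2%:E * (4%:E * (e / 20)%:E))%E).
    by apply: leeD; apply: lee_wpmul2l => //; exact: s4.
  by rewrite -!EFinM -EFinD lee_fin; lra.
have B0 : 0 <= (4 * e1) ^+ 2 by exact: sqr_ge0.
have cd : closed_disc q `<=` unit_disc by move=> z h; exact: le_lt_trans q1.
apply: le_trans (energy_le_bound hw (measurable_closed_disc q) cd hdiff B0 _) _.
  move=> z hz; rewrite ler_pXn2r ?nnegrE ?modulus_ge0//; last by lra.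
  have z0 := modulus_ge0 z.
  have rzq : modulus (ofR r * z) <= q.
    by rewrite modulusM modulus_ofR gtr0_norm//; rewrite /closed_disc /= in hz; nra.
  have a1 := hP _ hz; have a2 := hP _ rzq.
  have [_ a3] := hK z r (ltW (cd _ hz)) r01.
  have [a4 _] := hK (ofR r * z) r (le_trans rzq (ltW q1)) r01.
  rewrite /dilate (_ : phi z - ofR r * phi (ofR r * z) =
     (phi z - P.[z]) + (P.[z] - P.[ofR r * z]) - (phi (ofR r * z) - P.[ofR r * z]) * ofR r
      + P.[ofR r * z] * ofR (1 - r)); last by rewrite ofRB ofR1; ring.
  apply: le_trans (modulusD _ _) _; apply: le_trans (lerD (modulusB _ _) (lexx _)) _.
  apply: le_trans (lerD (lerD (modulusD _ _) (lexx _)) (lexx _)) _.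
  rewrite !modulusM !modulus_ofR (gtr0_norm r0) (ger0_norm (_ : 0 <= 1 - r)); last by lra.
  have b1 : modulus (phi (ofR r * z) - P.[ofR r * z]) * r <= e1.
    by have := modulus_ge0 (phi (ofR r * z) - P.[ofR r * z]); nra.
  have b2 : modulus P.[ofR r * z] * (1 - r) <= K * (1 - r) by apply: ler_wpM2r => //; lra.
  have b3 : (1 - r) * (2 * (K + 1)) <= e1 by rewrite -ler_pdivlMr ?mulr_gt0// ltW// ; lra.
  nra.
have af := @arc_full R.
have full : arc_of_length (cis @` `[0, (0 + 2 * pi)] : set C) (2 * pi).
  split; first by rewrite lexx pi2_gt0.
  by exists 0, (`[0, (0 + 2 * pi)]%classic); split.
have := wstar_square_total hw full; rewrite full_square => tot.
apply: (@le_trans _ _ (((4 * e1) ^+ 2)%:E * (pi^-1 * (2 * pi * T))%:E)%E).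
  apply: lee_wpmul2l; first by rewrite lee_fin.
  apply: le_trans tot; apply: area_integral_subset => //.
  - exact: measurable_closed_disc.
  - exact: measurable_unit_disc.
  - exact: measurable_wstar_plane.
  - by move=> z _; exact: wstar_ge0.
have pn : (pi : R) != 0 by rewrite gt_eqF ?pi_gt0.
rewrite -EFinM lee_fin exprMn e1E (_ : pi^-1 * (2 * pi * T) = 2 * T); last first.
  by rewrite (mulrC 2 pi) -!mulrA mulKf.
rewrite le_eqVlt; apply/orP; left; apply/eqP; field.
by rewrite gt_eqF.
Qed.

End dilation_total.

(** * Convergence in norm *)

Section norm.
Context {R : realType}.
Local Notation C := (Cplx R).
Local Notation T2 := (measurableTypeR R * measurableTypeR R)%type.
Local Arguments modulus : simpl never.
Local Arguments plane : simpl never.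

Lemma full_arc : arc_of_length (cis @` `[0, (0 + 2 * pi)] : set C) (2 * pi).
Proof.
split; first by rewrite lexx pi2_gt0.
by exists 0, (`[0, (0 + 2 * pi)]%classic); split => //; exact: arc_full.
Qed.

Variable w : C -> R.
Hypothesis hw : continuous_radial_weight w.

Lemma energy_ge0 phi S : (0 <= energy w phi S)%E.
Proof. by apply: integral_ge0 => p _; exact: density_ge0. Qed.

Lemma energy_ext phi psi S : (forall z, S z -> phi z = psi z) ->
  energy w phi S = energy w psi S.
Proof.
move=> h; apply: eq_integral => p; rewrite inE => Sp.
by rewrite /density h.
Qed.

Lemma quotient_ge0 f (I : set C) l : arc_of_length I l -> (0 <= carleson_quotient w f I l)%E.
Proof.
move=> hI; rewrite /carleson_quotient (weight_arc hw hI) inver.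
have m0 := mass_gt0 hw (arc_gt0 hI); rewrite gt_eqF//.
apply: mule_ge0; last by rewrite lee_fin invr_ge0 ltW.
exact: energy_ge0.
Qed.

Definition quotients f : set (\bar R) :=
  [set q | exists I l, arc_of_length I l /\ q = carleson_quotient w f I l].

Lemma quotients_sup_ge0 f : (0 <= ereal_sup (quotients f))%E.
Proof.
apply: le_trans (quotient_ge0 f full_arc) _; apply: ereal_sup_ubound.
by exists (cis @` `[0, (0 + 2 * pi)]), (2 * pi); split => //; exact: full_arc.
Qed.

Lemma C1_norm_le f (c : R) : 0 <= c ->
  (C1_norm w f <= (Num.sqrt c)%:E)%E ->
  modulus (f 0) ^+ 2 <= c /\
  forall I l, arc_of_length I l -> (carleson_quotient w f I l <= c%:E)%E.
Proof.
move=> c0; rewrite -[(Num.sqrt c)%:E]/(sqrte c%:E) lee_sqrt ?lee_fin// -/(quotients f).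
have s0 := quotients_sup_ge0 f.
move=> h; split.
  by rewrite -lee_fin; apply: le_trans h; rewrite leeDl.
move=> I l hI; apply: (@le_trans _ _ (ereal_sup (quotients f))).
  by apply: ereal_sup_ubound; exists I, l.
by apply: le_trans h; rewrite leeDr// lee_fin sqr_ge0.
Qed.

Lemma C1_norm_bound f (c : R) : 0 <= c -> modulus (f 0) ^+ 2 <= c ->
  (forall I l, arc_of_length I l -> (carleson_quotient w f I l <= c%:E)%E) ->
  (C1_norm w f <= (Num.sqrt (2 * c))%:E)%E.
Proof.
move=> c0 h0 h; rewrite -[(Num.sqrt _)%:E]/(sqrte (2 * c)%:E).
rewrite lee_sqrt ?lee_fin ?mulr_ge0// (_ : 2 * c = c + c); last by ring.
rewrite EFinD; apply: leeD; first by rewrite lee_fin.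
by apply: ge_ereal_sup => q [I [l [hI ->]]]; exact: h.
Qed.

(** Convergence to [0] in norm, freed from the supremum and the square root: one
    bound for all the squares at once. *)
Lemma C1_norm_cvg0 (T : Type) (F : set_system T) (f : T -> C -> C) : Filter F ->
  (C1_norm w (f x) @[x --> F] --> 0%E) <->
  forall e : R, 0 < e -> \forall x \near F,
    modulus (f x 0) ^+ 2 <= e /\
    forall I l, arc_of_length I l -> (carleson_quotient w (f x) I l <= e%:E)%E.
Proof.
move=> FF; split=> [h e e0|h A].
  have s0 : ((0 : R)%:E < (Num.sqrt e)%:E)%E by rewrite lte_fin sqrtr_gt0.
  have : \forall x \near F, (C1_norm w (f x) < (Num.sqrt e)%:E)%E.
    exact: (h [set x | (x < (Num.sqrt e)%:E)%E] (open_ereal_lt' s0)).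
  by apply: filterS => x /ltW; apply: C1_norm_le; exact: ltW.
move=> nA; have /nbhs_ballP[d /= d0 hd] : nbhs (0 : R) (fun r => A r%:E) by exact: nA.
have q0 : 0 < d ^+ 2 / 8 by rewrite divr_gt0// exprn_gt0.
apply: filterS (h _ q0) => x [h1 h2] /=.
have := C1_norm_bound (ltW q0) h1 h2.
have n0 : (0 <= C1_norm w (f x))%E by exact: sqrte_ge0.
rewrite (_ : 2 * _ = (d / 2) ^+ 2); last by field.
rewrite sqrtr_sqr ger0_norm; last by rewrite divr_ge0// ltW.
case: (C1_norm w (f x)) n0 hd => [y||] // y0 hd; rewrite lee_fin => yd.
rewrite lee_fin in y0; apply: hd; rewrite -ball_normE /= sub0r normrN ger0_norm//; lra.
Qed.

Lemma C1_energy_finite g : C1 w g -> (energy w (derive1 g) unit_disc < +oo)%E.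
Proof.
move=> [_]; rewrite /C1_norm -/(quotients g) => h.
have fq := full_arc; have s0 := quotients_sup_ge0 g.
have qs : (carleson_quotient w g (cis @` `[0%R, (0 + 2 * pi)%R]) (2 * pi)%R <= ereal_sup (quotients g))%E.
  by apply: ereal_sup_ubound; exists (cis @` `[0, (0 + 2 * pi)]), (2 * pi).
move: s0 qs h; case: (ereal_sup (quotients g)) => [y||] // _ qs _.
by move: qs; rewrite (quotient_le hw g y fq) full_square => /le_lt_trans; apply; rewrite ltry.
Qed.

Lemma holomorphic_disc_cderiv (g : C -> C) (z : C) : holomorphic_disc g -> modulus z < 1 ->
  cderiv g z (derive1 g z).
Proof. by move=> hg z1; apply: derivable_cderiv; exact: hg. Qed.

(** Approximation of [g] together with its derivative. *)
Lemma derive_poly_limit (g : C -> C) : holomorphic_disc g -> poly_limit (derive1 g).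
Proof.
move=> hg r e r0 r1 e0.
have [|P hP] := @holomorphic_poly_approx1 R g 1 r e r0 r1 e0.
  by move=> z z1; exists (derive1 g z); exact: holomorphic_disc_cderiv.
by exists P^`() => z /hP[].
Qed.

Lemma derive1B_horner (g : C -> C) (P : {poly C}) (z : C) : holomorphic_disc g -> unit_disc z ->
  derive1 (fun z => g z - P.[z]) z = derive1 g z - P^`().[z].
Proof.
move=> hg z1; apply: cderiv_derive1; apply: cderivB; last exact: cderiv_horner.
exact: holomorphic_disc_cderiv.
Qed.

Lemma disc_dilate r (z : C) : 0 <= r <= 1 -> unit_disc z -> unit_disc (ofR r * z).
Proof.
move=> /andP[r0 r1]; rewrite /unit_disc /= modulusM modulus_ofR ger0_norm//.
by move=> z1; have := modulus_ge0 z; nra.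
Qed.

Lemma derive1B_dilate (g : C -> C) (r : R) (z : C) : holomorphic_disc g -> 0 <= r <= 1 -> unit_disc z ->
  derive1 (fun z => g z - dilate r g z) z = derive1 g z - ofR r * dilate r (derive1 g) z.
Proof.
move=> hg r01 z1; apply: cderiv_derive1; apply: cderivB; first exact: holomorphic_disc_cderiv.
rewrite mulrC; apply: cderiv_scale; apply: holomorphic_disc_cderiv => //.
exact: disc_dilate.
Qed.

Lemma mass_nondecreasing l l' : 0 < l -> l <= l' -> mass w l <= mass w l'.
Proof.
move=> l0 ll; rewrite /mass; apply: ler_wpM2l; first by rewrite invr_ge0 pi_ge0.
have i1 := inner_radius_lt1 l0.
have t0 : 0 < tail w (inner_radius l) by apply: (tail_gt0 hw) => //; exact: inner_radius_ge0.
apply: ler_pM => //; [exact: ltW|exact: ltW|].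
apply: (tail_nonincreasing hw) => //; first exact: inner_radius_ge0.
rewrite /inner_radius; apply: le_max2 => //; lra.
Qed.

(** Hence a uniformly small derivative has uniformly small quotients. Long arcs
    are compared with the whole disc. *)
Lemma wstar_square_mass : exists2 K : R, 0 < K & forall I l, arc_of_length I l ->
  (area_integral (carleson_square I l) (wstar w) <= (K * mass w l)%:E)%E.
Proof.
have t0 : 0 < tail w 0 by apply: (tail_gt0 hw).
have t2 : 0 < tail w 2^-1 by apply: (tail_gt0 hw); lra.
have k0 : 0 < tail w 0 / tail w 2^-1 by exact: divr_gt0.
exists (1 + tail w 0 / tail w 2^-1) => [|I l hI]; first by lra.
have l0 := arc_gt0 hI; have m0 := mass_gt0 hw l0.
have [lh|lh] := leP l 2^-1.
  apply: le_trans (wstar_square_small hw hI lh) _; rewrite lee_fin; apply: ler_wpM2r; first exact: ltW.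
  nra.
apply: le_trans (wstar_square_total hw hI) _; rewrite lee_fin.
rewrite /mass [leRHS]mulrCA; apply: ler_wpM2l; first by rewrite invr_ge0 pi_ge0.
rewrite [leRHS]mulrCA; apply: ler_wpM2l; first exact: ltW.
have i0 := inner_radius_ge0 l; have i1 := inner_radius_lt1 l0.
have ti : tail w 2^-1 <= tail w (inner_radius l).
  apply: (tail_nonincreasing hw) => //; last by lra.
  by rewrite /inner_radius ge_max; apply/andP; split; lra.
apply: (@le_trans _ _ (tail w 0 / tail w 2^-1 * tail w 2^-1)); first by rewrite divfK// gt_eqF.
by apply: ler_pM => //; [exact: ltW|exact: ltW|lra].
Qed.

End norm.

(** * The three conditions *)

Section main.
Context {R : realType}.
Local Notation C := (Cplx R).
Local Notation T2 := (measurableTypeR R * measurableTypeR R)%type.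
Local Arguments modulus : simpl never.
Local Arguments plane : simpl never.
Variable w : C -> R.

Definition vanishing (phi : C -> C) := forall e : R, 0 < e -> exists2 d : R, 0 < d &
  forall I l, arc_of_length I l -> l < d ->
    (energy w phi (carleson_square I l) <= (e * mass w l)%:E)%E.

(** Three ranges of squares. For lengths bounded below, the energy over the
    whole disc is small by [energy_total_dilate]. For short arcs the functions
    [phi] and [dilate r phi] are estimated separately, the latter by
    [energy_dilate_large] if [1 - r <= l] and by [energy_dilate_small]
    otherwise; the doubling constants [D2] and [D] compare the masses involved.
    *)
Lemma dilation_energy_const (phi : C -> C) : class_I w \/ class_R w -> poly_limit phi ->
  (energy w phi unit_disc < +oo)%E -> vanishing phi ->
  exists2 K : R, 0 < K & forall e : R, 0 < e -> exists2 d : R, 0 < d &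
    forall r, 1 - d < r < 1 -> forall I l, arc_of_length I l ->
    (energy w (fun z => phi z - ofR r * dilate r phi z)%R (carleson_square I l) <=
     (K * (e * mass w l))%:E)%E.
Proof.
move=> /class_tail_doubling[hw [r0 /andP[r01 r02] dbl]] hphi fin van.
have [D2 D20 hD2] := dbl 2^-1 ltac:(lra) ltac:(lra).
have [D D0 hD] := dbl 12^-1 ltac:(lra) ltac:(lra).
exists (2 * (1 + 8 * D2 + 3072 * D)) => [|e1 e10]; first by lra.
have [d0 d00 hd0] := van e1 e10.
pose d1 := Num.min (d0 / 4) (Num.min ((1 - r0) / 4) 16^-1).
have d10 : 0 < d1 by rewrite !lt_min; apply/and3P; split; lra.
have md0 := mass_gt0 hw d10.
have [d2 d20 hd2] := energy_total_dilate hw hphi (mulr_gt0 e10 md0) fin.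
have [d1a [d1b d1c]] : d1 <= d0 / 4 /\ d1 <= (1 - r0) / 4 /\ d1 <= 16^-1.
  by have := lexx d1; rewrite {2}/d1 !le_min => /and3P[].
clearbody d1.
exists (Num.min d1 d2) => [|r /andP[+ r1] I l hI]; first by rewrite lt_min d10.
rewrite ltrBlDr addrC -ltrBlDr lt_min => /andP[hr1 hr2].
have l0 := arc_gt0 hI; have ml0 := mass_gt0 hw l0.
have em : [/\ 0 < e1 * mass w l, 0 < D2 * (e1 * mass w l) & 0 < D * (e1 * mass w l)].
  have em0 := mulr_gt0 e10 ml0.
  by split=> //; apply: mulr_gt0.
have r12 : 2^-1 <= r < 1 by apply/andP; split; lra.
have rr : 0 <= r <= 1 by apply/andP; split; lra.
have hd := poly_limit_dilate rr hphi.
have hdiff := poly_limitB hphi (poly_limitZ rr hd).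
have mS := square_measurable hI; have SD := @square_sub_disc R I l.
have [ld|ld] := leP d1 l.
  apply: (@le_trans _ _ (e1 * mass w d1)%:E).
    apply: le_trans (hd2 r _); last by apply/andP; split; lra.
    apply: area_integral_subset => //.
    - exact: measurable_unit_disc.
    - exact: measurable_density.
    - by move=> z _; exact: density_ge0.
  have : e1 * mass w d1 <= e1 * mass w l.
    by apply: ler_wpM2l; [exact: ltW|exact: mass_nondecreasing].
  by rewrite lee_fin => /le_trans; apply; case: em => em0 p0 p1; clear -em0 p0 p1; lra.
have Q1 := hd0 I l hI ltac:(lra).
have Q2 : (energy w (dilate r phi) (carleson_square I l) <=
    ((8 * D2 + 3072 * D) * (e1 * mass w l))%:E)%E.
  have [rl|rl] := leP (1 - r) l.
    have [I' [hI' hE]] := energy_dilate_large hw hphi hI ltac:(lra) r12 rl.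
    have hE2 := hd0 I' (2 * l) hI' ltac:(lra).
    apply: le_trans hE _; apply: le_trans (lee_wpmul2l _ hE2) _ => //.
    have m2 : mass w (2 * l) <= 2 * D2 * mass w l.
      rewrite /mass !inner_radius_small; try lra.
      have t1 := hD2 (1 - 2 * l) ltac:(apply/andP; split; lra).
      have tE : 1 - 2^-1 * (1 - (1 - 2 * l)) = 1 - l by field.
      rewrite tE in t1; rewrite [leRHS]mulrCA.
      apply: ler_wpM2l; first by rewrite invr_ge0 pi_ge0.
      have := ler_wpM2l (ltW l0) t1; lra.
    have m3 := ler_wpM2l (ltW e10) m2.
    by rewrite -EFinM lee_fin; case: em => em0 p0 p1; clear -m3 em0 p0 p1; lra.
  have hE2 (I' : set C) : arc_of_length I' (3 * (1 - r)) ->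
      (energy w phi (carleson_square I' (3 * (1 - r))) <= (e1 * mass w (3 * (1 - r)))%:E)%E.
    by move=> hI'; apply: hd0 => //; lra.
  have t1 := hD (1 - 3 * (1 - r)) ltac:(apply/andP; split; lra).
  have tE : 1 - 12^-1 * (1 - (1 - 3 * (1 - r))) = 1 - (1 - r) / 4 by field.
  rewrite tE in t1.
  have := @energy_dilate_small R w hw phi (1 - r) l e1 D I hphi ltac:(lra) ltac:(lra)
     (ltW e10) (ltW D0) hE2 t1 hI (ltW rl).
  rewrite (_ : 1 - (1 - r) = r); last by ring.
  by move/le_trans; apply; rewrite lee_fin; case: em => em0 p0 p1; clear -em0 p0 p1; lra.
apply: le_trans (energy_le_sum hw mS SD hdiff hphi hd _) _.
  move=> z _; apply: le_trans (modulusB _ _) _; rewrite lerD2l modulusM modulus_ofR ger0_norm; last lra.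
  by have := modulus_ge0 (dilate r phi z); nra.
apply: (@le_trans _ _ (2%:E * (e1 * mass w l)%:E + 2%:E * ((8 * D2 + 3072 * D) * (e1 * mass w l))%:E)%E).
  by apply: leeD; apply: lee_wpmul2l.
by rewrite -!EFinM -EFinD lee_fin; case: em => em0 p0 p1; clear -em0 p0 p1; lra.
Qed.

Lemma dilation_energy (phi : C -> C) : class_I w \/ class_R w -> poly_limit phi ->
  (energy w phi unit_disc < +oo)%E -> vanishing phi ->
  forall e : R, 0 < e -> exists2 d : R, 0 < d & forall r, 1 - d < r < 1 ->
    forall I l, arc_of_length I l ->
    (energy w (fun z => phi z - ofR r * dilate r phi z)%R (carleson_square I l) <=
     (e * mass w l)%:E)%E.
Proof.
move=> hw hphi fin van e e0; have [K K0 hK] := dilation_energy_const hw hphi fin van.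
have [d d0 hd] := hK (e / K) (divr_gt0 e0 K0); exists d => // r hr I l hI.
by apply: le_trans (hd r hr I l hI) _; rewrite mulrCA mulrA mulrC divfK ?lt0r_neq0// mulrC.
Qed.

Hypothesis hw : continuous_radial_weight w.

Lemma horner_bounded (P : {poly C}) : exists2 M : R, 0 <= M &
  forall z, unit_disc z -> modulus P.[z] <= M.
Proof.
have [K K0 hK] := poly_dilate_lipschitz P; exists K => // z z1.
by have [] := hK z 1 (ltW z1) ltac:(by rewrite ler01 lexx).
Qed.

(** The derivative of a polynomial is bounded, so it satisfies the vanishing
    condition by [wstar_square_small], and the condition is closed under uniform
    approximation of the quotients. *)
Lemma poly_approx_vanishing (g : C -> C) : holomorphic_disc g ->
  (forall e : R, 0 < e -> exists P : {poly C}, forall I l, arc_of_length I l ->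
     (carleson_quotient w (fun z => g z - P.[z])%R I l <= e%:E)%E) ->
  C1_0 w g.
Proof.
move=> hg hP; split=> // e e0.
have [P {}hP] := hP (e / 8) ltac:(lra).
have [M M0 hM] := horner_bounded P^`().
have M1 : 0 < 16 * (M ^+ 2 + 1) by have := sqr_ge0 M; lra.
exists (Num.min 2^-1 (e / (16 * (M ^+ 2 + 1)))) => [|I l hI].
  by rewrite lt_min divr_gt0// andbT; lra.
rewrite lt_min => /andP[l2]; rewrite ltr_pdivlMr// => lM.
have l0 := arc_gt0 hI; have ml0 := mass_gt0 hw l0.
rewrite (quotient_lt hw g e hI).
have hphi := derive_poly_limit hg; have hp := poly_limit_horner P^`().
have hd := poly_limitB hphi hp.
have mS := square_measurable hI; have SD := @square_sub_disc R I l.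
apply: le_lt_trans (energy_le_sum hw mS SD hphi hd hp _) _.
  by move=> z _; apply: le_trans (modulusD _ _); rewrite subrK.
have Q1 := hP I l hI; rewrite (quotient_le hw _ _ hI) in Q1.
rewrite (energy_ext w (fun z Sz => derive1B_horner P hg (SD z Sz))) in Q1.
have Q2 : (energy w (fun z => P^`().[z]) (carleson_square I l) <= (M ^+ 2 * (2 * l ^+ 2 * mass w l))%:E)%E.
  apply: le_trans (energy_le_bound hw mS SD hp (sqr_ge0 M) _) _.
    by move=> z /SD /hM h; rewrite ler_pXn2r ?nnegrE ?modulus_ge0.
  rewrite [leRHS]EFinM; apply: lee_wpmul2l; first by rewrite lee_fin sqr_ge0.
  by apply: wstar_square_small => //; exact: ltW.
apply: (@le_lt_trans _ _ (2%:E * (e / 8 * mass w l)%:E + 2%:E * (M ^+ 2 * (2 * l ^+ 2 * mass w l))%:E)%E).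
  by apply: leeD; apply: lee_wpmul2l.
rewrite -!EFinM -EFinD lte_fin.
have h1 : M ^+ 2 * l ^+ 2 <= M ^+ 2 * l by apply: ler_wpM2l; [exact: sqr_ge0|nra].
have h2 : 16 * (M ^+ 2 * l ^+ 2) <= e by have := sqr_ge0 M; nra.
have := ler_wpM2r (ltW ml0) h2; have := mulr_gt0 e0 ml0; lra.
Qed.

(** The function [g] is approximated with its derivative on the disc of radius
    [r]; rescaling, [dilate r g] is approximated on the whole unit disc, where
    uniform bounds control the quotients by [wstar_square_mass]. *)
Lemma dilation_poly_approx (g : C -> C) (r e : R) : holomorphic_disc g -> 0 < r < 1 -> 0 < e ->
  (forall I l, arc_of_length I l ->
     (carleson_quotient w (fun z => g z - dilate r g z)%R I l <= (e / 8)%:E)%E) ->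
  exists P : {poly C}, modulus (g 0 - P.[0]) ^+ 2 <= e /\
    forall I l, arc_of_length I l ->
     (carleson_quotient w (fun z => g z - P.[z])%R I l <= e%:E)%E.
Proof.
move=> hg /andP[r0 r1] e0 hQ.
have [K K0 hK] := wstar_square_mass hw.
have K8 : 0 < 8 * (K + 1) by lra.
have [e1 e10 e1E] : exists2 e1, 0 < e1 & e1 ^+ 2 * (8 * (K + 1)) = e.
  move: (8 * _) K8 => c c0; exists (Num.sqrt (e / c)); first by rewrite sqrtr_gt0 divr_gt0.
  by rewrite sqr_sqrtr ?divfK ?lt0r_neq0// divr_ge0// ltW.
have [|P hP] := @holomorphic_poly_approx1 R g 1 r e1 r0 r1 e10.
  by move=> z z1; exists (derive1 g z); exact: holomorphic_disc_cderiv.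
have r01 : 0 <= r <= 1 by rewrite !ltW.
have sqe : 0 <= e1 ^+ 2 := sqr_ge0 e1.
pose Q := P \Po (ofR r *: 'X).
have QE z : Q.[z] = P.[ofR r * z] by rewrite horner_comp hornerZ hornerX.
have dQE z : Q^`().[z] = ofR r * P^`().[ofR r * z].
  by rewrite /Q deriv_comp hornerM horner_comp derivZ derivX !hornerZ hornerX hornerC mulr1 mulrC.
exists Q; split.
  have [h _] := hP 0 ltac:(by rewrite modulus0 ltW).
  rewrite QE mulr0; apply: (@le_trans _ _ (e1 ^+ 2)).
    by rewrite ler_pXn2r ?nnegrE ?modulus_ge0// ltW.
  have := mulr_ge0 sqe (ltW K0); lra.
move=> I l hI; have l0 := arc_gt0 hI; have ml0 := mass_gt0 hw l0.
have hphi := derive_poly_limit hg; have hp := poly_limit_horner Q^`().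
have hd := poly_limit_dilate r01 hphi.
have hrd := poly_limitZ r01 hd.
have h1 := poly_limitB hphi hrd; have h2 := poly_limitB hrd hp; have h3 := poly_limitB hphi hp.
have mS := square_measurable hI; have SD := @square_sub_disc R I l.
rewrite (quotient_le hw _ _ hI) (energy_ext w (fun z Sz => derive1B_horner Q hg (SD z Sz))).
have Q1 := hQ I l hI; rewrite (quotient_le hw _ _ hI) in Q1.
rewrite (energy_ext w (fun z Sz => derive1B_dilate hg r01 (SD z Sz))) in Q1.
apply: le_trans (energy_le_sum hw mS SD h3 h1 h2 _) _.
  by move=> z _; apply: le_trans (modulusD _ _); rewrite addrA subrK.
have Q2 : (energy w (fun z => ofR r * dilate r (derive1 g) z - Q^`().[z])%R (carleson_square I l) <=
    (e1 ^+ 2 * (K * mass w l))%:E)%E.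
  apply: le_trans (energy_le_bound hw mS SD h2 sqe _) _.
    move=> z /SD z1; rewrite ler_pXn2r ?nnegrE ?modulus_ge0 ?(ltW e10)//.
    have zr : modulus (ofR r * z) <= r.
      by rewrite modulusM modulus_ofR gtr0_norm//; move: z1; rewrite /unit_disc /=; nra.
    have [_ hz] := hP _ zr.
    rewrite dQE -mulrBr modulusM modulus_ofR gtr0_norm//.
    by have := modulus_ge0 (derive1 g (ofR r * z) - P^`().[ofR r * z]); rewrite /dilate; nra.
  rewrite [leRHS]EFinM; apply: lee_wpmul2l; first by rewrite lee_fin.
  exact: hK.
apply: (@le_trans _ _ (2%:E * (e / 8 * mass w l)%:E + 2%:E * (e1 ^+ 2 * (K * mass w l))%:E)%E).
  by apply: leeD; apply: lee_wpmul2l.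
rewrite -!EFinM -EFinD lee_fin.
have p1 : 0 <= e1 ^+ 2 * mass w l by apply: mulr_ge0 => //; exact: ltW.
have p2 : (e1 ^+ 2 * (8 * (K + 1))) * mass w l = e * mass w l by rewrite e1E.
have p3 := mulr_gt0 e0 ml0.
lra.
Qed.

Lemma near_leftP (P : R -> Prop) (x d : R) : 0 < d -> (forall r, x - d < r < x -> P r) ->
  \forall r \near x^'-, P r.
Proof.
move=> d0 h; near=> r; apply: h; apply/andP; split; last by near: r; exact: nbhs_left_lt.
by near: r; apply: nbhs_left_gt; lra.
Unshelve. all: by end_near. Qed.

End main.

Theorem proposition5p5 (R : realType) (w : Cplx R -> R) (g : Cplx R -> Cplx R)
    (hw : class_I w \/ class_R w) (hg : C1 w g) :
  (C1_0 w g <->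
   C1_norm w (fun z => g z - dilate r g z) @[r --> (1 : R)^'-] --> 0%E) /\
  (C1_norm w (fun z => g z - dilate r g z) @[r --> (1 : R)^'-] --> 0%E <->
   exists P : nat -> {poly Cplx R},
     C1_norm w (fun z => g z - (P n).[z]) @[n --> \oo] --> 0%E).
Proof.
have [cw _] := class_tail_doubling hw.
have [hol _] := hg; have fin := C1_energy_finite cw hg.
have dil := @C1_norm_cvg0 R w cw R (1 : R)^'- (fun r z => g z - dilate r g z) _.
have i_ii : C1_0 w g -> C1_norm w (fun z => g z - dilate r g z) @[r --> (1 : R)^'-] --> 0%E.
  move=> [_ van]; apply/dil => e e0.
  have [|d d0 hd] := dilation_energy hw (derive_poly_limit hol) fin _ e0.
    move=> e' e'0; have [d d0 hd] := van e' e'0; exists d => // I l hI ld.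
    by rewrite -(quotient_le cw g e' hI) ltW// hd.
  apply: (@near_leftP R _ _ (Num.min d 1)); first by rewrite lt_min d0 /=.
  move=> r /andP[+ r1]; rewrite ltrBlDr addrC -ltrBlDr lt_min => /andP[rd r0].
  split; first by rewrite /dilate mulr0 subrr modulus0 expr0n /= ltW.
  move=> I l hI; rewrite (quotient_le cw _ _ hI).
  have r01 : 0 <= r <= 1 by apply/andP; split; lra.
  rewrite (energy_ext w (fun z Sz => derive1B_dilate hol r01 (@square_sub_disc R I l z Sz))).
  by apply: hd => //; apply/andP; split; lra.
have ii_iii : C1_norm w (fun z => g z - dilate r g z) @[r --> (1 : R)^'-] --> 0%E ->
    exists P : nat -> {poly Cplx R}, C1_norm w (fun z => g z - (P n).[z]) @[n --> \oo] --> 0%E.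
  move=> /dil h.
  have ex (n : nat) : exists P : {poly Cplx R}, modulus (g 0 - P.[0]) ^+ 2 <= n.+1%:R^-1 /\
      forall I l, arc_of_length I l ->
      (carleson_quotient w (fun z => g z - P.[z])%R I l <= (n.+1%:R^-1)%:E)%E.
    have n0 : 0 < n.+1%:R^-1 :> R by rewrite invr_gt0.
    have n8 : 0 < n.+1%:R^-1 / 8 :> R by exact: divr_gt0.
    have FF : Filter (1 : R)^'- by exact: _.
    have hr := @filterI _ _ FF _ _ (@filterI _ _ FF _ _ (h _ n8) (nbhs_left_gt (@ltr01 R))) (nbhs_left_lt (1 : R)).
    have [r [[[_ hQ] r0] r1]] := filter_ex hr.
    by apply: (dilation_poly_approx cw hol _ n0 hQ); rewrite r0.
  have [P hP] := choice ex; exists P.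
  apply/(@C1_norm_cvg0 R w cw nat \oo (fun n z => g z - (P n).[z]) _) => e e0.
  have [N hN] := ltr_add_invr e0; rewrite add0r in hN.
  exists N => // n /= Nn; have [h1 h2] := hP n.
  have ne : n.+1%:R^-1 <= e.
    by apply: le_trans (ltW hN); rewrite lef_pV2 ?posrE// ler_nat.
  split; first exact: le_trans h1 ne.
  by move=> I l hI; apply: le_trans (h2 I l hI) _; rewrite lee_fin.
have iii_i : (exists P : nat -> {poly Cplx R},
    C1_norm w (fun z => g z - (P n).[z]) @[n --> \oo] --> 0%E) -> C1_0 w g.
  move=> [P /(@C1_norm_cvg0 R w cw nat \oo (fun n z => g z - (P n).[z]) _) h].
  apply: (poly_approx_vanishing cw hol) => e e0.
  by have [n [_ hn]] := filter_ex (h e e0); exists (P n).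
by split; split; [exact: i_ii|move/ii_iii/iii_i|exact: ii_iii|move/iii_i/i_ii].
Qed.
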